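(* Let $\lambda\in\mathbb{R}$ and let $M$ be a rotational $\lambda$-translator in $\mathrm{Nil}_3$ that does not intersect the rotation axis. Then $M$ is either $\mathcal{C}_\lambda$, the vertical cylinder of constant mean curvature $\lambda$ and radius $1/(2\lambda)$, or $M$ is a properly immersed annulus with infinitely many self-intersections. In the latter case, one end has its third coordinate diverging to $\infty$, is embedded and converges to $\mathcal{C}_\lambda$; the other end has its third coordinate diverging to $-\infty$, has infinitely many self-intersections and its distance to the rotation axis is unbounded.
   Context: The Heisenberg space $\mathrm{Nil}_3$ is $\mathbb{R}^3$ with coordinates $(x,y,z)$ and metric $\langle\cdot,\cdot\rangle=dx^2+dy^2+(dz+\tau(y\,dx-x\,dy))^2$, where $\tau$ is a fixed constant. The mean curvature $H$ is half the trace of the second fundamental form with respect to the unit normal $N$. Given $\lambda\in\mathbb{R}$, an oriented surface $M$ in $\mathrm{Nil}_3$ is a $\lambda$-translator if $H(p)=\langle N(p),\partial_z\rangle+\lambda$ for all $p\in M$. A rotational surface is one invariant under the usual Euclidean rotations about the $z$-axis (the rotation axis), which are isometries of $\mathrm{Nil}_3$; it is parametrized as $\psi(s,t)=(x(s)\cos t,x(s)\sin t,z(s))$, where $\alpha(s)=(x(s),0,z(s))$ is its profile curve.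
   Formalization: M is assumed complete, with connected smooth profile (an open piece of the cylinder would refute the claim otherwise); λ ≠ 0, since the radius 1/(2λ) is undefined at λ = 0, and τ ≠ 0; for λ < 0 the radius is read as 1/(2|λ|). *)

(* Defs.v *)
From Stdlib Require Import Reals List.
From Coquelicot Require Import Coquelicot.
Open Scope R_scope.

(* Points and tangent vectors of R^3; a tangent vector at a point is given by
   its components in the coordinate frame (d/dx, d/dy, d/dz). *)
Definition R3 := (R * R * R)%type.

Inductive ix := ix_x | ix_y | ix_z.

Definition coord (i : ix) (p : R3) : R :=
  match i with ix_x => fst (fst p) | ix_y => snd (fst p) | ix_z => snd p end.

Definition basis (i : ix) : R3 :=
  match i with ix_x => (1, 0, 0) | ix_y => (0, 1, 0) | ix_z => (0, 0, 1) end.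

Definition sum3 (f : ix -> R) : R := f ix_x + f ix_y + f ix_z.

Definition d_z : R3 := basis ix_z.

Definition metric (tau : R) (p v w : R3) : R :=
  let '(x, y, _) := p in
  let '(v1, v2, v3) := v in
  let '(w1, w2, w3) := w in
  v1 * w1 + v2 * w2
  + (v3 + tau * (y * v1 - x * v2)) * (w3 + tau * (y * w1 - x * w2)).

Definition gcoef (tau : R) (i j : ix) (p : R3) : R :=
  metric tau p (basis i) (basis j).

Definition shift (p : R3) (k : ix) (u : R) : R3 :=
  let '(a, b, c) := p in
  match k with
  | ix_x => (a + u, b, c) | ix_y => (a, b + u, c) | ix_z => (a, b, c + u)
  end.

Definition d_gcoef (tau : R) (k i j : ix) (p : R3) : R :=
  Derive (fun u => gcoef tau i j (shift p k u)) 0.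

(* Christoffel symbols of the first kind of the Levi-Civita connection:
   [christoffel tau l i j p] is g(nabla_{d_i} d_j, d_l) at p. *)
Definition christoffel (tau : R) (l i j : ix) (p : R3) : R :=
  / 2 * (d_gcoef tau i l j p + d_gcoef tau j l i p - d_gcoef tau l i j p).

Definition smooth (f : R -> R) : Prop := forall (n : nat) (u : R), ex_derive_n f n u.

Definition C1 (f : R -> R) : Prop :=
  forall u, ex_derive f u /\ continuous (Derive f) u.

Definition C1_curve (c : R -> R3) : Prop := forall i, C1 (fun u => coord i (c u)).

Definition velocity (c : R -> R3) (u : R) : R3 :=
  (Derive (fun v => coord ix_x (c v)) u,
   Derive (fun v => coord ix_y (c v)) u,
   Derive (fun v => coord ix_z (c v)) u).

Definition curve_length (tau : R) (c : R -> R3) (a b : R) : R :=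
  RInt (fun u => sqrt (metric tau (c u) (velocity c u) (velocity c u))) a b.

Definition dist_to (tau : R) (p : R3) (S : R3 -> Prop) : Rbar :=
  Glb_Rbar (fun l => exists c : R -> R3,
    C1_curve c /\ c 0 = p /\ S (c 1) /\ l = curve_length tau c 0 1).

Definition partial_s (X : R -> R -> R3) (s t : R) : R3 := velocity (fun u => X u t) s.
Definition partial_t (X : R -> R -> R3) (s t : R) : R3 := velocity (fun u => X s u) t.

Definition immersion (X : R -> R -> R3) : Prop :=
  forall s t a b : R,
    (forall i, a * coord i (partial_s X s t) + b * coord i (partial_t X s t) = 0) ->
    a = 0 /\ b = 0.

(* [cov_inner tau p v w d n] is g(nabla_v W, n) at p, for a vector field W with
   value w at p and componentwise derivative d in the direction v. *)
Definition cov_inner (tau : R) (p v w d n : R3) : R :=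
  metric tau p d n
  + sum3 (fun l => sum3 (fun i => sum3 (fun j =>
      christoffel tau l i j p * coord i v * coord j w * coord l n))).

Definition unit_normal (tau : R) (X N : R -> R -> R3) : Prop :=
  (forall s t,
     metric tau (X s t) (N s t) (N s t) = 1 /\
     metric tau (X s t) (N s t) (partial_s X s t) = 0 /\
     metric tau (X s t) (N s t) (partial_t X s t) = 0) /\
  (forall q : R * R, continuous (fun q' : R * R => N (fst q') (snd q')) q).

(* Half the trace of the second fundamental form II(U,V) = g(nabla_U V, N) with
   respect to the first fundamental form (E, F, G). *)
Definition mean_curvature (tau : R) (X N : R -> R -> R3) (s t : R) : R :=
  let p := X s t in
  let Xs := partial_s X s t in
  let Xt := partial_t X s t in
  let E := metric tau p Xs Xs in
  let F := metric tau p Xs Xt in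
  let G := metric tau p Xt Xt in
  let e := cov_inner tau p Xs Xs (partial_s (partial_s X) s t) (N s t) in
  let f := cov_inner tau p Xs Xt (partial_s (partial_t X) s t) (N s t) in
  let g := cov_inner tau p Xt Xt (partial_t (partial_t X) s t) (N s t) in
  (e * G - 2 * f * F + g * E) / (2 * (E * G - F ^ 2)).

Definition translator (tau lam : R) (X N : R -> R -> R3) : Prop :=
  forall s t, mean_curvature tau X N s t = metric tau (X s t) (N s t) d_z + lam.

(* The profile curve is s |-> (x s, 0, z s). *)
Definition rot_surface (x z : R -> R) (s t : R) : R3 :=
  (x s * cos t, x s * sin t, z s).

Definition rotation_axis (p : R3) : Prop := coord ix_x p = 0 /\ coord ix_y p = 0.

(* The annulus R x S^1 inside R x R^2, and the map it induces into R^3: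
   rot_surface x z s t = annulus_map x z (s, (cos t, sin t)). *)
Definition annulus (q : R * (R * R)) : Prop :=
  fst (snd q) ^ 2 + snd (snd q) ^ 2 = 1.

Definition annulus_map (x z : R -> R) (q : R * (R * R)) : R3 :=
  let '(s, (c, d)) := q in (x s * c, x s * d, z s).

(* Completeness of the induced metric: every divergent curve of R x S^1 has
   infinite length.  A curve diverges iff |s| tends to infinity along it. *)
Definition complete_surface (tau : R) (x z : R -> R) : Prop :=
  forall sigma theta : R -> R, C1 sigma -> C1 theta ->
    is_lim (fun u => Rabs (sigma u)) p_infty p_infty ->
    is_lim (fun u => curve_length tau
              (fun v => rot_surface x z (sigma v) (theta v)) 0 u) p_infty p_infty.

Definition compact_set {U : UniformSpace} (K : U -> Prop) : Prop :=
  forall (I : Type) (V : I -> U -> Prop),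
    (forall i, open (V i)) ->
    (forall p, K p -> exists i, V i p) ->
    exists l : list I, forall p, K p -> exists i, In i l /\ V i p.

Definition properly_immersed_annulus (x z : R -> R) : Prop :=
  immersion (rot_surface x z) /\
  forall K : R3 -> Prop, compact_set K ->
    compact_set (fun q : R * (R * R) => annulus q /\ K (annulus_map x z q)).

(* p is the image of two distinct points of the part D x S^1 of the annulus. *)
Definition self_intersection (x z : R -> R) (D : R -> Prop) (p : R3) : Prop :=
  exists q1 q2 : R * (R * R),
    annulus q1 /\ annulus q2 /\ D (fst q1) /\ D (fst q2) /\ q1 <> q2 /\
    annulus_map x z q1 = p /\ annulus_map x z q2 = p.

(* By rotational invariance self-intersections come in whole circles around the
   axis; each circle meets the half-plane {y = 0, x > 0} once, so counting there
   counts circles rather than points. *)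
Definition infinitely_many_self_intersections (x z : R -> R) (D : R -> Prop) : Prop :=
  forall l : list R3, exists p : R3,
    coord ix_y p = 0 /\ 0 < coord ix_x p /\
    self_intersection x z D p /\ ~ In p l.

(* The ends of R x S^1 are s -> +oo and s -> -oo; the sets D x S^1 with
   [Rbar_locally e D] are the neighbourhoods of the end e. *)
Definition opposite_ends (e1 e2 : Rbar) : Prop :=
  (e1 = p_infty /\ e2 = m_infty) \/ (e1 = m_infty /\ e2 = p_infty).

(* Injective, and a homeomorphism onto its image. *)
Definition embedded_on (x z : R -> R) (D : R -> Prop) : Prop :=
  (forall p, ~ self_intersection x z D p) /\
  (forall (q : R * (R * R)) (V : R * (R * R) -> Prop),
     annulus q -> D (fst q) -> locally q V ->
     exists W : R3 -> Prop, locally (annulus_map x z q) W /\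
       forall q', annulus q' -> D (fst q') -> W (annulus_map x z q') -> V q').

Definition embedded_end (x z : R -> R) (e : Rbar) : Prop :=
  exists D : R -> Prop, Rbar_locally e D /\ embedded_on x z D.

(* The vertical cylinder of radius 1/(2|lam|). *)
Definition cylinder (lam : R) (p : R3) : Prop :=
  coord ix_x p ^ 2 + coord ix_y p ^ 2 = (/ (2 * lam)) ^ 2.

Definition is_cylinder (tau lam : R) (X N : R -> R -> R3) : Prop :=
  (forall p, cylinder lam p <-> exists s t, X s t = p) /\
  (forall s t, mean_curvature tau X N s t = lam).

(* C^1 convergence, uniform in t: the distance to the cylinder tends to 0 and the
   tangent planes tend to those of the cylinder, whose unit normal is the
   horizontal radial field (cos t, sin t, 0) up to sign. *)
Definition converges_to_cylinder (tau lam : R) (x z : R -> R) (N : R -> R -> R3)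
    (e : Rbar) : Prop :=
  forall eps : R, 0 < eps ->
    Rbar_locally e (fun s => forall t,
      Rbar_lt (dist_to tau (rot_surface x z s t) (cylinder lam)) eps /\
      Rabs (Rabs (metric tau (rot_surface x z s t) (N s t) (cos t, sin t, 0)) - 1) < eps).

Definition unbounded_distance_to_axis (tau : R) (x z : R -> R) (e : Rbar) : Prop :=
  forall (B : R) (D : R -> Prop), Rbar_locally e D ->
    exists s t, D s /\ Rbar_lt B (dist_to tau (rot_surface x z s t) rotation_axis).

(* Main.v *)
Require Import Defs.
From Stdlib Require Import Reals List Lra Psatz Classical ClassicalEpsilon.
From Coquelicot Require Import Coquelicot.
Open Scope R_scope.

(* Let [r = |x|], [w = sqrt (1 + tau^2 r^2)], [W^2 = w^2 x'^2 + z'^2], and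
   [(p, q) = (w r' / W, z' / W)], a point of the unit circle.  In the time with
   [dt = (W / w) ds] the translator equation becomes the planar system
   [r' = p, z' = w q, (p, q)' = (2 p / w + 2 mu - q / r) (- q, p)] with
   [mu = +- lam]; reversing the time changes the sign of [mu], so let [mu > 0].
   The Delaunay energy [J = r q - mu r^2] satisfies [J' = 2 r p^2 / w >= 0].

   Where [J] stays bounded below, [r] stays bounded, and Barbalat's lemma gives
   [r -> 1 / (2 mu)] and [q -> 1].  This always happens as [t -> +oo].  If it also
   happens as [t -> -oo], then [J] is constant and the surface is the cylinder.
   Otherwise [J -> -oo] and [r -> +oo] as [t -> -oo].  There the angle of [(p, q)]
   turns at speed close to [2 mu] while the height [z] has mean drift
   [|tau| / (2 mu)], so [z -> -oo]; and since [J] is monotone, the leftmost and the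
   rightmost points of consecutive loops of the profile curve move in the same
   direction, which forces neighbouring loops to cross. *)

(** * Real analysis *)

(** The time [t] is arc length in the orbit space of the rotations. Since [E G - F^2 = r^2 W^2] and
    [G = r^2 w^2], the component of the profile velocity orthogonal to the orbits has length
    [W / w], and the quotient metric is [dr^2 + dz^2 / w^2]. In this time [|r'| <= 1] and, because
    [r / w <= 1 / |tau|], the rate of [J] is at most [2 / |tau|] at every radius. This single bound
    excludes an escape in finite time, keeps [r] small against [|t|] in the past, and limits the
    change of [J] during one turn. Without [2 p / w], the contribution of [<N, d_z>], [J] would be a
    first integral, as it is for constant mean curvature profiles. The obstacle at the far end is
    that neighbouring loops nearly coincide: the drift in height per turn is bounded, while the
    height of one loop is of order [w], which is unbounded. The horizontal displacement of the loops
    is not estimated. Only its sign is used, read off from [J] at [q = 1] and [q = -1], and the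
    intermediate value theorem then supplies the crossings. *)

Lemma mean_value (f df : R -> R) (a b : R) :
  a < b -> (forall c, a <= c <= b -> is_derive f c (df c)) ->
  exists c, a < c < b /\ f b - f a = df c * (b - a).
Proof.
  intros Hab Hd.
  destruct (MVT_cor2 f df a b Hab) as [c [Hc1 Hc2]].
  - intros c Hc. apply is_derive_Reals. auto.
  - exists c; auto.
Qed.

Lemma increment_ge (f df : R -> R) (m a b : R) :
  a <= b -> (forall c, a <= c <= b -> is_derive f c (df c)) ->
  (forall c, a <= c <= b -> m <= df c) -> m * (b - a) <= f b - f a.
Proof.
  intros Hab Hd Hm. destruct (Req_dec a b) as [->|Hne]; [lra|].
  destruct (mean_value f df a b) as [c [Hc ->]]; [lra|assumption|].
  apply Rmult_le_compat_r; [lra|]. apply Hm; lra.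
Qed.

Lemma increment_le (f df : R -> R) (m a b : R) :
  a <= b -> (forall c, a <= c <= b -> is_derive f c (df c)) ->
  (forall c, a <= c <= b -> df c <= m) -> f b - f a <= m * (b - a).
Proof.
  intros Hab Hd Hm. destruct (Req_dec a b) as [->|Hne]; [lra|].
  destruct (mean_value f df a b) as [c [Hc ->]]; [lra|assumption|].
  apply Rmult_le_compat_r; [lra|]. apply Hm; lra.
Qed.

Lemma increment_abs (f df : R -> R) (L a b : R) :
  a <= b -> (forall c, a <= c <= b -> is_derive f c (df c)) ->
  (forall c, a <= c <= b -> Rabs (df c) <= L) -> Rabs (f b - f a) <= L * (b - a).
Proof.
  intros Hab Hd HL. apply Rabs_le. split.
  - replace (- (L * (b - a))) with ((- L) * (b - a)) by ring.
    apply (increment_ge f df); auto. intros c Hc. specialize (HL c Hc). apply Rabs_le_between in HL. lra.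
  - apply (increment_le f df); auto. intros c Hc. specialize (HL c Hc). apply Rabs_le_between in HL. lra.
Qed.

Lemma constant_of_derive (f : R -> R) :
  (forall t, is_derive f t 0) -> forall t, f t = f 0.
Proof.
  intros Hd t. destruct (Rle_lt_dec 0 t) as [Ht|Ht].
  - assert (H := increment_abs f (fun _ => 0) 0 0 t Ht (fun c _ => Hd c)
      ltac:(intros; cbv beta; rewrite Rabs_R0; lra)).
    rewrite Rmult_0_l in H. apply Rabs_le_between in H. lra.
  - assert (H := increment_abs f (fun _ => 0) 0 t 0 ltac:(lra) (fun c _ => Hd c)
      ltac:(intros; cbv beta; rewrite Rabs_R0; lra)).
    rewrite Rmult_0_l in H. apply Rabs_le_between in H. lra.
Qed.

Lemma is_lim_p_infty_0 (f : R -> R) :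
  is_lim f p_infty 0 <->
  forall eps, 0 < eps -> exists T, forall t, T <= t -> Rabs (f t) < eps.
Proof.
  split.
  - intros H eps He. apply is_lim_spec in H. destruct (H (mkposreal eps He)) as [M HM].
    exists (M + 1). intros t Ht. specialize (HM t). simpl in HM.
    rewrite Rminus_0_r in HM. apply HM. lra.
  - intros H. apply is_lim_spec. intros eps.
    destruct (H eps (cond_pos eps)) as [T HT]. exists T. intros t Ht.
    rewrite Rminus_0_r. apply HT. lra.
Qed.

(* Barbalat's lemma: each time [|b|] exceeds [eps] it stays above [eps/2] for a
   definite time, during which [J] gains a definite amount. *)
Lemma barbalat_square (J dJ b db : R -> R) (C L B : R) :
  0 < C -> 0 < L ->
  (forall t, 0 <= t -> is_derive J t (dJ t)) ->
  (forall t, 0 <= t -> is_derive b t (db t)) ->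
  (forall t, 0 <= t -> J t <= B) ->
  (forall t, 0 <= t -> (b t) ^ 2 <= C * dJ t) ->
  (forall t, 0 <= t -> Rabs (db t) <= L) ->
  is_lim b p_infty 0.
Proof.
  intros HC HL HJ Hb HB Hsq Hdb. apply is_lim_p_infty_0. intros eps Heps.
  set (h := eps / (2 * L)).
  assert (Hh : 0 < h) by (apply Rdiv_lt_0_compat; lra).
  set (gain := (eps / 2) ^ 2 / C * h).
  assert (Hgain : 0 < gain).
  { apply Rmult_lt_0_compat; [|assumption]. apply Rdiv_lt_0_compat; [|lra]. nra. }
  destruct (completeness (fun y => exists t, 0 <= t /\ y = J t)) as [m [Hm1 Hm2]].
  { exists B. intros y [t [Ht ->]]. auto. }
  { exists (J 0), 0. split; [lra|auto]. }
  assert (HT : exists T, 0 <= T /\ m - gain < J T).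
  { apply NNPP. intros Hn. assert (m <= m - gain); [|lra].
    apply Hm2. intros y [t [Ht ->]]. apply Rnot_lt_le. intros Hlt. apply Hn. now exists t. }
  destruct HT as [T [HT0 HT]]. exists T. intros t Ht.
  apply Rnot_le_lt. intros Hge.
  assert (Hmono : forall u v, 0 <= u <= v -> J u <= J v).
  { intros u v Huv. assert (0 * (v - u) <= J v - J u); [|lra].
    apply (increment_ge J dJ); [lra| |]; intros c Hc; [apply HJ; lra|].
    assert (H0 : (b c) ^ 2 <= C * dJ c) by (apply Hsq; lra).
    assert (0 <= (b c) ^ 2) by apply pow2_ge_0. nra. }
  assert (Hstep : (eps / 2) ^ 2 / C * (t + h - t) <= J (t + h) - J t).
  { apply (increment_ge J dJ); [lra| |]; intros c Hc; [apply HJ; lra|].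
    assert (Hc1 : Rabs (b c - b t) <= L * (c - t)).
    { apply (increment_abs b db); [lra| |]; intros u Hu; [apply Hb|apply Hdb]; lra. }
    assert (Hc2 : L * (c - t) <= eps / 2).
    { replace (eps / 2) with (L * h) by (unfold h; field; lra). nra. }
    assert (Hc3 : eps / 2 <= Rabs (b c)).
    { assert (H := Rabs_triang_inv (b t) (b t - b c)).
      rewrite <- Rabs_Ropp in Hc1. replace (- (b c - b t)) with (b t - b c) in Hc1 by ring.
      replace (b t - (b t - b c)) with (b c) in H by ring. lra. }
    apply Rmult_le_reg_l with C; [lra|].
    replace (C * ((eps / 2) ^ 2 / C)) with ((eps / 2) ^ 2) by (field; lra).
    eapply Rle_trans; [|apply Hsq; lra]. rewrite <- (pow2_abs (b c)).
    apply pow_incr; lra. }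
  replace (t + h - t) with h in Hstep by ring. fold gain in Hstep.
  assert (J (t + h) <= m) by (apply Hm1; exists (t + h); split; [lra|reflexivity]).
  assert (J T <= J t) by (apply Hmono; lra). lra.
Qed.

(** If [|f| >= eps] at a late time, the bound on [df] keeps [f] beyond [eps / 2], with the same
    sign, for the time [h]. As [|g| < eps / 4] there, [b] moves by at least [eps / 4 * h], whereas
    each of its two end values is smaller than half of that. *)
Lemma barbalat_derivative (b f g df : R -> R) (L : R) :
  0 < L ->
  (forall t, 0 <= t -> is_derive b t (f t + g t)) ->
  (forall t, 0 <= t -> is_derive f t (df t)) ->
  (forall t, 0 <= t -> Rabs (df t) <= L) ->
  is_lim b p_infty 0 -> is_lim g p_infty 0 -> is_lim f p_infty 0.
Proof.
  intros HL Hb Hf Hdf Lb Lg. rewrite is_lim_p_infty_0 in Lb, Lg. apply is_lim_p_infty_0.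
  intros eps Heps. set (h := eps / (2 * L)).
  assert (Hh : 0 < h) by (apply Rdiv_lt_0_compat; lra).
  destruct (Lg (eps / 4)) as [T1 HT1]; [lra|].
  destruct (Lb (eps / 4 * h / 2)) as [T2 HT2]; [nra|].
  exists (Rmax 0 (Rmax T1 T2)). intros t Ht.
  assert (H0 := Rmax_l 0 (Rmax T1 T2)). assert (H1 := Rmax_r 0 (Rmax T1 T2)).
  assert (H2 := Rmax_l T1 T2). assert (H3 := Rmax_r T1 T2).
  apply Rnot_le_lt. intros Hge.
  assert (Hclose : forall c, t <= c <= t + h -> Rabs (f c - f t) <= eps / 2 /\ Rabs (g c) < eps / 4).
  { intros c Hc. split; [|apply HT1; lra].
    assert (Rabs (f c - f t) <= L * (c - t)).
    { apply (increment_abs f df); [lra| |]; intros u Hu; [apply Hf|apply Hdf]; lra. }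
    replace (eps / 2) with (L * h) by (unfold h; field; lra). nra. }
  assert (B1 := HT2 t ltac:(lra)). assert (B2 := HT2 (t + h) ltac:(lra)).
  apply Rabs_lt_between in B1, B2.
  destruct (Rle_lt_dec 0 (f t)) as [Hs|Hs].
  - rewrite Rabs_right in Hge by lra.
    assert (eps / 4 * (t + h - t) <= b (t + h) - b t); [|nra].
    apply (increment_ge b (fun u => f u + g u)); [lra| |]; intros c Hc; [apply Hb; lra|].
    destruct (Hclose c Hc) as [Q1 Q2].
    apply Rabs_le_between in Q1. apply Rabs_lt_between in Q2. lra.
  - rewrite Rabs_left in Hge by lra.
    assert (b (t + h) - b t <= - (eps / 4) * (t + h - t)); [|nra].
    apply (increment_le b (fun u => f u + g u)); [lra| |]; intros c Hc; [apply Hb; lra|].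
    destruct (Hclose c Hc) as [Q1 Q2].
    apply Rabs_le_between in Q1. apply Rabs_lt_between in Q2. lra.
Qed.

Lemma increasing_inverse (f : R -> R) :
  (forall t, continuous f t) -> (forall a b, a < b -> f a < f b) ->
  (forall M, exists t, f t < M) -> (forall M, exists t, M < f t) ->
  exists g, (forall t, g (f t) = t) /\ (forall y, f (g y) = y) /\ (forall y, continuous g y).
Proof.
  intros Hc Hi Hlo Hhi.
  assert (Hs : forall y, exists t, f t = y).
  { intros y. destruct (Hlo y) as [a Ha]. destruct (Hhi y) as [b Hb].
    assert (Hab : a < b).
    { apply Rnot_le_lt. intros H. destruct H as [H| ->]; [apply Hi in H|]; lra. }
    destruct (IVT_gen f a b y) as [t [_ Ht]]; [|rewrite Rmin_left, Rmax_right by lra; lra|now exists t].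
    intros u. apply continuity_pt_filterlim, Hc. }
  set (g := fun y => proj1_sig (constructive_indefinite_description _ (Hs y))).
  assert (Hfg : forall y, f (g y) = y).
  { intros y. unfold g. now destruct constructive_indefinite_description. }
  assert (Hle : forall a b, f a < f b -> a < b).
  { intros a b H. apply Rnot_le_lt. intros H'. destruct H' as [H'| ->]; [apply Hi in H'|]; lra. }
  assert (Hgf : forall t, g (f t) = t).
  { intros t. assert (H := Hfg (f t)).
    destruct (Rtotal_order (g (f t)) t) as [H'|[H'|H']]; [apply Hi in H'; lra|assumption|apply Hi in H'; lra]. }
  exists g. repeat split; auto. intros y.
  apply filterlim_locally. intros eps.
  assert (He := cond_pos eps).
  assert (H1 : f (g y - eps) < y) by (rewrite <- (Hfg y) at 2; apply Hi; lra).
  assert (H2 : y < f (g y + eps)) by (rewrite <- (Hfg y) at 1; apply Hi; lra).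
  assert (Hd : 0 < Rmin (y - f (g y - eps)) (f (g y + eps) - y)) by (apply Rmin_pos; lra).
  exists (mkposreal _ Hd). intros v Hv.
  change (Rabs (v - y) < Rmin (y - f (g y - eps)) (f (g y + eps) - y)) in Hv.
  apply Rabs_lt_between in Hv.
  assert (M1 := Rmin_l (y - f (g y - eps)) (f (g y + eps) - y)).
  assert (M2 := Rmin_r (y - f (g y - eps)) (f (g y + eps) - y)).
  change (Rabs (g v - g y) < eps). apply Rabs_lt_between.
  assert (g y - eps < g v) by (apply Hle; rewrite Hfg; lra).
  assert (g v < g y + eps) by (apply Hle; rewrite Hfg; lra). lra.
Qed.

(** * The profile system *)

Definition warp (tau x : R) : R := sqrt (1 + tau ^ 2 * x ^ 2).

(** The angular velocity of [(p, q)] prescribed by the translator equation: [2 * p / warp tau x]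
    comes from [<N, d_z>], [2 * mu] from [lam], and [- q / x] from the rotation. *)
Definition turning (tau mu x p q : R) : R := 2 * p / warp tau x + 2 * mu - q / x.

(* [rho] is [dt/ds]: in the notation above, [W / w] for the parameter [s] and [1] for [t]. *)
Record flow (tau mu : R) (rho x z p q : R -> R) : Prop := {
  flow_pos : forall t, 0 < x t;
  flow_unit : forall t, p t ^ 2 + q t ^ 2 = 1;
  flow_x : forall t, is_derive x t (rho t * p t);
  flow_z : forall t, is_derive z t (rho t * (warp tau (x t) * q t));
  flow_p : forall t, is_derive p t (rho t * (- q t * turning tau mu (x t) (p t) (q t)));
  flow_q : forall t, is_derive q t (rho t * (p t * turning tau mu (x t) (p t) (q t)))
}.

Definition energy (mu x q : R) : R := x * q - mu * x ^ 2.

Lemma warp_arg_pos (tau x : R) : 0 < 1 + tau ^ 2 * x ^ 2.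
Proof.
  assert (0 <= (tau * x) ^ 2) by apply pow2_ge_0.
  replace (tau ^ 2 * x ^ 2) with ((tau * x) ^ 2) by ring. lra.
Qed.

Lemma warp_sqr (tau x : R) : warp tau x ^ 2 = 1 + tau ^ 2 * x ^ 2.
Proof. unfold warp. rewrite pow2_sqrt; [reflexivity|]. left. apply warp_arg_pos. Qed.

Lemma warp_pos (tau x : R) : 0 < warp tau x.
Proof. apply sqrt_lt_R0, warp_arg_pos. Qed.

Lemma warp_ge_1 (tau x : R) : 1 <= warp tau x.
Proof.
  assert (H := warp_sqr tau x). assert (H0 := warp_pos tau x).
  assert (0 <= (tau * x) ^ 2) by apply pow2_ge_0. nra.
Qed.

Lemma warp_ge (tau x : R) : 0 <= x -> Rabs tau * x <= warp tau x.
Proof.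
  intros Hx. assert (H := warp_sqr tau x). assert (H0 := warp_pos tau x).
  rewrite <- (pow2_abs tau) in H. assert (H1 := Rabs_pos tau). nra.
Qed.

Lemma warp_le (tau x : R) : 0 <= x -> warp tau x <= 1 + Rabs tau * x.
Proof.
  intros Hx. assert (H := warp_sqr tau x). assert (H0 := warp_pos tau x).
  rewrite <- (pow2_abs tau) in H. assert (H1 := Rabs_pos tau).
  assert (0 <= Rabs tau * x) by nra. nra.
Qed.

Lemma div_warp_le (tau x : R) : tau <> 0 -> 0 <= x -> x / warp tau x <= / Rabs tau.
Proof.
  intros Ht Hx. assert (H := warp_ge tau x Hx). assert (H0 := warp_pos tau x).
  assert (H1 := Rabs_pos_lt tau Ht).
  apply Rmult_le_reg_l with (Rabs tau * warp tau x); [nra|].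
  replace (Rabs tau * warp tau x * (x / warp tau x)) with (Rabs tau * x) by (field; lra).
  replace (Rabs tau * warp tau x * / Rabs tau) with (warp tau x) by (field; lra). lra.
Qed.

Lemma warp_sign (tau de x : R) : de ^ 2 = 1 -> warp tau (de * x) = warp tau x.
Proof. intros H. unfold warp. do 2 f_equal. rewrite Rpow_mult_distr, H. ring. Qed.

Lemma warp_derive (tau x : R) : is_derive (warp tau) x (tau ^ 2 * (x / warp tau x)).
Proof.
  assert (H1 := warp_pos tau x). unfold warp at 1. auto_derive.
  - apply warp_arg_pos.
  - replace (tau * (tau * 1) * (x * (x * 1))) with (tau ^ 2 * x ^ 2) by ring.
    fold (warp tau x). field. lra.
Qed.

Lemma abs_of_sqr_1 (y : R) : y ^ 2 = 1 -> Rabs y = 1.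
Proof. intros H. rewrite <- pow2_abs in H. assert (H0 := Rabs_pos y). nra. Qed.

Lemma unit_sqr_le (p q : R) : p ^ 2 + q ^ 2 = 1 -> p ^ 2 <= 1 /\ q ^ 2 <= 1 /\ -1 <= p <= 1 /\ -1 <= q <= 1.
Proof. intros H. assert (0 <= p ^ 2) by apply pow2_ge_0. assert (0 <= q ^ 2) by apply pow2_ge_0. repeat split; nra. Qed.

(* [auto_derive], with the derivatives of unknown functions read off the hypotheses. *)
Ltac derive_hyps :=
  auto_derive;
  [ repeat split; try (eexists; match goal with
     | D : forall t, is_derive ?f t _ |- is_derive ?f _ _ => apply D
     | D : forall t, is_derive ?f t _ |- is_derive (fun u => ?f u) _ _ => apply D end)
  | repeat match goal with
     | D : forall t, is_derive ?f t _ |- context [Derive (fun u => ?f u) ?s] =>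
         replace (Derive (fun u => f u) s) with (Derive f s) by reflexivity;
         rewrite (is_derive_unique f s _ (D s))
     | D : forall t, is_derive ?f t _ |- context [Derive ?f ?s] =>
         rewrite (is_derive_unique f s _ (D s)) end ].

Ltac flow_derive H :=
  let dx := fresh in let dz := fresh in let dp := fresh in let dq := fresh in
  pose proof (flow_x _ _ _ _ _ _ _ H) as dx; pose proof (flow_z _ _ _ _ _ _ _ H) as dz;
  pose proof (flow_p _ _ _ _ _ _ _ H) as dp; pose proof (flow_q _ _ _ _ _ _ _ H) as dq;
  derive_hyps; clear dx dz dp dq.

Section Flow.
Variables (tau mu : R) (rho x z p q : R -> R).
Hypothesis F : flow tau mu rho x z p q.

Lemma energy_derive t :
  is_derive (fun t => energy mu (x t) (q t)) t (rho t * (2 * (x t / warp tau (x t)) * p t ^ 2)).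
Proof.
  unfold energy. flow_derive F. unfold turning.
  assert (H := flow_pos _ _ _ _ _ _ _ F t). assert (H1 := warp_pos tau (x t)).
  field. lra.
Qed.

Lemma flow_xp_derive t :
  is_derive (fun t => x t * p t) t
    (rho t * (1 - 2 * mu * (x t * q t) - 2 * q t * (x t * p t) / warp tau (x t))).
Proof.
  flow_derive F. unfold turning.
  assert (H := flow_pos _ _ _ _ _ _ _ F t). assert (H1 := warp_pos tau (x t)).
  transitivity (rho t * ((p t ^ 2 + q t ^ 2) - 2 * mu * (x t * q t) - 2 * q t * (x t * p t) / warp tau (x t))).
  - field. lra.
  - rewrite (flow_unit _ _ _ _ _ _ _ F). ring.
Qed.

Lemma flow_xq_derive t :
  is_derive (fun t => x t * q t) t
    (rho t * (2 * (x t * p t) * (p t / warp tau (x t) + mu))).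
Proof.
  flow_derive F. unfold turning.
  assert (H := flow_pos _ _ _ _ _ _ _ F t). assert (H1 := warp_pos tau (x t)).
  field. lra.
Qed.

(* By the equation for [p], [warp * q] differs from [|tau| / (2 mu)] by a
   derivative and by terms of order [1 / x]. *)
Lemma height_derive t : mu <> 0 ->
  is_derive (fun t => 2 * mu * z t + warp tau (x t) * p t + q t ^ 2 / (2 * mu)) t
    (rho t * (tau ^ 2 * (x t / warp tau (x t)) * p t ^ 2 + warp tau (x t) / x t * q t ^ 2
       + p t * q t / mu * (2 * p t / warp tau (x t) - q t / x t))).
Proof.
  intros Hmu.
  assert (H1 := warp_pos tau (x t)). assert (H := flow_pos _ _ _ _ _ _ _ F t).
  pose proof (warp_derive tau) as dw. flow_derive F.
  unfold turning. field. lra.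
Qed.
End Flow.

(** The same curve traversed backwards: [p] and [q] change sign, and [mu] has to change sign with
    them for [turning] to do so. *)
Lemma flow_reverse (tau mu : R) (rho x z p q : R -> R) :
  flow tau mu rho x z p q ->
  flow tau (- mu) (fun t => rho (- t)) (fun t => x (- t)) (fun t => z (- t))
    (fun t => - p (- t)) (fun t => - q (- t)).
Proof.
  intros F. constructor.
  - intros t. apply F.
  - intros t. rewrite <- (flow_unit _ _ _ _ _ _ _ F (- t)). ring.
  - intros t. flow_derive F. ring.
  - intros t. flow_derive F. ring.
  - intros t. assert (H := flow_pos _ _ _ _ _ _ _ F (- t)). assert (H1 := warp_pos tau (x (- t))).
    flow_derive F. unfold turning. field. lra.
  - intros t. assert (H := flow_pos _ _ _ _ _ _ _ F (- t)). assert (H1 := warp_pos tau (x (- t))).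
    flow_derive F. unfold turning. field. lra.
Qed.

(** The energy bound gives [mu * x ^ 2 <= x + C], which fails once [x > 1] and [mu * x > C + 1]. *)
Lemma radius_bound (mu C x q : R) :
  0 < mu -> 0 <= C -> 0 < x -> -1 <= q <= 1 -> - C <= energy mu x q -> x <= 1 + (C + 1) / mu.
Proof.
  unfold energy. intros Hmu HC Hx Hq HE.
  assert (Hk : mu * x ^ 2 <= x + C) by nra.
  apply Rnot_lt_le. intros Hlt.
  assert (0 < (C + 1) / mu) by (apply Rdiv_lt_0_compat; lra).
  assert (H2 : (C + 1) < mu * x).
  { apply Rle_lt_trans with (mu * ((C + 1) / mu)); [right; field; lra|]. nra. }
  nra.
Qed.

Lemma radius_bound_abs (mu C x q : R) :
  mu <> 0 -> 0 <= C -> 0 < x -> -1 <= q <= 1 -> Rabs (energy mu x q) <= C ->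
  x <= 1 + (C + 1) / Rabs mu.
Proof.
  intros Hmu HC Hx Hq HE. apply Rabs_le_between in HE.
  destruct (Rlt_le_dec 0 mu) as [H|H].
  - rewrite Rabs_right by lra. apply radius_bound with q; lra.
  - rewrite Rabs_left by lra. apply radius_bound with (- q); try lra.
    unfold energy in *. lra.
Qed.

(** * Asymptotics of orbits *)

Lemma derive_scaled (f : R -> R) (eta t l : R) :
  is_derive f (eta * t) l -> is_derive (fun t => f (eta * t)) t (eta * l).
Proof.
  intros H. apply (is_derive_comp f (fun t => eta * t) t l eta H).
  auto_derive; [trivial|ring].
Qed.

Lemma abs_div_warp_le (tau x a : R) : Rabs (a / warp tau x) <= Rabs a.
Proof.
  assert (H := warp_ge_1 tau x).
  unfold Rdiv. rewrite Rabs_mult. rewrite (Rabs_right (/ warp tau x)).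
  - assert (/ warp tau x <= 1) by (rewrite <- Rinv_1; apply Rinv_le_contravar; lra).
    assert (0 <= Rabs a) by apply Rabs_pos. nra.
  - apply Rle_ge. left. apply Rinv_0_lt_compat. lra.
Qed.

Lemma abs_mult_le (a b A B : R) : Rabs a <= A -> Rabs b <= B -> Rabs (a * b) <= A * B.
Proof.
  intros Ha Hb. rewrite Rabs_mult. apply Rmult_le_compat; auto using Rabs_pos.
Qed.

Lemma abs_plus_le (a b A B : R) : Rabs a <= A -> Rabs b <= B -> Rabs (a + b) <= A + B.
Proof. intros Ha Hb. eapply Rle_trans; [apply Rabs_triang|lra]. Qed.

Lemma is_lim_mult' (f g : R -> R) (e : Rbar) (a b : R) :
  is_lim f e a -> is_lim g e b -> is_lim (fun t => f t * g t) e (a * b).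
Proof. intros Hf Hg. apply (is_lim_mult f g e a b Hf Hg). exact I. Qed.

Lemma is_lim_div' (f g : R -> R) (e : Rbar) (a b : R) :
  b <> 0 -> is_lim f e a -> is_lim g e b -> is_lim (fun t => f t / g t) e (a / b).
Proof.
  intros Hb Hf Hg. apply (is_lim_div f g e a b Hf Hg); [|exact I].
  intros H. apply Hb. now injection H.
Qed.

Section Orbit.
Variables (tau mu : R) (x z p q : R -> R).
Hypothesis (Htau : tau <> 0) (Hmu : 0 < mu).
Hypothesis F : flow tau mu (fun _ => 1) x z p q.

Let xpos := flow_pos _ _ _ _ _ _ _ F.
Let pq_unit := flow_unit _ _ _ _ _ _ _ F.

Lemma orbit_abs_le t : Rabs (p t) <= 1 /\ Rabs (q t) <= 1.
Proof. destruct (unit_sqr_le _ _ (pq_unit t)) as (_&_&H1&H2). split; apply Rabs_le; lra. Qed.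

(* In terms of [a = x q] and [b = x p], the energy gives [b ^ 2 = O(J')] and
   [b' = 1 - 2 mu a + O(b)], so that Barbalat's lemma applies twice. *)
Lemma bounded_half_orbit_converges (eta M : R) :
  eta ^ 2 = 1 -> (forall t, 0 <= t -> x (eta * t) <= M) ->
  is_lim (fun t => x (eta * t)) p_infty (/ (2 * mu)) /\
  is_lim (fun t => q (eta * t)) p_infty 1.
Proof.
  intros Heta HM.
  (* [eta] is [1] or [-1], so one argument serves both directions of time. Multiplying the energy by
     [eta] makes it nondecreasing in the new time. *)
  assert (Heta' : Rabs eta <= 1) by (apply Rabs_le; nra).
  assert (HM0 : 0 < M) by (specialize (HM 0 (Rle_refl 0)); specialize (xpos (eta * 0)); lra).
  assert (Ht0 := Rabs_pos tau).
  assert (Habs : forall t, 0 <= t -> Rabs (x (eta * t)) <= M).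
  { intros t Ht. rewrite Rabs_right; [auto|]. apply Rle_ge. left. apply xpos. }
  set (b := fun t => x (eta * t) * p (eta * t)).
  set (a := fun t => x (eta * t) * q (eta * t)).
  set (f := fun t => eta * (1 - 2 * mu * a t)).
  set (g := fun t => eta * (- (2 * q (eta * t) * (b t / warp tau (x (eta * t)))))).
  assert (Hbb : forall t, 0 <= t -> Rabs (b t) <= M * 1).
  { intros t Ht. apply abs_mult_le; [auto|apply orbit_abs_le]. }
  assert (Haa : forall t, 0 <= t -> Rabs (a t) <= M * 1).
  { intros t Ht. apply abs_mult_le; [auto|apply orbit_abs_le]. }
  assert (Hbd : forall t, is_derive b t (f t + g t)).
  { intros t.
    assert (H := derive_scaled _ eta t _ (flow_xp_derive _ _ _ _ _ _ _ F (eta * t))).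
    evar_last; [exact H|]. unfold f, g, a, b. field. apply Rgt_not_eq, warp_pos. }
  assert (Hgb : forall t, Rabs (g t) <= 1 * (2 * Rabs (b t))).
  { intros t. unfold g. apply abs_mult_le; [assumption|]. rewrite Rabs_Ropp.
    apply abs_mult_le; [|apply abs_div_warp_le].
    replace 2 with (2 * 1) at 2 by ring. apply abs_mult_le; [rewrite Rabs_right; lra|apply orbit_abs_le]. }
  assert (Hfb : forall t, 0 <= t -> Rabs (f t) <= 1 * (1 + 2 * mu * M)).
  { intros t Ht. unfold f. apply abs_mult_le; [assumption|].
    apply abs_plus_le; [rewrite Rabs_R1; lra|]. rewrite Rabs_Ropp.
    apply abs_mult_le; [rewrite Rabs_right; lra|]. specialize (Haa t Ht). lra. }
  assert (Lb : is_lim b p_infty 0).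
  (* Write [b ^ 2] as [x * warp] times [x / warp * p ^ 2]. The first factor is at most
     [M * (1 + Rabs tau * M)], the second is half the energy rate. The two other constants bound
     [b'] and the energy. *)
  { apply (barbalat_square (fun t => eta * energy mu (x (eta * t)) (q (eta * t)))
      (fun t => 2 * (x (eta * t) / warp tau (x (eta * t))) * p (eta * t) ^ 2) b
      (fun t => f t + g t) (M * (1 + Rabs tau * M)) (1 * (1 + 2 * mu * M) + 1 * (2 * (M * 1))) (M * 1 + mu * (M * M))).
    - apply Rmult_lt_0_compat; nra.
    - nra.
    - intros t Ht. assert (H := derive_scaled _ eta t _ (energy_derive _ _ _ _ _ _ _ F (eta * t))).
      apply (is_derive_scal _ t eta) in H. evar_last; [exact H|]. simpl.
      transitivity (eta ^ 2 * (2 * (x (eta * t) / warp tau (x (eta * t))) * p (eta * t) ^ 2)).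
      + ring.
      + rewrite Heta. ring.
    - intros t Ht. apply Hbd.
    - intros t Ht. apply Rle_trans with (Rabs eta * Rabs (energy mu (x (eta * t)) (q (eta * t)))).
      + rewrite <- Rabs_mult. apply Rle_abs.
      + assert (Rabs (energy mu (x (eta * t)) (q (eta * t))) <= M * 1 + mu * (M * M)).
        { unfold energy. apply abs_plus_le; [apply (Haa t Ht)|]. rewrite Rabs_Ropp.
          apply abs_mult_le; [rewrite Rabs_right; lra|]. simpl. rewrite Rmult_1_r.
          apply abs_mult_le; auto. }
        assert (0 <= Rabs (energy mu (x (eta * t)) (q (eta * t)))) by apply Rabs_pos.
        nra.
    - intros t Ht. unfold b. specialize (HM t Ht). specialize (xpos (eta * t)).
      set (X := x (eta * t)) in *. set (P := p (eta * t)).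
      assert (Hw := warp_pos tau X). assert (Hw' := warp_le tau X ltac:(lra)).
      assert (HwM : X * warp tau X <= M * (1 + Rabs tau * M)).
      { apply Rmult_le_compat; try lra. nra. }
      replace ((X * P) ^ 2) with (X * warp tau X * (X / warp tau X * P ^ 2)) by (field; lra).
      assert (HY : 0 <= X / warp tau X * P ^ 2).
      { apply Rmult_le_pos; [|apply pow2_ge_0]. left. apply Rdiv_lt_0_compat; lra. }
      apply Rle_trans with (M * (1 + Rabs tau * M) * (X / warp tau X * P ^ 2)).
      + now apply Rmult_le_compat_r.
      + replace (2 * (X / warp tau X) * P ^ 2) with (2 * (X / warp tau X * P ^ 2)) by ring.
        apply Rmult_le_compat_l; [|lra]. assert (0 <= Rabs tau * M) by nra. nra.
    - intros t Ht. apply abs_plus_le; [auto|]. eapply Rle_trans; [apply Hgb|].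
      specialize (Hbb t Ht). lra. }
  assert (Lg : is_lim g p_infty 0).
  { apply is_lim_p_infty_0. intros eps He. rewrite is_lim_p_infty_0 in Lb.
    destruct (Lb (eps / 2)) as [T HT]; [lra|]. exists T. intros t Ht.
    specialize (HT t Ht). specialize (Hgb t). lra. }
  assert (Lf : is_lim f p_infty 0).
  { apply (barbalat_derivative b f g
      (fun t => eta * (- (2 * mu * (eta * (2 * b t * (p (eta * t) / warp tau (x (eta * t)) + mu))))))
      (1 * ((2 * mu) * (1 * (2 * (M * 1) * (1 + mu)))))); auto.
    - assert (0 < mu * M) by nra. nra.
    - intros t Ht. unfold f, a.
      assert (H := derive_scaled _ eta t _ (flow_xq_derive _ _ _ _ _ _ _ F (eta * t))).
      apply (is_derive_scal _ t eta). evar_last.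
      + apply (is_derive_minus (fun _ => 1)); [apply is_derive_const|].
        apply (is_derive_scal _ t (2 * mu)). exact H.
      + simpl. unfold minus, plus, opp, zero, b; simpl. ring.
    - intros t Ht. apply abs_mult_le; [assumption|]. rewrite Rabs_Ropp.
      apply abs_mult_le; [rewrite Rabs_right; lra|]. apply abs_mult_le; [assumption|].
      apply abs_mult_le.
      + apply abs_mult_le; [rewrite Rabs_right; lra|auto].
      + apply abs_plus_le; [|rewrite Rabs_right; lra].
        eapply Rle_trans; [apply abs_div_warp_le|apply orbit_abs_le]. }
  assert (La : is_lim a p_infty (/ (2 * mu))).
  { apply is_lim_ext with (fun t => (1 - eta * f t) * / (2 * mu)).
    - intros t. unfold f.
      transitivity ((1 - eta ^ 2 * (1 - 2 * mu * a t)) * / (2 * mu)); [ring|].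
      rewrite Heta. field. lra.
    - evar_last.
      + apply is_lim_mult'; [|apply is_lim_const]. apply is_lim_minus'; [apply is_lim_const|].
        apply is_lim_mult'; [apply is_lim_const|exact Lf].
      + simpl. f_equal. field. lra. }
  (* Since [a ^ 2 + b ^ 2 = x ^ 2], the limits of [a] and [b] give that of [x], and then that of
     [q = a / x]. *)
  assert (Lx2 : is_lim (fun t => a t * a t + b t * b t) p_infty (/ (2 * mu) * / (2 * mu) + 0 * 0)).
  { apply is_lim_plus'; apply is_lim_mult'; assumption. }
  assert (Hr : 0 < / (2 * mu)) by (apply Rinv_0_lt_compat; lra).
  assert (Lx : is_lim (fun t => x (eta * t)) p_infty (/ (2 * mu))).
  { apply is_lim_ext with (fun t => sqrt (a t * a t + b t * b t)).
    - intros t. unfold a, b. replace (_ + _) with (x (eta * t) ^ 2 * (p (eta * t) ^ 2 + q (eta * t) ^ 2)) by ring.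
      rewrite pq_unit, Rmult_1_r. apply sqrt_pow2. left. apply xpos.
    - evar_last.
      + apply (is_lim_comp_continuous _ sqrt); [exact Lx2|]. apply continuous_sqrt.
      + f_equal. replace (_ + _) with ((/ (2 * mu)) ^ 2) by ring. apply sqrt_pow2. lra. }
  split; [assumption|].
  apply is_lim_ext with (fun t => a t / x (eta * t)).
  - intros t. unfold a. field. apply Rgt_not_eq, xpos.
  - evar_last.
    + apply (is_lim_div' a); [|exact La|exact Lx]. lra.
    + f_equal. field. lra.
Qed.
End Orbit.

Lemma lim_le_of_nonincreasing (f : R -> R) (l t : R) :
  (forall a b, a <= b -> f b <= f a) -> is_lim f p_infty l -> l <= f t.
Proof.
  intros Hm Hl. apply (is_lim_le_loc f (fun _ => f t) p_infty l (f t)).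
  - exists t. intros s Hs. apply Hm. lra.
  - exact Hl.
  - apply is_lim_const.
Qed.

Section Orbit.
Variables (tau mu : R) (x z p q : R -> R).
Hypothesis (Htau : tau <> 0) (Hmu : 0 < mu).
Hypothesis F : flow tau mu (fun _ => 1) x z p q.

Let xpos := flow_pos _ _ _ _ _ _ _ F.
Let pq_unit := flow_unit _ _ _ _ _ _ _ F.

Lemma energy_increment s t : s <= t ->
  0 <= energy mu (x t) (q t) - energy mu (x s) (q s) <= 2 / Rabs tau * (t - s).
Proof.
  intros Hst. set (dE := fun t => 1 * (2 * (x t / warp tau (x t)) * p t ^ 2)).
  assert (Hb : forall c, 0 <= dE c <= 2 / Rabs tau).
  { intros c. unfold dE. specialize (xpos c).
    assert (H1 := div_warp_le tau (x c) Htau ltac:(lra)). assert (H2 := warp_pos tau (x c)).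
    assert (0 < x c / warp tau (x c)) by (apply Rdiv_lt_0_compat; lra).
    destruct (unit_sqr_le _ _ (pq_unit c)) as (H3&_). assert (0 <= p c ^ 2) by apply pow2_ge_0.
    unfold Rdiv at 2. nra. }
  split.
  - replace 0 with (0 * (t - s)) by ring.
    apply (increment_ge (fun t => energy mu (x t) (q t)) dE); [lra| |intros c _; apply Hb].
    intros; apply (energy_derive _ _ _ _ _ _ _ F).
  - apply (increment_le (fun t => energy mu (x t) (q t)) dE); [lra| |intros c _; apply Hb].
    intros; apply (energy_derive _ _ _ _ _ _ _ F).
Qed.

Lemma orbit_q_range t : -1 <= q t <= 1.
Proof. apply (unit_sqr_le _ _ (pq_unit t)). Qed.

(** The energy never drops below its value at time [0], which bounds the radius on the whole forward
    half-orbit. *)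
Lemma forward_converges : is_lim x p_infty (/ (2 * mu)) /\ is_lim q p_infty 1.
Proof.
  set (C := Rabs (energy mu (x 0) (q 0))).
  destruct (bounded_half_orbit_converges tau mu x z p q Hmu F 1 (1 + (C + 1) / mu)) as [H1 H2].
  - ring.
  - intros t Ht. rewrite Rmult_1_l. apply radius_bound with (q t); auto.
    + apply Rabs_pos.
    + apply orbit_q_range.
    + assert (H := energy_increment 0 t Ht). assert (H' := Rabs_maj2 (energy mu (x 0) (q 0))).
      fold C in H'. lra.
  - split; [apply is_lim_ext with (2 := H1)|apply is_lim_ext with (2 := H2)];
      intros t; now rewrite Rmult_1_l.
Qed.

(* [1 / (4 mu)] is the maximum of the energy, attained only on the cylinder. *)
Lemma backward_bounded_stationary (C : R) :
  (forall t, t <= 0 -> - C <= energy mu (x t) (q t)) ->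
  forall t, x t = / (2 * mu) /\ q t = 1 /\ p t = 0.
Proof.
  intros HC t.
  destruct (bounded_half_orbit_converges tau mu x z p q Hmu F (-1) (1 + (Rabs C + 1) / mu)) as [H1 H2].
  - ring.
  - intros s Hs. apply radius_bound with (q (-1 * s)); auto.
    + apply Rabs_pos.
    + apply orbit_q_range.
    + assert (H := HC (-1 * s) ltac:(lra)). assert (H' := Rle_abs C). lra.
  (* By monotonicity the energy at [t] is at least its limit in the past, which is computed from the
     limits of [x] and [q]. *)
  - assert (HE : / (4 * mu) <= energy mu (x t) (q t)).
    { assert (L : is_lim (fun s => energy mu (x (-1 * s)) (q (-1 * s))) p_infty (/ (4 * mu))).
      { unfold energy. evar_last.
        - apply is_lim_minus'; apply is_lim_mult'; [exact H1|exact H2|apply is_lim_const|].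
          simpl. apply is_lim_mult'; [exact H1|]. apply is_lim_mult'; [exact H1|apply is_lim_const].
        - f_equal. field. lra. }
      replace t with (-1 * - t) by ring.
      apply (lim_le_of_nonincreasing (fun s => energy mu (x (-1 * s)) (q (-1 * s)))); [|exact L].
      intros a b Hab. assert (H := energy_increment (-1 * b) (-1 * a) ltac:(lra)). lra. }
    assert (Hq := orbit_q_range t). specialize (xpos t).
    set (r := / (2 * mu)) in *.
    assert (Hr : mu * r = / 2) by (unfold r; field; lra).
    replace (/ (4 * mu)) with (mu * r ^ 2) in HE by (unfold r; field; lra).
    assert (0 < r) by (apply Rinv_0_lt_compat; lra).
    unfold energy in HE.
    assert (Hx : x t = r).
    (* With [q t <= 1] and [2 * mu * r = 1], the lower bound on the energy is this inequality after
       completing the square. *)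
    { assert (H0 : mu * (x t - r) ^ 2 <= 0).
      { assert (x t * q t <= x t) by nra.
        replace (mu * (x t - r) ^ 2) with (mu * x t ^ 2 - 2 * (mu * r) * x t + mu * r ^ 2) by ring.
        rewrite Hr. lra. }
      assert (0 <= (x t - r) ^ 2) by apply pow2_ge_0.
      assert ((x t - r) ^ 2 = 0) by nra. nra. }
    assert (Hq1 : q t = 1).
    { rewrite Hx in HE. assert (2 * (mu * r) * r <= r * q t) by lra. rewrite Hr in *. nra. }
    repeat split; auto. specialize (pq_unit t). rewrite Hq1 in pq_unit. nra.
Qed.

Hypothesis Hunbdd : forall C, exists t, t <= 0 /\ energy mu (x t) (q t) < - C.

(** The energy is at least [- x - mu * x ^ 2], so a very negative value forces a large radius; by
    monotonicity the energy is no larger at all earlier times. *)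
Lemma backward_radius (M : R) : exists T, T <= 0 /\ forall t, t <= T -> M <= x t.
Proof.
  destruct (Hunbdd (Rabs M + mu * Rabs M ^ 2)) as [T [HT HE]]. exists T; split; [assumption|].
  intros t Ht. apply Rnot_lt_le. intros Hx.
  assert (H := energy_increment t T Ht). assert (Hq := orbit_q_range t). specialize (xpos t).
  assert (H1 := Rle_abs M). unfold energy in *.
  assert (- x t <= x t * q t) by nra.
  assert (x t ^ 2 <= Rabs M ^ 2) by (apply pow_incr; lra). nra.
Qed.

(** The derivative found in [height_derive]. For large [x] it is close to
    [Rabs tau * (p ^ 2 + q ^ 2)], that is, to [Rabs tau]. *)
Definition height_rate (x p q : R) : R :=
  tau ^ 2 * (x / warp tau x) * p ^ 2 + warp tau x / x * q ^ 2
  + p * q / mu * (2 * p / warp tau x - q / x).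

Lemma far_rates : exists X0, 1 <= X0 /\ forall x p q, X0 <= x -> p ^ 2 + q ^ 2 = 1 ->
  mu <= turning tau mu x p q <= 3 * mu /\ Rabs tau / 2 <= height_rate x p q <= 2 * Rabs tau.
Proof.
  assert (Ht := Rabs_pos_lt tau Htau). set (T := Rabs tau) in *.
  (* Chosen so that [2 / w + / y <= k / y], because [w >= T * y]. *)
  set (k := 2 / T + 1).
  assert (HT' : 0 < 2 / T) by (apply Rdiv_lt_0_compat; lra).
  assert (Ha : 0 < 3 / T) by (apply Rdiv_lt_0_compat; lra).
  assert (Hb : 0 < k / mu) by (apply Rdiv_lt_0_compat; unfold k; lra).
  assert (Hc : 0 < 4 * k / (mu * T)) by (apply Rdiv_lt_0_compat; unfold k; nra).
  (* The last three summands give in turn [T * y >= 3], hence [w <= 4 / 3 * (T * y)]; an error of at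
     most [mu] in [turning]; and an error of at most [T / 4] in [height_rate]. *)
  exists (1 + 3 / T + k / mu + 4 * k / (mu * T)). split; [lra|].
  intros y P Q Hy HPQ.
  assert (H1 := warp_pos tau y). assert (H2 := warp_ge tau y ltac:(lra)).
  assert (H3 := warp_le tau y ltac:(lra)). fold T in H2, H3. set (w := warp tau y) in *.
  destruct (unit_sqr_le _ _ HPQ) as (HP2&HQ2&HP&HQ).
  assert (0 <= P ^ 2) by apply pow2_ge_0. assert (0 <= Q ^ 2) by apply pow2_ge_0.
  assert (Hiw : / w <= / T / y).
  { replace (/ T / y) with (/ (T * y)) by (field; lra). apply Rinv_le_contravar; nra. }
  assert (Hw0 : 0 < / w) by (apply Rinv_0_lt_compat; lra).
  assert (Hy0 : 0 < / y) by (apply Rinv_0_lt_compat; lra).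
  assert (HTy : 3 <= T * y).
  { apply Rle_trans with (T * (3 / T)); [right; field; lra|]. nra. }
  assert (Hmy : k <= mu * y).
  { apply Rle_trans with (mu * (k / mu)); [right; field; lra|]. nra. }
  assert (Hmty : 4 * k <= mu * T * y).
  { apply Rle_trans with (mu * T * (4 * k / (mu * T))); [right; field; lra|].
    apply Rmult_le_compat_l; [nra|lra]. }
  assert (Hk : 2 * / w + / y <= k / y).
  { replace (k / y) with (2 * (/ T / y) + / y) by (unfold k; field; lra). lra. }
  assert (Hk1 : k / y <= mu).
  { apply Rmult_le_reg_r with y; [lra|]. replace (k / y * y) with k by (field; lra). lra. }
  assert (Hk2 : k / y / mu <= T / 4).
  { apply Rmult_le_reg_r with (mu * y * 4); [nra|].
    replace (k / y / mu * (mu * y * 4)) with (4 * k) by (field; lra).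
    replace (T / 4 * (mu * y * 4)) with (mu * T * y) by field. lra. }
  assert (Hs : Rabs (2 * P / w - Q / y) <= k / y).
  { eapply Rle_trans; [|exact Hk]. apply Rabs_le. unfold Rdiv. split; nra. }
  split.
  - unfold turning. fold w. apply Rabs_le_between in Hs. lra.
  - unfold height_rate. fold w.
    assert (E1 : T * (3 / 4) <= tau ^ 2 * (y / w) <= T).
    { replace (tau ^ 2) with (T ^ 2) by apply pow2_abs. split.
      - apply Rmult_le_reg_r with w; [lra|].
        replace (T ^ 2 * (y / w) * w) with (T * (T * y)) by (field; lra). nra.
      - apply Rmult_le_reg_r with w; [lra|].
        replace (T ^ 2 * (y / w) * w) with (T * (T * y)) by (field; lra). nra. }
    assert (E2 : T <= w / y <= T * (4 / 3)).
    { split; apply Rmult_le_reg_r with y; try lra; replace (w / y * y) with w by (field; lra); lra. }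
    assert (E3 : Rabs (P * Q / mu * (2 * P / w - Q / y)) <= T / 4).
    { eapply Rle_trans; [|exact Hk2]. replace (k / y / mu) with (/ mu * (k / y)) by (field; lra).
      apply abs_mult_le; [|assumption].
      assert (0 < / mu) by (apply Rinv_0_lt_compat; lra).
      apply Rabs_le. unfold Rdiv. assert (-1 <= P * Q <= 1) by nra. nra. }
    apply Rabs_le_between in E3. split; nra.
Qed.

Lemma height_increment X0 s t : s <= t ->
  (forall x p q, X0 <= x -> p ^ 2 + q ^ 2 = 1 ->
    Rabs tau / 2 <= height_rate x p q <= 2 * Rabs tau) ->
  (forall u, u <= t -> X0 <= x u) ->
  Rabs tau / 2 * (t - s) <=
    (2 * mu * z t + warp tau (x t) * p t + q t ^ 2 / (2 * mu))
    - (2 * mu * z s + warp tau (x s) * p s + q s ^ 2 / (2 * mu)) <= 2 * Rabs tau * (t - s).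
Proof.
  intros Hst HX Hx.
  set (Z := fun t => 2 * mu * z t + warp tau (x t) * p t + q t ^ 2 / (2 * mu)).
  assert (HZ : forall c, is_derive Z c (1 * height_rate (x c) (p c) (q c))).
  { intros c. apply (height_derive _ _ _ _ _ _ _ F). lra. }
  assert (HR : forall c, s <= c <= t -> Rabs tau / 2 <= 1 * height_rate (x c) (p c) (q c) <= 2 * Rabs tau).
  { intros c Hc. rewrite Rmult_1_l. apply HX; [apply Hx; lra|apply pq_unit]. }
  change (Rabs tau / 2 * (t - s) <= Z t - Z s <= 2 * Rabs tau * (t - s)). split.
  - apply (increment_ge Z (fun c => 1 * height_rate (x c) (p c) (q c))); auto. intros c Hc. now apply HR.
  - apply (increment_le Z (fun c => 1 * height_rate (x c) (p c) (q c))); auto. intros c Hc. now apply HR.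
Qed.

(** Going back by the time [s], [2 * mu * z + warp * p] falls by at least [Rabs tau / 2 * s], up to
    a bounded term. The correction [warp * p] is of the order of the radius. As the energy falls at
    most linearly, [mu * x ^ 2] grows at most linearly, so [x <= c + s / 4], and [warp] takes back
    only half of the fall. *)
Lemma backward_height (M : R) : exists T, forall t, t <= T -> z t <= M.
Proof.
  destruct far_rates as [X0 [HX0 HX]].
  destruct (backward_radius X0) as [T0 [HT0 Hx]].
  assert (Ht := Rabs_pos_lt tau Htau). set (T := Rabs tau) in *.
  set (Z0 := 2 * mu * z T0 + warp tau (x T0) * p T0 + q T0 ^ 2 / (2 * mu)).
  set (A := Rabs (energy mu (x T0) (q T0))). assert (HA : 0 <= A) by apply Rabs_pos.
  (* Large enough that [x t > c + s / 4] would contradict [mu * x t ^ 2 <= x t + A + 2 / T * s], the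
     bound given by the energy. *)
  set (c := 1 + (2 + A) / mu + 4 * (2 / T) / mu).
  assert (H2T : 0 < 2 / T) by (apply Rdiv_lt_0_compat; lra).
  assert (Hc1 : 0 < (2 + A) / mu) by (apply Rdiv_lt_0_compat; lra).
  assert (Hc2 : 0 < 4 * (2 / T) / mu) by (apply Rdiv_lt_0_compat; lra).
  assert (Hmc : 2 + A + 4 * (2 / T) <= mu * c).
  { unfold c. replace (mu * (1 + (2 + A) / mu + 4 * (2 / T) / mu))
      with (mu + (2 + A) + 4 * (2 / T)) by (field; lra). lra. }
  set (N := Rabs (Z0 + 1 + T * c) + Rabs (2 * mu * M)).
  exists (T0 - 4 * N / T). intros t Htt.
  assert (HN : 0 <= N) by (unfold N; assert (H1 := Rabs_pos (Z0 + 1 + T * c)); assert (H2 := Rabs_pos (2 * mu * M)); lra).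
  assert (HNT : 0 <= 4 * N / T) by (apply Rdiv_le_0_compat; lra).
  set (s := T0 - t). assert (Hs : 0 <= s) by (unfold s; lra).
  assert (HTs : 4 * N <= T * s).
  { apply Rle_trans with (T * (4 * N / T)); [right; field; lra|]. apply Rmult_le_compat_l; unfold s; lra. }
  assert (HZ := height_increment X0 t T0 ltac:(unfold s in Hs; lra)
    (fun x p q Hx Hu => proj2 (HX x p q Hx Hu)) Hx). fold T Z0 s in HZ.
  assert (HE := energy_increment t T0 ltac:(unfold s in Hs; lra)). fold T s in HE.
  assert (Hq := orbit_q_range t). assert (Hxt := xpos t).
  assert (Hy : x t <= c + s / 4).
  { apply Rnot_lt_le. intros Hlt.
    assert (HA' := Rabs_maj2 (energy mu (x T0) (q T0))). fold A in HA'.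
    unfold energy in *.
    assert (E1 : mu * x t ^ 2 <= x t + A + 2 / T * s) by nra.
    assert (E2 : mu * (c + s / 4) <= mu * x t) by nra.
    assert (E3 : 1 <= c) by (unfold c; lra).
    assert (E4 : x t * (2 + A + 4 * (2 / T) + mu * (s / 4)) <= mu * x t ^ 2) by nra.
    assert (E5 : (4 * (2 / T)) * (s / 4) <= (mu * c) * (s / 4)) by (apply Rmult_le_compat_r; lra).
    assert (E6 : c * (mu * (s / 4)) <= x t * (mu * (s / 4))).
    { apply Rmult_le_compat_r; [nra|lra]. }
    nra. }
  assert (Hw := warp_le tau (x t) ltac:(lra)). fold T in Hw. assert (Hw0 := warp_pos tau (x t)).
  destruct (unit_sqr_le _ _ (pq_unit t)) as (_&_&Hp&_).
  assert (0 <= q t ^ 2 / (2 * mu)) by (apply Rdiv_le_0_compat; [apply pow2_ge_0|lra]).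
  assert (Hz : 2 * mu * z t <= Z0 + 1 + T * c - T * s / 4) by nra.
  assert (G1 := Rle_abs (Z0 + 1 + T * c)). assert (G2 := Rabs_maj2 (2 * mu * M)).
  unfold N in HTs. apply Rmult_le_reg_l with (2 * mu); [lra|]. nra.
Qed.
End Orbit.

(** * Loops of the far end *)

Lemma integral_derive (f : R -> R) (t : R) :
  (forall u, continuous f u) -> is_derive (fun u => RInt f 0 u) t (f t).
Proof.
  intros Hf. apply (is_derive_RInt f _ 0 t); [|apply Hf].
  apply filter_forall. intros u. apply (@RInt_correct R_CompleteNormedModule).
  apply ex_RInt_continuous. intros v _. apply Hf.
Qed.

Lemma unit_angle (p q : R) : p ^ 2 + q ^ 2 = 1 -> exists a, cos a = p /\ sin a = q.
Proof.
  intros H. destruct (unit_sqr_le p q H) as (_&_&Hp&_).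
  assert (Hs : sqrt (1 - p²) = Rabs q).
  { rewrite <- (sqrt_Rsqr_abs q). f_equal. unfold Rsqr. nra. }
  destruct (Rle_lt_dec 0 q) as [Hq|Hq].
  - exists (acos p). rewrite cos_acos, sin_acos, Hs by lra. split; [reflexivity|].
    apply Rabs_right. lra.
  - exists (- acos p). rewrite cos_neg, sin_neg, cos_acos, sin_acos, Hs by lra.
    split; [reflexivity|]. rewrite Rabs_left by lra. ring.
Qed.

Lemma continuous_of_derive (f df : R -> R) : (forall t, is_derive f t (df t)) -> forall t, continuous f t.
Proof. intros H t. apply (@ex_derive_continuous R_AbsRing R_NormedModule). eexists; apply H. Qed.

(* [c] clamps to an interval; [f o c + id - c] extends [f] outside it with slope 1. *)
Lemma clamped_inverse (f c : R -> R) :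
  (forall t, continuous f t) ->
  (forall u v, u <= v -> 0 <= c v - c u <= v - u) ->
  (forall u v, c u < c v -> f (c u) < f (c v)) ->
  (forall M, exists t, f (c t) + (t - c t) < M) ->
  (forall M, exists t, M < f (c t) + (t - c t)) ->
  exists h, (forall y, continuous h y) /\ forall u, c u = u -> h (f u) = u.
Proof.
  intros Hf Hc Hi Hlo Hhi.
  assert (Hcc : forall t, continuous c t).
  { intros t. apply filterlim_locally. intros eps. exists eps. intros s Hs.
    change (Rabs (s - t) < eps) in Hs. change (Rabs (c s - c t) < eps).
    apply Rabs_lt_between in Hs. apply Rabs_lt_between.
    destruct (Rle_lt_dec s t) as [H|H].
    - specialize (Hc s t H). lra.
    - specialize (Hc t s (Rlt_le _ _ H)). lra. }
  destruct (increasing_inverse (fun t => f (c t) + (t - c t))) as [h [H1 [H2 H3]]]; auto.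
  - intros t. apply (continuous_plus (fun t => f (c t))).
    + apply continuous_comp; auto.
    + apply (continuous_minus (fun t : R => t) c); [apply continuous_id|apply Hcc].
  - intros a b Hab. assert (H := Hc a b (Rlt_le _ _ Hab)).
    destruct (Req_dec (c a) (c b)) as [He|He].
    + rewrite He. lra.
    + assert (f (c a) < f (c b)) by (apply Hi; lra). lra.
  - exists h. split; [assumption|]. intros u Hu. rewrite <- (H1 u) at 2. f_equal. rewrite Hu. ring.
Qed.

Definition increasing_on (f : R -> R) (a b : R) : Prop :=
  forall u v, a <= u -> u < v -> v <= b -> f u < f v.

(** The inverse is made continuous on all of [R], beyond the image of the branch, so that heights
    composed with it meet the hypotheses of [crossing] directly. *)
Lemma branch_inverse (f : R -> R) (a b : R) : a < b ->
  (forall t, continuous f t) -> increasing_on f a b ->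
  exists h, (forall y, continuous h y) /\ (forall u, a <= u <= b -> h (f u) = u) /\
    forall y, f a <= y <= f b -> a <= h y <= b /\ f (h y) = y.
Proof.
  intros Hab Hf Hi. set (c := fun t => Rmax a (Rmin b t)).
  assert (Hcid : forall u, a <= u <= b -> c u = u).
  { intros u Hu. unfold c. rewrite Rmin_right, Rmax_right; lra. }
  assert (Hcab : forall u, a <= c u <= b).
  { intros u. unfold c, Rmax, Rmin. repeat destruct Rle_dec; lra. }
  destruct (clamped_inverse f c) as [h [H1 H2]]; auto.
  - intros u v Huv. unfold c, Rmax, Rmin. repeat destruct Rle_dec; lra.
  - intros u v Huv. apply Hi; try assumption; apply Hcab.
  - intros M. exists (Rmin a (M - 1 - f a + a)).
    assert (H := Rmin_l a (M - 1 - f a + a)). assert (H' := Rmin_r a (M - 1 - f a + a)).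
    replace (c (Rmin a (M - 1 - f a + a))) with a; [lra|].
    unfold c. rewrite (Rmin_right b), Rmax_left; lra.
  - intros M. exists (Rmax b (M + 1 - f b + b)).
    assert (H := Rmax_l b (M + 1 - f b + b)). assert (H' := Rmax_r b (M + 1 - f b + b)).
    replace (c (Rmax b (M + 1 - f b + b))) with b; [lra|].
    unfold c. rewrite (Rmin_left b), Rmax_right; lra.
  - exists h. split; [assumption|]. split; [auto|]. intros y Hy.
    destruct (IVT_gen f a b y) as [u [Hu Hfu]].
    + intros t. apply continuity_pt_filterlim, Hf.
    + assert (f a < f b) by (apply Hi; lra). rewrite Rmin_left, Rmax_right; lra.
    + rewrite Rmin_left, Rmax_right in Hu by lra. rewrite <- Hfu, H2; auto.
Qed.

Lemma branch_inverse_decreasing (f : R -> R) (a b : R) : a < b ->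
  (forall t, continuous f t) -> increasing_on (fun t => - f t) a b ->
  exists h, (forall y, continuous h y) /\ (forall u, a <= u <= b -> h (f u) = u) /\
    forall y, f b <= y <= f a -> a <= h y <= b /\ f (h y) = y.
Proof.
  intros Hab Hf Hi.
  destruct (branch_inverse (fun t => - f t) a b Hab) as [h [H1 [H2 H3]]]; auto.
  - intros t. apply (continuous_opp f), Hf.
  - exists (fun y => h (- y)). split; [|split].
    + intros y. apply (continuous_comp Ropp h); [apply (continuous_opp (fun y : R => y)), continuous_id|apply H1].
    + intros u Hu. apply H2, Hu.
    + intros y Hy. destruct (H3 (- y)) as [H4 H5]; [lra|]. split; [assumption|lra].
Qed.

Lemma increasing_on_of_derive (f df : R -> R) (a b : R) :
  (forall t, is_derive f t (df t)) -> (forall t, a < t < b -> 0 < df t) -> increasing_on f a b.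
Proof.
  intros Hd Hp u v Hu Huv Hv.
  destruct (mean_value f df u v Huv) as [c [Hc He]]; [auto|].
  assert (0 < df c) by (apply Hp; lra). nra.
Qed.

Lemma crossing (f g : R -> R) (u v : R) :
  u <= v -> (forall t, continuous f t) -> (forall t, continuous g t) ->
  f u <= g u -> g v <= f v -> exists c, u <= c <= v /\ f c = g c.
Proof.
  intros Huv Hf Hg H1 H2.
  destruct (IVT_gen (fun t => f t - g t) u v 0) as [c [Hc He]].
  - intros t. apply continuity_pt_filterlim. apply (continuous_minus f g); auto.
  - rewrite Rmin_left, Rmax_right; lra.
  - rewrite Rmin_left, Rmax_right in Hc by lra. exists c. split; [assumption|lra].
Qed.

Section Orbit.
Variables (tau mu : R) (x z p q : R -> R).
Hypothesis (Htau : tau <> 0) (Hmu : 0 < mu).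
Hypothesis F : flow tau mu (fun _ => 1) x z p q.

Let xpos := flow_pos _ _ _ _ _ _ _ F.
Let pq_unit := flow_unit _ _ _ _ _ _ _ F.

Lemma orbit_continuous :
  (forall t, continuous x t) /\ (forall t, continuous z t) /\
  (forall t, continuous p t) /\ (forall t, continuous q t).
Proof.
  split; [|split; [|split]].
  - exact (continuous_of_derive _ _ (flow_x _ _ _ _ _ _ _ F)).
  - exact (continuous_of_derive _ _ (flow_z _ _ _ _ _ _ _ F)).
  - exact (continuous_of_derive _ _ (flow_p _ _ _ _ _ _ _ F)).
  - exact (continuous_of_derive _ _ (flow_q _ _ _ _ _ _ _ F)).
Qed.

Lemma turning_continuous t : continuous (fun t => turning tau mu (x t) (p t) (q t)) t.
Proof.
  destruct orbit_continuous as (Hx&_&Hp&Hq).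
  assert (Hw : forall t, continuous (fun t => / warp tau (x t)) t).
  { intros s. apply (continuous_comp (fun t => warp tau (x t)) Rinv).
    - apply (continuous_comp x (warp tau)); [apply Hx|].
      apply (continuous_of_derive _ _ (warp_derive tau)).
    - apply continuous_Rinv. apply Rgt_not_eq, warp_pos. }
  assert (Hix : forall t, continuous (fun t => / x t) t).
  { intros s. apply (continuous_comp x Rinv); [apply Hx|].
    apply continuous_Rinv. apply Rgt_not_eq, xpos. }
  unfold turning, Rdiv, Rminus.
  apply (continuous_plus (fun t => 2 * p t * / warp tau (x t) + 2 * mu)).
  - apply (continuous_plus (fun t => 2 * p t * / warp tau (x t))); [|apply continuous_const].
    apply (continuous_mult (fun t => 2 * p t)); [|apply Hw].
    apply (continuous_mult (fun _ => 2)); [apply continuous_const|apply Hp].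
  - apply (continuous_opp (fun t => q t * / x t)).
    apply (continuous_mult q); [apply Hq|apply Hix].
Qed.

(** The angle is the integral of [turning] from a correct initial value. Both [(p, q)] and
    [(cos theta, sin theta)] rotate at that speed, so their inner product stays [1], and unit
    vectors with inner product [1] coincide. *)
Lemma angle_lift : exists theta : R -> R,
  (forall t, is_derive theta t (turning tau mu (x t) (p t) (q t))) /\
  forall t, p t = cos (theta t) /\ q t = sin (theta t).
Proof.
  destruct (unit_angle (p 0) (q 0) (pq_unit 0)) as [a [Ha1 Ha2]].
  set (Th := fun t => turning tau mu (x t) (p t) (q t)).
  set (theta := fun t => a + RInt Th 0 t).
  assert (Hd : forall t, is_derive theta t (Th t)).
  { intros t. unfold theta. evar_last.
    - apply (is_derive_plus (fun _ => a)); [apply is_derive_const|].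
      apply integral_derive. intros u. apply turning_continuous.
    - unfold plus, zero; simpl. ring. }
  exists theta. split; [exact Hd|]. intros t.
  assert (Hc : forall t, p t * cos (theta t) + q t * sin (theta t) = 1).
  { intros s. set (I := fun t => p t * cos (theta t) + q t * sin (theta t)).
    assert (HI : forall t, is_derive I t 0).
    { intros u. unfold I. assert (Hp := flow_p _ _ _ _ _ _ _ F u). assert (Hq := flow_q _ _ _ _ _ _ _ F u).
      auto_derive.
      - split; [eexists; apply Hp|]. split; [eexists; apply Hd|].
        split; [eexists; apply Hq|]. split; [eexists; apply Hd|trivial].
      - replace (Derive (fun t => theta t) u) with (Th u) by (symmetry; apply is_derive_unique, Hd).
        replace (Derive (fun t => p t) u) with (1 * (- q u * Th u)) by (symmetry; apply is_derive_unique, Hp).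
        replace (Derive (fun t => q t) u) with (1 * (p u * Th u)) by (symmetry; apply is_derive_unique, Hq).
        ring. }
    assert (H0 : I 0 = 1).
    { unfold I, theta. rewrite RInt_point. unfold zero; simpl. rewrite Rplus_0_r, Ha1, Ha2.
      rewrite <- (pq_unit 0). ring. }
    change (I s = 1). rewrite <- H0.
    now apply constant_of_derive. }
  specialize (Hc t). specialize (pq_unit t). assert (Ht := sin2_cos2 (theta t)). unfold Rsqr in Ht.
  assert (H : (p t - cos (theta t)) ^ 2 + (q t - sin (theta t)) ^ 2 = 0) by nra.
  assert (0 <= (p t - cos (theta t)) ^ 2) by apply pow2_ge_0.
  assert (0 <= (q t - sin (theta t)) ^ 2) by apply pow2_ge_0.
  split; nra.
Qed.
End Orbit.

Section Orbit.
Variables (tau mu : R) (x z p q : R -> R).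
Hypothesis (Htau : tau <> 0) (Hmu : 0 < mu).
Hypothesis F : flow tau mu (fun _ => 1) x z p q.
Hypothesis Hunbdd : forall C, exists t, t <= 0 /\ energy mu (x t) (q t) < - C.

Let xpos := flow_pos _ _ _ _ _ _ _ F.
Let pq_unit := flow_unit _ _ _ _ _ _ _ F.

(** A lift may be shifted by multiples of [2 * PI]. It is shifted until it exceeds [4 * PI] at [T1],
    so that the fixed angles used for the loops are all attained before [T1], where the radius is
    large and the angle grows at speed at least [mu]. *)
Lemma far_angle_lift (X0 T : R) : exists phi T1, T1 <= T /\
  (forall t, p t = cos (phi t) /\ q t = sin (phi t)) /\
  (forall v, v <= 4 * PI -> exists t, t <= T1 /\ phi t = v) /\
  (forall s t, s <= t -> t <= T1 -> mu * (t - s) <= phi t - phi s) /\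
  (forall t, t <= T1 -> X0 <= x t) /\
  (forall s t, s <= t -> t <= T1 ->
    Rabs tau / 2 * (t - s) <=
    (2 * mu * z t + warp tau (x t) * p t + q t ^ 2 / (2 * mu))
    - (2 * mu * z s + warp tau (x s) * p s + q s ^ 2 / (2 * mu)) <= 2 * Rabs tau * (t - s)).
Proof.
  destruct (far_rates tau mu Htau Hmu) as [X1 [HX1 HX]].
  destruct (backward_radius tau mu x z p q Htau Hmu F Hunbdd (Rmax X0 X1)) as [T0 [HT0 Hx]].
  assert (Hm0 := Rmax_l X0 X1). assert (Hm1 := Rmax_r X0 X1).
  destruct (angle_lift tau mu x z p q F) as [th [Hth Hpq]].
  set (T1 := Rmin T T0). assert (HT1 := Rmin_l T T0). assert (HT1' := Rmin_r T T0). fold T1 in HT1, HT1'.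
  (* A negative [up] is truncated to [0]; only [up <= n] matters. *)
  set (n := Z.to_nat (up ((4 * PI - th T1) / (2 * PI)))).
  assert (HPI := PI_RGT_0).
  assert (Hn : 4 * PI <= th T1 + 2 * INR n * PI).
  { assert (Hu := archimed ((4 * PI - th T1) / (2 * PI))).
    assert (Hun : IZR (up ((4 * PI - th T1) / (2 * PI))) <= INR n).
    { unfold n. rewrite INR_IZR_INZ. apply IZR_le. destruct (up ((4 * PI - th T1) / (2 * PI))); simpl; lia. }
    assert (H : (4 * PI - th T1) / (2 * PI) * (2 * PI) <= INR n * (2 * PI)) by (apply Rmult_le_compat_r; lra).
    replace ((4 * PI - th T1) / (2 * PI) * (2 * PI)) with (4 * PI - th T1) in H by (field; lra). lra. }
  assert (Hgrow : forall s t, s <= t -> t <= T1 -> mu * (t - s) <= th t - th s).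
  { intros s t Hst Ht. apply (increment_ge th (fun t => turning tau mu (x t) (p t) (q t))); auto.
    intros c Hc. apply HX; [|apply pq_unit]. specialize (Hx c ltac:(lra)). lra. }
  exists (fun t => th t + 2 * INR n * PI), T1. split; [assumption|].
  split; [intros t; rewrite cos_period, sin_period; apply Hpq|]. split; [|split; [|split]].
  - intros v Hv. set (s := T1 - (th T1 + 2 * INR n * PI - v) / mu).
    assert (Hs : s <= T1).
    { assert (0 <= (th T1 + 2 * INR n * PI - v) / mu) by (apply Rdiv_le_0_compat; lra). unfold s; lra. }
    assert (Hg := Hgrow s T1 Hs (Rle_refl _)).
    replace (mu * (T1 - s)) with (th T1 + 2 * INR n * PI - v) in Hg by (unfold s; field; lra).
    destruct (IVT_gen th s T1 (v - 2 * INR n * PI)) as [t [Ht He]].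
    + intros t. apply continuity_pt_filterlim. eapply continuous_of_derive, Hth.
    + rewrite Rmin_left, Rmax_right; lra.
    + rewrite Rmin_left, Rmax_right in Ht by lra. exists t. split; lra.
  - intros s t Hst Ht. specialize (Hgrow s t Hst Ht). lra.
  - intros t Ht. specialize (Hx t ltac:(lra)). lra.
  - intros s t Hst Ht.
    apply (height_increment tau mu x z p q Hmu F X1); [assumption| |].
    + intros y P Q Hy HPQ. apply HX; assumption.
    + intros u Hu. specialize (Hx u ltac:(lra)). lra.
Qed.

(* Two consecutive far turns [phi in [-pi/2, 3pi/2]] and [[3pi/2, 7pi/2]]: the
   radius is maximal (minimal) where [phi = pi/2] ([phi = -pi/2]) mod [2 pi], and
   both the maxima and the minima decrease in time by monotonicity of the energy.
   Over each half-turn the curve is a graph over the radius.  At the radius [xm]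
   every descending-radius branch lies far above every ascending-radius branch,
   while the branches agree at the turning points; the intermediate value theorem
   therefore makes two non-adjacent branches cross. *)
Lemma backward_loops (T : R) : exists s t, s < t /\ t <= T /\ x s = x t /\ z s = z t.
Proof.
  assert (Ht := Rabs_pos_lt tau Htau). set (a := Rabs tau) in *.
  (* The times used below span an angle of [5 * PI <= 20], at speed at least [mu]: they lie within a
     duration [D], during which the energy changes by at most [K]. *)
  set (D := 20 / mu). assert (HD : 0 < D) by (apply Rdiv_lt_0_compat; lra).
  set (K := 2 / a * D). assert (HK : 0 < K) by (apply Rmult_lt_0_compat; [apply Rdiv_lt_0_compat|]; lra).
  assert (Him : 0 < / mu) by (apply Rinv_0_lt_compat; lra).
  set (e := / (2 * mu)). assert (He : 0 < e) by (apply Rinv_0_lt_compat; lra).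
  assert (HY : 0 <= (2 * a * D + e) / a) by (apply Rdiv_le_0_compat; nra).
  (* [2 * K] forces [|q| <= 1 / 2] wherever the radius is [xm]; [/ mu] reaches the range where the
     energy at [q = 1] decreases in [x]; the last term makes [warp] exceed the drift [2 * a * D]
     plus the correction [e]. *)
  set (X0 := 1 + 2 * K + / mu + (2 * a * D + e) / a).
  destruct (far_angle_lift X0 T) as (phi&T1&HT1&Hpq&Hval&Hgrow&Hx&HZ).
  assert (HPI := PI_RGT_0). assert (HPI4 := PI_4).
  destruct (Hval (- 3 * (PI / 2)) ltac:(lra)) as [tm1 [Lm1 Vm1]].
  destruct (Hval (- (PI / 2)) ltac:(lra)) as [t0 [L0 V0]].
  destruct (Hval 0 ltac:(lra)) as [tm [Lm Vm]].
  destruct (Hval (PI / 2) ltac:(lra)) as [t1 [L1 V1]].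
  destruct (Hval (3 * (PI / 2)) ltac:(lra)) as [t2 [L2 V2]].
  destruct (Hval (5 * (PI / 2)) ltac:(lra)) as [t3 [L3 V3]].
  destruct (Hval (7 * (PI / 2)) ltac:(lra)) as [t4 [L4 V4]].
  assert (Hlt : forall s t, s <= T1 -> phi s < phi t -> s < t).
  { intros s t Hs Hst. apply Rnot_le_lt. intros H. specialize (Hgrow t s H Hs). nra. }
  assert (Hmono : forall s t, s <= t -> t <= T1 -> phi s <= phi t).
  { intros s t Hst HtT. specialize (Hgrow s t Hst HtT). nra. }
  assert (Om1 : tm1 < t0) by (apply Hlt; lra). assert (O0 : t0 < tm) by (apply Hlt; lra).
  assert (Om : tm < t1) by (apply Hlt; lra). assert (O1 : t1 < t2) by (apply Hlt; lra).
  assert (O2 : t2 < t3) by (apply Hlt; lra). assert (O3 : t3 < t4) by (apply Hlt; lra).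
  assert (HDur : t4 - tm1 <= D).
  { assert (H := Hgrow tm1 t4 ltac:(lra) L4). rewrite Vm1, V4 in H.
    apply Rmult_le_reg_l with mu; [lra|]. unfold D. replace (mu * (20 / mu)) with 20 by (field; lra). lra. }
  assert (Sgn : forall k s t u, s <= u <= t -> t <= T1 -> phi s = k - PI / 2 -> phi t = k + PI / 2 ->
    - (PI / 2) <= phi u - k <= PI / 2).
  { intros k s t u Hu HtT Hs Ht'. assert (H1 := Hmono s u ltac:(lra) ltac:(lra)).
    assert (H2 := Hmono u t ltac:(lra) ltac:(lra)). lra. }
  assert (Sgn' : forall k s t u, s < u < t -> t <= T1 -> phi s = k - PI / 2 -> phi t = k + PI / 2 ->
    - (PI / 2) < phi u - k < PI / 2).
  { intros k s t u Hu HtT Hs Ht'. assert (H1 := Hgrow s u ltac:(lra) ltac:(lra)).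
    assert (H2 := Hgrow u t ltac:(lra) ltac:(lra)). nra. }
  assert (Cp : forall y, cos (y - 2 * PI) = cos y).
  { intros y. rewrite <- (cos_period (y - 2 * PI) 1). f_equal. simpl. ring. }
  assert (Cm : forall y, cos (y + PI) = - cos y) by (intros; apply neg_cos).
  assert (Cm3 : forall y, cos (y - 3 * PI) = - cos y).
  { intros y. rewrite <- (Cp y), <- (Cm (y - 2 * PI)), <- (Cp (y - 2 * PI + PI)). f_equal. ring. }
  assert (Pf : forall u, t0 <= u <= t1 -> 0 <= p u).
  { intros u Hu. rewrite (proj1 (Hpq u)). destruct (Sgn 0 t0 t1 u); try lra. apply cos_ge_0; lra. }
  assert (Pf2 : forall u, t2 <= u <= t3 -> 0 <= p u).
  { intros u Hu. rewrite (proj1 (Hpq u)), <- Cp. destruct (Sgn (2 * PI) t2 t3 u); try lra. apply cos_ge_0; lra. }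
  assert (Pg0 : forall u, tm1 <= u <= t0 -> p u <= 0).
  { intros u Hu. rewrite (proj1 (Hpq u)). destruct (Sgn (- PI) tm1 t0 u); try lra.
    assert (0 <= cos (phi u + PI)) by (apply cos_ge_0; lra). rewrite Cm in H1. lra. }
  assert (Pg2 : forall u, t3 <= u <= t4 -> p u <= 0).
  { intros u Hu. rewrite (proj1 (Hpq u)). destruct (Sgn (3 * PI) t3 t4 u); try lra.
    assert (0 <= cos (phi u - 3 * PI)) by (apply cos_ge_0; lra). rewrite Cm3 in H1. lra. }
  assert (Hdx : forall t, is_derive x t (p t)).
  { intros t. evar_last; [apply (flow_x _ _ _ _ _ _ _ F)|]. simpl. ring. }
  assert (Hdnx : forall t, is_derive (fun t => - x t) t (- p t)).
  { intros t. apply (is_derive_opp x), Hdx. }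
  assert (If : increasing_on x t0 t1).
  { apply (increasing_on_of_derive x p); [exact Hdx|]. intros u Hu.
    rewrite (proj1 (Hpq u)). destruct (Sgn' 0 t0 t1 u); try lra. apply cos_gt_0; lra. }
  assert (If2 : increasing_on x t2 t3).
  { apply (increasing_on_of_derive x p); [exact Hdx|]. intros u Hu.
    rewrite (proj1 (Hpq u)), <- Cp. destruct (Sgn' (2 * PI) t2 t3 u); try lra. apply cos_gt_0; lra. }
  assert (Ig0 : increasing_on (fun t => - x t) tm1 t0).
  { apply (increasing_on_of_derive _ (fun t => - p t)); [exact Hdnx|]. intros u Hu.
    rewrite (proj1 (Hpq u)), <- Cm. destruct (Sgn' (- PI) tm1 t0 u); try lra. apply cos_gt_0; lra. }
  assert (Ig2 : increasing_on (fun t => - x t) t3 t4).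
  { apply (increasing_on_of_derive _ (fun t => - p t)); [exact Hdnx|]. intros u Hu.
    rewrite (proj1 (Hpq u)), <- Cm3. destruct (Sgn' (3 * PI) t3 t4 u); try lra. apply cos_gt_0; lra. }
  destruct (orbit_continuous tau mu x z p q F) as (Cx&Cz&_&_).
  destruct (branch_inverse x t0 t1 ltac:(lra) Cx If) as (hf&Hf1&Hf2&Hf3).
  destruct (branch_inverse x t2 t3 ltac:(lra) Cx If2) as (hf'&Hf1'&Hf2'&Hf3').
  destruct (branch_inverse_decreasing x tm1 t0 ltac:(lra) Cx Ig0) as (hg&Hg1&Hg2&Hg3).
  destruct (branch_inverse_decreasing x t3 t4 ltac:(lra) Cx Ig2) as (hg'&Hg1'&Hg2'&Hg3').
  assert (Sh : sin (PI / 2) = 1) by apply sin_PI2.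
  assert (Qodd : forall t k, phi t = PI / 2 + 2 * INR k * PI -> q t = 1).
  { intros t k Hk. rewrite (proj2 (Hpq t)), Hk, sin_period. exact Sh. }
  assert (Qeven : forall t k, phi t = - (PI / 2) + 2 * INR k * PI -> q t = -1).
  { intros t k Hk. rewrite (proj2 (Hpq t)), Hk, sin_period, sin_neg, Sh. reflexivity. }
  assert (Q0 : q t0 = -1) by (apply (Qeven t0 0%nat); rewrite V0; simpl; ring).
  assert (Q2 : q t2 = -1) by (apply (Qeven t2 1%nat); rewrite V2; simpl; field).
  assert (Q4 : q t4 = -1) by (apply (Qeven t4 2%nat); rewrite V4; simpl; field).
  assert (Q1 : q t1 = 1) by (apply (Qodd t1 0%nat); rewrite V1; simpl; ring).
  assert (Q3 : q t3 = 1) by (apply (Qodd t3 1%nat); rewrite V3; simpl; field).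
  assert (Qm1 : q tm1 = 1).
  { rewrite (proj2 (Hpq tm1)), <- (sin_period _ 1), Vm1, <- Sh. f_equal. simpl. field. }
  assert (Qm : q tm = 0) by (rewrite (proj2 (Hpq tm)), Vm; apply sin_0).
  assert (Pm : p tm = 1) by (rewrite (proj1 (Hpq tm)), Vm; apply cos_0).
  assert (HE : forall s t, s <= t -> 0 <= energy mu (x t) (q t) - energy mu (x s) (q s) <= 2 / a * (t - s)).
  { intros s t Hst. now apply (energy_increment tau mu x z p q Htau F). }
  assert (HX0 : 1 + 2 * K <= X0 /\ / mu < X0 /\ 2 * a * D + e < a * X0).
  { unfold X0. repeat split; try lra.
    apply Rlt_le_trans with (a * 1 + a * ((2 * a * D + e) / a)); [|nra].
    replace (a * ((2 * a * D + e) / a)) with (2 * a * D + e) by (field; lra). lra. }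
  destruct HX0 as (HX1&HX2&HX3).
  assert (Hmx : forall t, t <= T1 -> 1 < mu * x t).
  { intros t HtT. specialize (Hx t HtT). replace 1 with (mu * / mu) by (field; lra).
    apply Rmult_lt_compat_l; lra. }
  (* At fixed [q = -1], or [q = 1] in [Emax], the energy is decreasing in [x] on this range. Its
     growth in time therefore moves the turning points inwards. *)
  assert (Emin : forall s t, s <= t -> t <= T1 -> q s = -1 -> q t = -1 -> x t <= x s).
  { intros s t Hst HtT Hqs Hqt. destruct (HE s t Hst) as [H _]. rewrite Hqs, Hqt in H.
    unfold energy in H. assert (H1 := Hmx s ltac:(lra)). assert (H2 := Hmx t ltac:(lra)).
    apply Rnot_lt_le. intros Hlt'.
    assert (H3 : 0 < (x t - x s) * (1 + (mu * x s + mu * x t))) by (apply Rmult_lt_0_compat; lra).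
    lra. }
  assert (Emax : forall s t, s <= t -> t <= T1 -> q s = 1 -> q t = 1 -> x t <= x s).
  { intros s t Hst HtT Hqs Hqt. destruct (HE s t Hst) as [H _]. rewrite Hqs, Hqt in H.
    unfold energy in H. assert (H1 := Hmx s ltac:(lra)). assert (H2 := Hmx t ltac:(lra)).
    apply Rnot_lt_le. intros Hlt'.
    assert (H3 : 0 < (x t - x s) * (mu * x s + mu * x t - 1)) by (apply Rmult_lt_0_compat; lra).
    lra. }
  assert (X02 := Emin t0 t2 ltac:(lra) ltac:(lra) Q0 Q2).
  assert (X24 := Emin t2 t4 ltac:(lra) ltac:(lra) Q2 Q4).
  assert (X11 := Emax tm1 t1 ltac:(lra) ltac:(lra) Qm1 Q1).
  assert (X13 := Emax t1 t3 ltac:(lra) ltac:(lra) Q1 Q3).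
  assert (X0m : x t0 < x tm) by (apply If; lra).
  assert (Xm1 : x tm < x t1) by (apply If; lra).
  assert (HEm : forall t, tm1 <= t <= t4 -> Rabs (energy mu (x t) (q t) - energy mu (x tm) (q tm)) <= K).
  { intros t Htt. unfold K. assert (H2a : 0 < 2 / a) by (apply Rdiv_lt_0_compat; lra).
    apply Rabs_le. destruct (Rle_lt_dec t tm) as [Hc|Hc].
    - assert (H := HE t tm Hc). assert (2 / a * (tm - t) <= 2 / a * D) by (apply Rmult_le_compat_l; lra). lra.
    - assert (H := HE tm t ltac:(lra)). assert (2 / a * (t - tm) <= 2 / a * D) by (apply Rmult_le_compat_l; lra). lra. }
  (* If [x t3 <= xm], the energy at [t3] would exceed the one at [tm] by at least [x t3], hence by
     more than [K]. *)
  assert (Xm3 : x tm < x t3).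
  { assert (H := HEm t3 ltac:(lra)). apply Rabs_le_between in H. rewrite Q3, Qm in H.
    unfold energy in H. assert (H1 := Hx t3 L3). assert (H2 := xpos tm).
    apply Rnot_le_lt. intros Hle. assert (x t3 ^ 2 <= x tm ^ 2) by (apply pow_incr; lra). nra. }
  set (xm := x tm) in *. assert (Hxm : X0 <= xm) by (apply Hx; lra).
  assert (Hbig : forall t, tm1 <= t <= t4 -> x t = xm -> 1 / 2 <= Rabs (p t)).
  { intros t Htt Hxt. assert (H := HEm t Htt). rewrite Hxt, Qm in H. unfold energy in H.
    replace (xm * q t - mu * xm ^ 2 - (xm * 0 - mu * xm ^ 2)) with (xm * q t) in H by ring.
    apply Rabs_le_between in H. assert (-1 / 2 <= q t <= 1 / 2) by nra.
    assert (Hu := pq_unit t). rewrite <- (pow2_abs (p t)) in Hu. assert (Hp0 := Rabs_pos (p t)). nra. }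
  assert (Hw : 2 * a * D + e < warp tau xm).
  { assert (H := warp_ge tau xm ltac:(lra)). fold a in H.
    assert (a * X0 <= a * xm) by (apply Rmult_le_compat_l; lra). lra. }
  assert (Hq2 : forall t, 0 <= q t ^ 2 / (2 * mu) <= e).
  { intros t. destruct (unit_sqr_le _ _ (pq_unit t)) as (_&H1&_). assert (0 <= q t ^ 2) by apply pow2_ge_0.
    unfold Rdiv. fold e. nra. }
  (* From [hg xm] to [hf' xm] the value of [p] rises from at most [- 1 / 2] to at least [1 / 2], so
     [warp * p] gains at least [warp xm]. This exceeds what [2 * mu * z + warp * p] can gain, even
     with the correction [e], so [z] falls. *)
  assert (Zlow : z (hf' xm) < z (hg xm)).
  { destruct (Hg3 xm ltac:(lra)) as [Ha1 Ha2]. destruct (Hf3' xm ltac:(lra)) as [Hb1 Hb2].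
    set (s := hg xm) in *. set (t := hf' xm) in *.
    assert (H := HZ s t ltac:(lra) ltac:(lra)). fold a in H. rewrite Ha2, Hb2 in H.
    assert (B1 := Hbig s ltac:(lra) Ha2). assert (B2 := Hbig t ltac:(lra) Hb2).
    assert (S1 := Pg0 s ltac:(lra)). assert (S2 := Pf2 t ltac:(lra)).
    rewrite Rabs_left1 in B1 by lra. rewrite Rabs_right in B2 by lra.
    assert (G1 := Hq2 s). assert (G2 := Hq2 t).
    assert (a * (t - s) <= a * D) by (apply Rmult_le_compat_l; lra).
    assert (warp tau xm <= warp tau xm * (p t - p s)) by nra. nra. }
  (* Here the drift helps: [warp * p] falls by at least [warp xm], as [p] passes from [1] to a value
     at most [0], and only [e] has to be beaten. *)
  assert (Zhigh : z tm < z (hg' xm)).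
  { destruct (Hg3' xm ltac:(lra)) as [Ha1 Ha2]. set (t := hg' xm) in *.
    assert (H := HZ tm t ltac:(lra) ltac:(lra)). fold a in H. rewrite Ha2 in H. fold xm in H.
    assert (S1 := Pg2 t ltac:(lra)). rewrite Pm in H.
    assert (G1 := Hq2 tm). assert (G2 := Hq2 t).
    assert (0 <= a * (t - tm)) by (apply Rmult_le_pos; lra).
    assert (0 < a * D) by nra.
    assert (warp tau xm <= warp tau xm * (1 - p t)) by nra. nra. }
  assert (Cc : forall h : R -> R, (forall y : R, continuous h y) ->
    forall y : R, continuous (fun y : R => z (h y)) y).
  { intros h Hh y. apply (continuous_comp h z); auto. }
  assert (Bf0 : hf (x t0) = t0) by (apply Hf2; lra).
  assert (Bg0 : hg (x t0) = t0) by (apply Hg2; lra).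
  assert (Bfm : hf xm = tm) by (apply Hf2; lra).
  assert (Bf3 : hf' (x t3) = t3) by (apply Hf2'; lra).
  assert (Bg3 : hg' (x t3) = t3) by (apply Hg2'; lra).
  (* If [hf'] starts at or above [z t0], it meets [hg] before [xm], by [Zlow]. Otherwise it starts
     below [hf]; either it catches up with [hf] before [x t3], or [hf] is still above at [x t3],
     where [hf'] and [hg'] join, and then [hf] meets [hg'] after [xm], by [Zhigh]. The two branches
     in each case occupy disjoint time intervals. *)
  destruct (Rle_lt_dec (z t0) (z (hf' (x t0)))) as [Hc0|Hc0].
  - destruct (crossing (fun y => z (hg y)) (fun y => z (hf' y)) (x t0) xm) as [c [Hc He']];
      [lra|now apply Cc|now apply Cc|rewrite Bg0; lra|lra|].
    destruct (Hg3 c ltac:(lra)) as [Ha1 Ha2]. destruct (Hf3' c ltac:(lra)) as [Hb1 Hb2].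
    exists (hg c), (hf' c). repeat split; try lra.
  - destruct (Rle_lt_dec (z (hf (x t3))) (z t3)) as [Hc3|Hc3].
    + destruct (crossing (fun y => z (hf' y)) (fun y => z (hf y)) (x t0) (x t3)) as [c [Hc He']];
        [lra|now apply Cc|now apply Cc|rewrite Bf0; lra|rewrite Bf3; lra|].
      destruct (Hf3 c ltac:(lra)) as [Ha1 Ha2]. destruct (Hf3' c ltac:(lra)) as [Hb1 Hb2].
      exists (hf c), (hf' c). repeat split; try lra.
    + destruct (crossing (fun y => z (hf y)) (fun y => z (hg' y)) xm (x t3)) as [c [Hc He']];
        [lra|now apply Cc|now apply Cc|rewrite Bfm; lra|rewrite Bg3; lra|].
      destruct (Hf3 c ltac:(lra)) as [Ha1 Ha2]. destruct (Hg3' c ltac:(lra)) as [Hb1 Hb2].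
      exists (hf c), (hg' c). repeat split; try lra.
Qed.
End Orbit.

(** * Change of time *)

(* Along a time interval of finite length the energy, hence the radius and the
   warping factor, stay bounded, and so does the arc length [L]. *)
Lemma time_unbounded (tau mu : R) (rho x z p q T L : R -> R) :
  tau <> 0 -> mu <> 0 -> flow tau mu rho x z p q -> (forall s, 0 < rho s) ->
  (forall s, is_derive T s (rho s)) ->
  (forall s, is_derive L s (rho s * warp tau (x s))) ->
  is_lim L p_infty p_infty -> forall M, exists s, M < T s.
Proof.
  intros Htau Hmu F Hrho HT HL HLim M. apply NNPP. intros Hn.
  assert (HM : forall s, T s <= M).
  { intros s. apply Rnot_lt_le. intros H. apply Hn. now exists s. }
  assert (Ht := Rabs_pos_lt tau Htau). assert (H2t : 0 < 2 / Rabs tau) by (apply Rdiv_lt_0_compat; lra).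
  set (E := fun s => energy mu (x s) (q s)).
  set (C := Rabs (E 0) + 2 / Rabs tau * (M - T 0)).
  assert (HT0 := HM 0).
  assert (HC : 0 <= C).
  { unfold C. assert (H := Rabs_pos (E 0)). assert (0 <= 2 / Rabs tau * (M - T 0)) by (apply Rmult_le_pos; lra). lra. }
  assert (HE : forall s, 0 <= s -> Rabs (E s) <= C).
  { intros s Hs.
    assert (Hrate : forall c, 0 <= rho c * (2 * (x c / warp tau (x c)) * p c ^ 2) <= 2 / Rabs tau * rho c).
    { intros c. specialize (Hrho c). assert (Hx := flow_pos _ _ _ _ _ _ _ F c).
      assert (H1 := div_warp_le tau (x c) Htau ltac:(lra)). assert (H2 := warp_pos tau (x c)).
      assert (0 < x c / warp tau (x c)) by (apply Rdiv_lt_0_compat; lra).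
      destruct (unit_sqr_le _ _ (flow_unit _ _ _ _ _ _ _ F c)) as (H3&_).
      assert (0 <= p c ^ 2) by apply pow2_ge_0.
      assert (0 <= 2 * (x c / warp tau (x c)) * p c ^ 2 <= 2 / Rabs tau) by (unfold Rdiv at 2; nra).
      split; [apply Rmult_le_pos; lra|]. rewrite (Rmult_comm _ (rho c)). apply Rmult_le_compat_l; lra. }
    assert (H1 : 0 * (s - 0) <= E s - E 0).
    { eapply (increment_ge E); [assumption|intros c _; apply (energy_derive _ _ _ _ _ _ _ F)|intros c _; apply Hrate]. }
    (* [E - 2 / Rabs tau * T] does not increase, so the assumed bound on [T] bounds the energy from
       above. *)
    assert (H2 : (E s - 2 / Rabs tau * T s) - (E 0 - 2 / Rabs tau * T 0) <= 0 * (s - 0)).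
    { eapply (increment_le (fun s => E s - 2 / Rabs tau * T s)); [assumption| |].
      - intros c _. apply (is_derive_minus E (fun s => 2 / Rabs tau * T s)).
        + apply (energy_derive _ _ _ _ _ _ _ F).
        + apply (is_derive_scal T), HT.
      - intros c _. unfold minus, plus, opp; simpl. specialize (Hrate c). lra. }
    specialize (HM s). assert (H3 := Rle_abs (E 0)). assert (H4 := Rabs_maj2 (E 0)).
    assert (2 / Rabs tau * (T s - T 0) <= 2 / Rabs tau * (M - T 0)) by (apply Rmult_le_compat_l; lra).
    apply Rabs_le. unfold C. split; lra. }
  set (X := 1 + (C + 1) / Rabs mu). set (w := 1 + Rabs tau * X).
  assert (Hw : forall s, 0 <= s -> warp tau (x s) <= w).
  { intros s Hs. assert (Hx := flow_pos _ _ _ _ _ _ _ F s).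
    eapply Rle_trans; [apply warp_le; lra|]. unfold w. apply Rplus_le_compat_l.
    apply Rmult_le_compat_l; [lra|]. apply radius_bound_abs with (q s); auto; [|now apply HE].
    destruct (unit_sqr_le _ _ (flow_unit _ _ _ _ _ _ _ F s)) as (_&_&_&H). exact H. }
  assert (Hw0 : 0 < w).
  { assert (H := Hw 0 (Rle_refl 0)). assert (H1 := warp_pos tau (x 0)). lra. }
  apply is_lim_spec in HLim. destruct (HLim (L 0 + w * (M - T 0))) as [s0 Hs0].
  set (s := Rmax 0 s0 + 1). assert (Hs1 := Rmax_l 0 s0). assert (Hs2 := Rmax_r 0 s0).
  specialize (Hs0 s ltac:(unfold s; lra)). simpl in Hs0.
  (* In the same way [L - w * T] does not increase, so [L] is bounded above, against its
     divergence. *)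
  assert (H2 : (L s - w * T s) - (L 0 - w * T 0) <= 0 * (s - 0)).
  { eapply (increment_le (fun s => L s - w * T s)); [unfold s; lra| |].
    - intros c _. apply (is_derive_minus L (fun s => w * T s)); [apply HL|].
      apply (is_derive_scal T), HT.
    - intros c Hc. unfold minus, plus, opp; simpl. specialize (Hw c ltac:(lra)).
      specialize (Hrho c). nra. }
  specialize (HM s).
  assert (w * (T s - T 0) <= w * (M - T 0)) by (apply Rmult_le_compat_l; lra). lra.
Qed.

Lemma derive_reverse (f : R -> R) (l s : R) :
  is_derive f (- s) l -> is_derive (fun s => f (- s)) s (- l).
Proof.
  intros H. evar_last.
  - apply (is_derive_comp f Ropp); [exact H|]. apply (is_derive_opp (fun s : R => s)). apply is_derive_id.
  - unfold scal, opp, one; simpl. unfold mult; simpl. ring.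
Qed.

Lemma is_lim_reverse (f : R -> R) (e : Rbar) (l : Rbar) :
  is_lim f (Rbar_opp e) l -> is_lim (fun s => f (- s)) e l.
Proof.
  intros H. apply (is_lim_comp f Ropp e l (Rbar_opp e)).
  - exact H.
  - apply (is_lim_opp (fun s => s)), is_lim_id.
  - destruct e as [e| |]; simpl; [|exists 0; intros; discriminate..].
    exists (mkposreal 1 Rlt_0_1). intros y _ Hy H1. apply Hy. injection H1. lra.
Qed.

(** By the mean value theorem the difference quotient of [S] equals [/ rho c] for some [c] between
    [S t] and [S (t + h)]; continuity of [S] and of [rho] concludes. *)
Lemma inverse_derive (T rho S : R -> R) :
  (forall s, is_derive T s (rho s)) -> (forall s, continuous rho s) -> (forall s, 0 < rho s) ->
  (forall t, T (S t) = t) -> (forall t, continuous S t) ->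
  forall t, is_derive S t (/ rho (S t)).
Proof.
  intros HT Hc Hp HTS HS t. apply is_derive_Reals. intros eps He.
  assert (Hcont : continuous (fun s => / rho s) (S t)).
  { apply (continuous_comp rho Rinv); [apply Hc|]. apply continuous_Rinv. apply Rgt_not_eq, Hp. }
  assert (H1 := proj1 (filterlim_locally _ _) Hcont (mkposreal eps He)).
  destruct H1 as [d1 Hd1].
  destruct (proj1 (filterlim_locally _ _) (HS t) d1) as [d2 Hd2].
  exists d2. intros h Hh Hhd.
  assert (HSh : Rabs (S (t + h) - S t) < d1).
  { apply Hd2. change (Rabs (t + h - t) < d2). now replace (t + h - t) with h by ring. }
  destruct (MVT_gen T (S t) (S (t + h)) rho) as [c [Hc1 Hc2]].
  - intros; apply HT.
  - intros; apply continuity_pt_filterlim. eapply continuous_of_derive, HT.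
  - rewrite !HTS in Hc2. replace (t + h - t) with h in Hc2 by ring.
    specialize (Hp c).
    replace ((S (t + h) - S t) / h) with (/ rho c).
    + apply Hd1. change (Rabs (c - S t) < d1).
      eapply Rle_lt_trans; [|exact HSh].
      unfold Rmin, Rmax in Hc1. destruct Rle_dec; split_Rabs; lra.
    + assert (Hd : S (t + h) - S t <> 0).
      { intros H0. apply Hh. rewrite Hc2, H0. ring. }
      set (d := S (t + h) - S t) in *. clearbody d. rewrite Hc2. field. split; lra.
Qed.

(** Phrased so as to survive reversal of the parameter: [q] occurs in absolute value because
    reversal changes its sign. The continuous left inverse [g] of the height says that the end is a
    graph over the axis, in the form from which embeddedness follows. *)
Definition profile_ends (R0 : R) (x z q : R -> R) (e1 e2 : Rbar) : Prop :=
  is_lim x e1 R0 /\ is_lim (fun s => Rabs (q s)) e1 1 /\ is_lim z e1 p_infty /\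
  (exists (D : R -> Prop) (g : R -> R), Rbar_locally e1 D /\ (forall y, continuous g y) /\
     forall s, D s -> g (z s) = s) /\
  is_lim x e2 p_infty /\ is_lim z e2 m_infty /\
  (forall D, Rbar_locally e2 D -> exists s t, s <> t /\ D s /\ D t /\ x s = x t /\ z s = z t).

Lemma orbit_ends (tau mu : R) (x z p q : R -> R) :
  tau <> 0 -> 0 < mu -> flow tau mu (fun _ => 1) x z p q ->
  (forall t, x t = / (2 * mu) /\ q t = 1 /\ p t = 0) \/
  profile_ends (/ (2 * mu)) x z q p_infty m_infty.
Proof.
  intros Htau Hmu F.
  destruct (classic (exists C, forall t, t <= 0 -> - C <= energy mu (x t) (q t))) as [[C HC]|Hn].
  { left. now apply (backward_bounded_stationary tau mu x z p q Htau Hmu F C). }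
  right.
  assert (Hunbdd : forall C, exists t, t <= 0 /\ energy mu (x t) (q t) < - C).
  { intros C. apply NNPP. intros H. apply Hn. exists C. intros t Ht.
    apply Rnot_lt_le. intros Hlt. apply H. now exists t. }
  destruct (forward_converges tau mu x z p q Htau Hmu F) as [Lx Lq].
  (* Once [q > 1 / 2], the derivative [warp * q] of the height is at least [1 / 2], as
     [warp >= 1]. *)
  destruct (proj2 (is_lim_spec _ _ _) Lq (mkposreal (/ 2) ltac:(lra))) as [a Ha].
  set (b := a + 1).
  assert (Hdz : forall t, is_derive z t (1 * (warp tau (x t) * q t))) by apply (flow_z _ _ _ _ _ _ _ F).
  assert (Hz : forall t, b <= t -> / 2 <= 1 * (warp tau (x t) * q t)).
  { intros t Ht. specialize (Ha t ltac:(unfold b in Ht; lra)). simpl in Ha.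
    apply Rabs_lt_between in Ha. assert (H := warp_ge_1 tau (x t)). nra. }
  assert (Hzg : forall t, b <= t -> z b + (t - b) / 2 <= z t).
  { intros t Ht. assert (/ 2 * (t - b) <= z t - z b); [|lra].
    eapply (increment_ge z); [assumption|intros; apply Hdz|intros c Hc; apply Hz; lra]. }
  assert (Lz : is_lim z p_infty p_infty).
  { apply is_lim_spec. intros M. exists (Rmax b (b + 2 * (M - z b) + 1)). intros t Ht.
    assert (H1 := Rmax_l b (b + 2 * (M - z b) + 1)). assert (H2 := Rmax_r b (b + 2 * (M - z b) + 1)).
    specialize (Hzg t ltac:(lra)). lra. }
  repeat apply conj.
  - exact Lx.
  - rewrite <- (Rabs_R1). apply (is_lim_comp_continuous q Rabs); [exact Lq|apply continuous_Rabs].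
  - exact Lz.
  (* The clamp [Rmax b] keeps the height on [[b, +oo)], where it increases, and extends it to the
     left with slope [1]. *)
  - destruct (clamped_inverse z (Rmax b)) as [g [Hg1 Hg2]].
    + apply (orbit_continuous tau mu x z p q F).
    + intros u v Huv. unfold Rmax. repeat destruct Rle_dec; lra.
    + intros u v Huv. assert (H := Rmax_l b u).
      destruct (mean_value z _ _ _ Huv (fun c _ => Hdz c)) as [c [Hc He]].
      specialize (Hz c ltac:(lra)). nra.
    + intros M. exists (Rmin b (b + M - z b - 1)). assert (H1 := Rmin_l b (b + M - z b - 1)).
      assert (H2 := Rmin_r b (b + M - z b - 1)). rewrite Rmax_left by lra. lra.
    + intros M. exists (Rmax b (b + 2 * (M - z b) + 1)).
      assert (H1 := Rmax_l b (b + 2 * (M - z b) + 1)). assert (H2 := Rmax_r b (b + 2 * (M - z b) + 1)).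
      set (t := Rmax b (b + 2 * (M - z b) + 1)) in *. rewrite Rmax_right by lra.
      specialize (Hzg t H1). lra.
    + exists (fun t => b < t), g. split; [now exists b|]. split; [assumption|].
      intros t Ht. apply Hg2, Rmax_right. lra.
  - apply is_lim_spec. intros M.
    destruct (backward_radius tau mu x z p q Htau Hmu F Hunbdd (M + 1)) as [T [_ HT]].
    exists T. intros t Ht. specialize (HT t ltac:(lra)). lra.
  - apply is_lim_spec. intros M.
    destruct (backward_height tau mu x z p q Htau Hmu F Hunbdd (M - 1)) as [T HT].
    exists T. intros t Ht. specialize (HT t ltac:(lra)). lra.
  - intros D [M HM].
    destruct (backward_loops tau mu x z p q Htau Hmu F Hunbdd (M - 1)) as (s&t&Hst&Ht&Hx&Hzz).
    exists s, t. repeat split; auto; try lra; apply HM; lra.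
Qed.

(** The primitive [T] of [rho] is a bijection of [R], so composing with its inverse [S] gives an
    orbit with [rho = 1] defined for all times; its ends are carried back through [S (T s) = s]. *)
Lemma flow_ends_pos (tau mu : R) (rho x z p q L : R -> R) :
  tau <> 0 -> 0 < mu -> flow tau mu rho x z p q ->
  (forall s, 0 < rho s) -> (forall s, continuous rho s) ->
  (forall s, is_derive L s (rho s * warp tau (x s))) ->
  is_lim L p_infty p_infty -> is_lim L m_infty m_infty ->
  (forall s, x s = / (2 * mu) /\ q s = 1 /\ p s = 0) \/
  profile_ends (/ (2 * mu)) x z q p_infty m_infty.
Proof.
  intros Htau Hmu F Hp Hc HL L1 L2.
  set (T := (fun s => RInt rho 0 s) : R -> R).
  assert (HT : forall s, is_derive T s (rho s)) by (intros s; exact (integral_derive rho s Hc)).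
  assert (Hup : forall M, exists s, M < T s) by (apply (time_unbounded tau mu rho x z p q T L); auto; lra).
  (* The past of the flow is the future of the reversed flow, to which [time_unbounded] applies with
     [- mu]. *)
  assert (Hdown : forall M, exists s, T s < M).
  { intros M.
    destruct (time_unbounded tau (- mu) (fun s => rho (- s)) (fun s => x (- s)) (fun s => z (- s))
      (fun s => - p (- s)) (fun s => - q (- s)) (fun s => - T (- s)) (fun s => - L (- s))) with (M := - M) as [s Hs].
    - assumption.
    - lra.
    - now apply flow_reverse.
    - auto.
    - intros s. rewrite <- (Ropp_involutive (rho (- s))).
      apply (is_derive_opp (fun s => T (- s))), derive_reverse, HT.
    - intros s. rewrite <- (Ropp_involutive (_ * _)).
      apply (is_derive_opp (fun s => L (- s))), derive_reverse, HL.
    - apply (is_lim_opp (fun s => L (- s)) _ m_infty), is_lim_reverse. exact L2.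
    - exists (- s). lra. }
  assert (Hinc : forall a b, a < b -> T a < T b).
  { intros a b Hab. destruct (mean_value T rho a b Hab) as [c [_ He]]; [auto|].
    specialize (Hp c). nra. }
  assert (HcT := continuous_of_derive T rho HT).
  destruct (increasing_inverse T HcT Hinc Hdown Hup) as (S&HST&HTS&HcS).
  assert (HdS := inverse_derive T rho S HT Hc Hp HTS HcS).
  assert (Hcomp : forall f df, (forall s, is_derive f s (rho s * df s)) ->
    forall t, is_derive (fun t => f (S t)) t (1 * df (S t))).
  { intros f df Hf t. evar_last.
    - apply (is_derive_comp f S); [apply Hf|apply HdS].
    - unfold scal; simpl. unfold mult; simpl. specialize (Hp (S t)). field. lra. }
  assert (F' : flow tau mu (fun _ => 1) (fun t => x (S t)) (fun t => z (S t)) (fun t => p (S t)) (fun t => q (S t))).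
  { constructor.
    - intros t. apply F.
    - intros t. apply F.
    - exact (Hcomp x p (flow_x _ _ _ _ _ _ _ F)).
    - exact (Hcomp z (fun s => warp tau (x s) * q s) (flow_z _ _ _ _ _ _ _ F)).
    - exact (Hcomp p (fun s => - q s * turning tau mu (x s) (p s) (q s)) (flow_p _ _ _ _ _ _ _ F)).
    - exact (Hcomp q (fun s => p s * turning tau mu (x s) (p s) (q s)) (flow_q _ _ _ _ _ _ _ F)). }
  assert (LT1 : is_lim T p_infty p_infty).
  { apply is_lim_spec. intros M. destruct (Hup M) as [s0 Hs0]. exists s0. intros s Hs.
    apply Hinc in Hs. lra. }
  assert (LT2 : is_lim T m_infty m_infty).
  { apply is_lim_spec. intros M. destruct (Hdown M) as [s0 Hs0]. exists s0. intros s Hs.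
    apply Hinc in Hs. lra. }
  assert (Back : forall f e l, (e = p_infty \/ e = m_infty) -> is_lim (fun t => f (S t)) e l -> is_lim f e l).
  { intros f e l He Hl. apply is_lim_ext with (fun s => f (S (T s))); [intros s; now rewrite HST|].
    apply (is_lim_comp (fun t => f (S t)) T e l e); [assumption| |];
      destruct He as [-> | ->]; try assumption; exists 0; intros; discriminate. }
  destruct (orbit_ends tau mu _ _ _ _ Htau Hmu F') as [H|(H1&H2&H3&(D&g&[b HD]&Hg&HgD)&H4&H5&H6)].
  - left. intros s. rewrite <- (HST s). apply H.
  - right. split; [apply Back; auto|]. split; [apply (Back (fun s => Rabs (q s))); auto|].
    split; [apply Back; auto|]. split; [|split; [apply Back; auto|split; [apply Back; auto|]]].
    + exists (fun s => D (T s)), (fun y => S (g y)). split; [|split].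
      * destruct (Hup b) as [s0 Hs0]. exists s0. intros s Hs. apply HD. apply Hinc in Hs. lra.
      * intros y. apply (continuous_comp g S); auto.
      * intros s Hs. apply HgD in Hs. rewrite HST in Hs. rewrite Hs. apply HST.
    + intros D' [M HM]. destruct (H6 (fun t => D' (S t))) as (s&t&Hst&Hs&Ht&Hx&Hz).
      * destruct (Hdown (T M)) as [s0 Hs0]. exists (T s0). intros t Ht. apply HM.
        apply Rnot_le_lt. intros Hle. rewrite <- (HTS t) in Ht.
        destruct Hle as [Hle|Hle]; [apply Hinc in Hle; lra|]. rewrite <- Hle in Ht. lra.
      * exists (S s), (S t). repeat split; auto.
        intros He. apply Hst. rewrite <- (HTS s), <- (HTS t). now rewrite He.
Qed.

Lemma profile_ends_reverse (R0 : R) (x z q : R -> R) :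
  profile_ends R0 (fun s => x (- s)) (fun s => z (- s)) (fun s => - q (- s)) p_infty m_infty ->
  profile_ends R0 x z q m_infty p_infty.
Proof.
  assert (Back : forall (f : R -> R) e l, is_lim (fun s => f (- s)) (Rbar_opp e) l -> is_lim f e l).
  { intros f e l H. apply is_lim_ext with (fun s => f (- - s)); [intros; now rewrite Ropp_involutive|].
    apply (is_lim_reverse (fun s => f (- s))), H. }
  intros (H1&H2&H3&(D&g&[b HD]&Hg&HgD)&H4&H5&H6).
  split; [now apply Back|]. split; [|split; [now apply Back|split; [|split; [now apply Back|split; [now apply Back|]]]]].
  - apply Back. apply is_lim_ext with (2 := H2). intros s. apply Rabs_Ropp.
  - exists (fun s => D (- s)), (fun y => - g y). split; [|split].
    + exists (- b). intros s Hs. apply HD. lra.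
    + intros y. apply (continuous_opp g), Hg.
    + intros s Hs. apply HgD in Hs. rewrite Ropp_involutive in Hs. rewrite Hs. ring.
  - intros D' [M HM]. destruct (H6 (fun s => D' (- s))) as (s&t&Hst&Hs&Ht&Hx&Hz).
    + exists (- M). intros s Hs. apply HM. lra.
    + exists (- s), (- t). repeat split; auto. lra.
Qed.

Lemma flow_ends (tau mu : R) (rho x z p q L : R -> R) :
  tau <> 0 -> mu <> 0 -> flow tau mu rho x z p q ->
  (forall s, 0 < rho s) -> (forall s, continuous rho s) ->
  (forall s, is_derive L s (rho s * warp tau (x s))) ->
  is_lim L p_infty p_infty -> is_lim L m_infty m_infty ->
  (exists c, c ^ 2 = 1 /\ forall s, x s = / (2 * Rabs mu) /\ q s = c /\ p s = 0) \/
  exists e1 e2, opposite_ends e1 e2 /\ profile_ends (/ (2 * Rabs mu)) x z q e1 e2.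
Proof.
  intros Htau Hmu F Hp Hc HL L1 L2. destruct (Rlt_le_dec 0 mu) as [H|H].
  - rewrite Rabs_right by lra.
    destruct (flow_ends_pos tau mu rho x z p q L) as [H1|H1]; auto.
    + left. exists 1. split; [ring|assumption].
    + right. exists p_infty, m_infty. split; [left; auto|assumption].
  - rewrite Rabs_left by lra.
    destruct (flow_ends_pos tau (- mu) (fun s => rho (- s)) (fun s => x (- s)) (fun s => z (- s))
      (fun s => - p (- s)) (fun s => - q (- s)) (fun s => - L (- s))) as [H1|H1]; auto.
    + lra.
    + now apply flow_reverse.
    + intros s. apply (continuous_comp Ropp rho); [|apply Hc].
      apply (continuous_opp (fun y : R => y)), continuous_id.
    + intros s. rewrite <- (Ropp_involutive (_ * _)).
      apply (is_derive_opp (fun s => L (- s))), derive_reverse, HL.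
    + apply (is_lim_opp (fun s => L (- s)) _ m_infty), is_lim_reverse. exact L2.
    + apply (is_lim_opp (fun s => L (- s)) _ p_infty), is_lim_reverse. exact L1.
    + left. exists (-1). split; [ring|]. intros s. destruct (H1 (- s)) as (Ha&Hb&Hc').
      rewrite Ropp_involutive in *. repeat split; lra.
    + right. exists m_infty, p_infty. split; [right; auto|]. now apply profile_ends_reverse.
Qed.

(** * The mean curvature of a rotational surface *)

Lemma d_gcoef_eq (tau : R) (k i j : ix) (a b c : R) :
  d_gcoef tau k i j (a, b, c) =
  match k, i, j with
  | ix_x, ix_y, ix_y => 2 * tau ^ 2 * a
  | ix_x, ix_x, ix_y | ix_x, ix_y, ix_x => - tau ^ 2 * b
  | ix_x, ix_y, ix_z | ix_x, ix_z, ix_y => - tau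
  | ix_y, ix_x, ix_x => 2 * tau ^ 2 * b
  | ix_y, ix_x, ix_y | ix_y, ix_y, ix_x => - tau ^ 2 * a
  | ix_y, ix_x, ix_z | ix_y, ix_z, ix_x => tau
  | _, _, _ => 0
  end.
Proof.
  unfold d_gcoef. apply is_derive_unique.
  destruct k, i, j; unfold gcoef, metric, shift, basis; auto_derive; auto; ring.
Qed.

Section Profile.
Variables (x z x1 z1 x2 z2 : R -> R).
Hypothesis (Hx : forall s, is_derive x s (x1 s)) (Hz : forall s, is_derive z s (z1 s)).
Hypothesis (Hx1 : forall s, is_derive x1 s (x2 s)) (Hz1 : forall s, is_derive z1 s (z2 s)).

Let X := rot_surface x z.

Lemma derive_mult_const (f : R -> R) (l c s : R) :
  is_derive f s l -> Derive (fun u => f u * c) s = l * c.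
Proof.
  intros H. apply is_derive_unique. auto_derive; [now exists l|].
  replace (Derive (fun u => f u) s) with l by (symmetry; now apply is_derive_unique). ring.
Qed.

Lemma partial_s_eq s t : partial_s X s t = (x1 s * cos t, x1 s * sin t, z1 s).
Proof.
  unfold partial_s, velocity, X, rot_surface; simpl.
  rewrite (derive_mult_const x (x1 s)), (derive_mult_const x (x1 s)) by apply Hx.
  rewrite (Derive_ext _ z), (is_derive_unique _ _ _ (Hz s)) by reflexivity. reflexivity.
Qed.

Lemma partial_t_eq s t : partial_t X s t = (- x s * sin t, x s * cos t, 0).
Proof.
  unfold partial_t, velocity, X, rot_surface; simpl.
  apply f_equal2; [apply f_equal2|]; apply is_derive_unique; auto_derive; auto; ring.
Qed.

Lemma partial_ss_eq s t : partial_s (partial_s X) s t = (x2 s * cos t, x2 s * sin t, z2 s).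
Proof.
  change (partial_s (partial_s X) s t) with (velocity (fun u => partial_s X u t) s). unfold velocity.
  apply f_equal2; [apply f_equal2|].
  - rewrite (Derive_ext _ (fun u => x1 u * cos t)) by (intros; now rewrite partial_s_eq).
    now apply derive_mult_const.
  - rewrite (Derive_ext _ (fun u => x1 u * sin t)) by (intros; now rewrite partial_s_eq).
    now apply derive_mult_const.
  - rewrite (Derive_ext _ z1) by (intros; now rewrite partial_s_eq).
    now apply is_derive_unique.
Qed.

Lemma partial_st_eq s t : partial_s (partial_t X) s t = (- x1 s * sin t, x1 s * cos t, 0).
Proof.
  change (partial_s (partial_t X) s t) with (velocity (fun u => partial_t X u t) s). unfold velocity.
  apply f_equal2; [apply f_equal2|].
  - rewrite (Derive_ext _ (fun u => x u * - sin t)) by (intros; rewrite partial_t_eq; simpl; ring).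
    rewrite (derive_mult_const x (x1 s)) by apply Hx. ring.
  - rewrite (Derive_ext _ (fun u => x u * cos t)) by (intros; now rewrite partial_t_eq).
    now apply derive_mult_const.
  - rewrite (Derive_ext _ (fun u => 0)) by (intros; now rewrite partial_t_eq).
    apply Derive_const.
Qed.

Lemma partial_tt_eq s t : partial_t (partial_t X) s t = (- x s * cos t, - x s * sin t, 0).
Proof.
  change (partial_t (partial_t X) s t) with (velocity (fun u => partial_t X s u) t). unfold velocity.
  apply f_equal2; [apply f_equal2|].
  - rewrite (Derive_ext _ (fun u => - x s * sin u)) by (intros; now rewrite partial_t_eq).
    apply is_derive_unique. auto_derive; auto; ring.
  - rewrite (Derive_ext _ (fun u => x s * cos u)) by (intros; now rewrite partial_t_eq).
    apply is_derive_unique. auto_derive; auto; ring.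
  - rewrite (Derive_ext _ (fun u => 0)) by (intros; now rewrite partial_t_eq).
    apply Derive_const.
Qed.

(** The [W^2] of the overview. It is [(E G - F^2) / a^2], not the squared speed [a1 ^ 2 + c1 ^ 2] of
    the profile curve: meridians need not be orthogonal to the rotation orbits. *)
Definition speed_sqr (tau a a1 c1 : R) : R := (1 + tau ^ 2 * a ^ 2) * a1 ^ 2 + c1 ^ 2.

Lemma mean_curvature_eq (tau : R) (N : R -> R -> R3) (k s : R) :
  x s <> 0 -> speed_sqr tau (x s) (x1 s) (z1 s) <> 0 ->
  N s 0 = (- k * z1 s, k * (tau * x s * x1 s), k * ((1 + tau ^ 2 * x s ^ 2) * x1 s)) ->
  mean_curvature tau X N s 0 =
  k * (z1 s * speed_sqr tau (x s) (x1 s) (z1 s)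
       + x s * (1 + tau ^ 2 * x s ^ 2) * (x1 s * z2 s - z1 s * x2 s)
       - tau ^ 2 * x s ^ 2 * x1 s ^ 2 * z1 s)
  / (2 * x s * speed_sqr tau (x s) (x1 s) (z1 s)).
Proof.
  intros Hx0 HW HN. unfold mean_curvature.
  rewrite partial_s_eq, partial_t_eq, partial_ss_eq, partial_st_eq, partial_tt_eq, HN.
  unfold X, rot_surface. rewrite cos_0, sin_0.
  unfold cov_inner, sum3, christoffel. rewrite !d_gcoef_eq. unfold metric, coord; simpl fst; simpl snd.
  unfold speed_sqr in *. field. repeat split; auto.
  - now rewrite Rpow_mult_distr.
  (* The denominator left by [field] is [E G - F^2], which is [x s * x s] times [speed_sqr]. *)
  - intros H. apply HW. apply (Rmult_eq_reg_l (x s * x s)); [|now apply Rmult_integral_contrapositive].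
    rewrite Rmult_0_r, <- H. ring.
Qed.
End Profile.

(** Here [n3 - tau * a * n2] is [<N, d_z>]. Orthogonality to the orbit expresses [n2] through it,
    orthogonality to the profile fixes the direction of [(n1, <N, d_z>)], and unit length leaves a
    sign. The sign is given by a formula, so that its continuity along the surface can be proved. *)
Lemma unit_normal_eq (tau a a1 c1 n1 n2 n3 : R) :
  a <> 0 -> 0 < speed_sqr tau a a1 c1 ->
  metric tau (a, 0, 0) (n1, n2, n3) (n1, n2, n3) = 1 ->
  metric tau (a, 0, 0) (n1, n2, n3) (a1, 0, c1) = 0 ->
  metric tau (a, 0, 0) (n1, n2, n3) (0, a, 0) = 0 ->
  let w2 := 1 + tau ^ 2 * a ^ 2 in
  let W := sqrt (speed_sqr tau a a1 c1) in
  let sg := (- n1 * c1 + w2 * (n3 - tau * a * n2) * a1) / W in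
  sg ^ 2 = 1 /\
  n1 = - (sg / W) * c1 /\ n2 = sg / W * (tau * a * a1) /\ n3 = sg / W * (w2 * a1) /\
  n3 - tau * a * n2 = sg * a1 / W.
Proof.
  intros Ha HW2 H1 H2 H3 w2 W sg. unfold metric in H1, H2, H3.
  assert (HW : 0 < W) by now apply sqrt_lt_R0.
  assert (HWW : W * W = w2 * a1 ^ 2 + c1 ^ 2) by (apply sqrt_sqrt; left; exact HW2).
  set (om := n3 - tau * a * n2) in *.
  assert (E2 : n2 = tau * a * om).
  { apply (Rmult_eq_reg_l a); [|assumption]. unfold om in *. nra. }
  assert (E3 : n1 * a1 + om * c1 = 0) by (unfold om; lra).
  assert (E1 : n1 ^ 2 + w2 * om ^ 2 = 1).
  { unfold w2. transitivity (n1 ^ 2 + (tau * a * om) * (tau * a * om) + om ^ 2); [ring|].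
    rewrite <- E2. unfold om. lra. }
  assert (S1 : sg * c1 = - n1 * W).
  { apply (Rmult_eq_reg_r W); [|lra]. transitivity ((- n1 * c1 + w2 * om * a1) * c1); [unfold sg; field; lra|].
    transitivity (- n1 * c1 ^ 2 + w2 * a1 * (om * c1)); [ring|].
    replace (om * c1) with (- n1 * a1) by lra.
    transitivity (- n1 * (W * W)); [rewrite HWW|]; ring. }
  assert (S2 : sg * a1 = om * W).
  { apply (Rmult_eq_reg_r W); [|lra]. transitivity ((- n1 * c1 + w2 * om * a1) * a1); [unfold sg; field; lra|].
    transitivity (- (n1 * a1) * c1 + w2 * om * a1 ^ 2); [ring|].
    replace (n1 * a1) with (- (om * c1)) by lra.
    transitivity (om * (W * W)); [rewrite HWW|]; ring. }
  assert (O : om = sg * a1 / W) by (rewrite S2; field; lra).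
  repeat split.
  - apply (Rmult_eq_reg_r (W * W)); [|nra].
    transitivity (w2 * (sg * a1) ^ 2 + (sg * c1) ^ 2); [rewrite HWW; ring|].
    rewrite S1, S2. transitivity ((n1 ^ 2 + w2 * om ^ 2) * (W * W)); [ring|]. rewrite E1. ring.
  - transitivity (- (sg * c1) / W); [rewrite S1|]; field; lra.
  - rewrite E2, O. field. lra.
  - transitivity (om + tau * a * n2); [unfold om; ring|]. rewrite E2, O. unfold w2. field. lra.
  - exact O.
Qed.

(** [sg] is the orientation of the normal and [de] the side of the axis on which the profile lies;
    both are absorbed into [mu]. The last hypothesis is the translator equation cleared of
    denominators. *)
Lemma profile_flow (tau lam sg de : R) (x z x1 z1 x2 z2 W : R -> R) :
  sg ^ 2 = 1 -> de ^ 2 = 1 -> (forall s, 0 < de * x s) ->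
  (forall s, is_derive x s (x1 s)) -> (forall s, is_derive z s (z1 s)) ->
  (forall s, is_derive x1 s (x2 s)) -> (forall s, is_derive z1 s (z2 s)) ->
  (forall s, 0 < W s) -> (forall s, W s ^ 2 = speed_sqr tau (x s) (x1 s) (z1 s)) ->
  (forall s, is_derive W s (((1 + tau ^ 2 * x s ^ 2) * (x1 s * x2 s) + tau ^ 2 * x s * x1 s ^ 3
    + z1 s * z2 s) / W s)) ->
  (forall s, z1 s * speed_sqr tau (x s) (x1 s) (z1 s)
     + x s * (1 + tau ^ 2 * x s ^ 2) * (x1 s * z2 s - z1 s * x2 s)
     - tau ^ 2 * x s ^ 2 * x1 s ^ 2 * z1 s
     = 2 * x s * speed_sqr tau (x s) (x1 s) (z1 s) * (x1 s + sg * lam * W s)) ->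
  flow tau (de * sg * lam) (fun s => W s / warp tau (x s)) (fun s => de * x s) z
    (fun s => de * x1 s * warp tau (x s) / W s) (fun s => z1 s / W s).
Proof.
  intros Hsg Hde Hpos Hx Hz Hx1 Hz1 HW0 HWW HW HQ.
  pose proof (warp_derive tau) as Hw.
  assert (Hwd : forall s, warp tau (de * x s) = warp tau (x s)).
  { intros s. now apply warp_sign. }
  assert (Hinv : forall s y, y / (de * x s) = de * (y / x s)).
  { intros s y. specialize (Hpos s). assert (Hn1 : de <> 0) by (intros H; rewrite H in Hpos; lra).
    assert (Hn2 : x s <> 0) by (intros H; rewrite H in Hpos; lra).
    transitivity (de ^ 2 * (y / (de * x s))); [rewrite Hde; ring|]. field. auto. }
  assert (Hx0 : forall s, x s <> 0).
  { intros s H. specialize (Hpos s). rewrite H in Hpos. lra. }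
  constructor; intros t; assert (Hw1 := warp_pos tau (x t)); assert (Hw2 := warp_sqr tau (x t));
    specialize (HW0 t); specialize (HWW t).
  - apply Hpos.
  - unfold speed_sqr in HWW. rewrite <- Hw2 in HWW.
    transitivity ((de ^ 2 * (warp tau (x t) ^ 2 * x1 t ^ 2) + z1 t ^ 2) / W t ^ 2); [field; lra|].
    rewrite Hde, Rmult_1_l, <- HWW. field. lra.
  - evar_last; [apply is_derive_scal, Hx|]. field. lra.
  - rewrite Hwd. evar_last; [apply Hz|]. field. lra.
  - unfold turning. rewrite Hwd.  rewrite Hinv. specialize (HQ t). specialize (Hx0 t).
    set (w := warp tau (x t)) in *.
    derive_hyps; [lra|]. fold w.
    (* This factor clears all denominators; the translator equation [HQ] is then substituted from
       right to left, and the rest is an identity of polynomials. *)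
    apply (Rmult_eq_reg_r (W t ^ 3 * w * x t)).
    2:{ apply Rmult_integral_contrapositive; split; [|assumption]. apply Rmult_integral_contrapositive; split; [|lra].
        apply pow_nonzero. lra. }
    transitivity (de * (x t * x2 t * w ^ 2 * W t ^ 2 + tau ^ 2 * x t ^ 2 * x1 t ^ 2 * W t ^ 2
       - x t * x1 t * w ^ 2 * ((1 + tau ^ 2 * x t ^ 2) * (x1 t * x2 t) + tau ^ 2 * x t * x1 t ^ 3 + z1 t * z2 t))).
    { field. lra. }
    transitivity (- de * z1 t * (2 * x t * W t ^ 2 * (x1 t + sg * lam * W t) - z1 t * W t ^ 2)).
    { rewrite HWW, <- HQ, Hw2. unfold speed_sqr. ring. }
    field. lra.
  - unfold turning. rewrite Hwd. rewrite Hinv. specialize (HQ t). specialize (Hx0 t).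
    set (w := warp tau (x t)) in *.
    derive_hyps; [lra|].
    apply (Rmult_eq_reg_r (W t ^ 3 * x t)).
    2:{ apply Rmult_integral_contrapositive; split; [|assumption]. apply pow_nonzero. lra. }
    transitivity (x t * z2 t * W t ^ 2
       - x t * z1 t * ((1 + tau ^ 2 * x t ^ 2) * (x1 t * x2 t) + tau ^ 2 * x t * x1 t ^ 3 + z1 t * z2 t)).
    { field. lra. }
    transitivity (de ^ 2 * x1 t * (2 * x t * W t ^ 2 * (x1 t + sg * lam * W t) - z1 t * W t ^ 2)).
    { rewrite HWW, <- HQ, Hde. unfold speed_sqr. ring. }
    field. lra.
Qed.

(** * Compactness, embeddedness and distances *)

Lemma continuous_pair {U V W : UniformSpace} (f : U -> V) (g : U -> W) (u : U) :
  continuous f u -> continuous g u -> continuous (fun u => (f u, g u)) u.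
Proof.
  intros Hf Hg. apply filterlim_locally. intros eps.
  assert (H1 := proj1 (filterlim_locally _ _) Hf eps). assert (H2 := proj1 (filterlim_locally _ _) Hg eps).
  generalize (filter_and _ _ H1 H2). apply filter_imp. intros v [H3 H4]. now split.
Qed.

Ltac continuity_step :=
  match goal with
  | |- continuous (fun u => ?c) _ => apply continuous_const
  | |- continuous (fun u => u) _ => apply continuous_id
  | |- continuous (fun u => fst u) _ => apply continuous_fst
  | |- continuous (fun u => snd u) _ => apply continuous_snd
  | |- continuous (fun u => (@?f u, @?g u)) _ => apply (continuous_pair f g)
  | |- continuous (fun u => @?f u + @?g u) _ => apply (continuous_plus f g)
  | |- continuous (fun u => @?f u - @?g u) _ => apply (continuous_minus f g)
  | |- continuous (fun u => - @?f u) _ => apply (continuous_opp f)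
  | |- continuous (fun u => @?f u * @?g u) _ => apply (continuous_mult f g)
  | |- continuous (fun u => Rabs (@?f u)) _ => apply (continuous_comp f Rabs); [|apply continuous_Rabs]
  | |- continuous (fun u => sqrt (@?f u)) _ => apply (continuous_comp f sqrt); [|apply continuous_sqrt]
  end.

Lemma coord_continuous (i : ix) (p : R3) : continuous (coord i) p.
Proof.
  destruct i; simpl.
  - apply (continuous_comp (fst : R3 -> R * R) fst); apply continuous_fst.
  - apply (continuous_comp (fst : R3 -> R * R) snd); [apply continuous_fst|apply continuous_snd].
  - apply continuous_snd.
Qed.

Lemma locally_gt {U : UniformSpace} (f : U -> R) (c : R) (u : U) :
  continuous f u -> c < f u -> locally u (fun v => c < f v).
Proof. intros Hf Hc. apply Hf. now apply open_gt. Qed.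

(** The sets of points farther than [eta] from [p] in some coordinate cover everything except [p]. A
    finite subcover of [K] has a least [eta], and the box of that size around [p] misses [K]. *)
Lemma compact_set_closed (K : R3 -> Prop) (p : R3) :
  compact_set K -> ~ K p -> locally p (fun q => ~ K q).
Proof.
  intros HK Hp.
  destruct (HK posreal (fun eta q => exists i, eta < Rabs (coord i q - coord i p))) as [l Hl].
  - intros eta q [i Hi].
    assert (Hc : continuous (fun q => Rabs (coord i q - coord i p)) q).
    { apply (continuous_comp (fun q => coord i q - coord i p) Rabs); [|apply continuous_Rabs].
      apply (continuous_minus (coord i)); [apply coord_continuous|apply continuous_const]. }
    generalize (locally_gt _ eta q Hc Hi). apply filter_imp. intros v Hv. now exists i.
  - intros q Hq. apply NNPP. intros Hn. apply Hp. replace p with q; [assumption|].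
    assert (Hi : forall i, coord i q = coord i p).
    { intros i. destruct (Req_dec (coord i q) (coord i p)) as [H|H]; [assumption|]. exfalso. apply Hn.
      assert (H0 : 0 < Rabs (coord i q - coord i p)) by (apply Rabs_pos_lt; lra).
      exists (mkposreal _ (is_pos_div_2 (mkposreal _ H0))), i. simpl. lra. }
    destruct q as [[q1 q2] q3], p as [[p1 p2] p3].
    assert (H1 := Hi ix_x). assert (H2 := Hi ix_y). assert (H3 := Hi ix_z). simpl in *. congruence.
  - assert (Hm : exists m : posreal, forall eta, In eta l -> m <= eta).
    { clear. induction l as [|e l [m Hm]].
      - exists (mkposreal 1 Rlt_0_1). intros eta [].
      - assert (H0 : 0 < Rmin e m) by (apply Rmin_pos; apply cond_pos).
        exists (mkposreal _ H0). simpl. intros eta [<-|H].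
        + apply Rmin_l.
        + eapply Rle_trans; [apply Rmin_r|auto]. }
    destruct Hm as [m Hm]. exists m. intros q Hq HKq.
    destruct (Hl q HKq) as [eta [Hin [i Hi]]]. specialize (Hm eta Hin).
    assert (Hb : Rabs (coord i q - coord i p) < m) by (destruct Hq as [[Ha Hb] Hc], i; assumption).
    lra.
Qed.

Lemma compact_set_bounded (K : R3 -> Prop) (i : ix) :
  compact_set K -> exists B, forall q, K q -> Rabs (coord i q) <= B.
Proof.
  intros HK. destruct (HK R (fun M q => Rabs (coord i q) < M)) as [l Hl].
  - intros M q Hq.
    assert (Hc : continuous (fun q => - Rabs (coord i q)) q).
    { apply (continuous_opp (fun q => Rabs (coord i q))).
      apply (continuous_comp (coord i) Rabs); [apply coord_continuous|apply continuous_Rabs]. }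
    generalize (locally_gt _ (- M) q Hc ltac:(lra)). apply filter_imp. intros v Hv. lra.
  - intros q Hq. exists (Rabs (coord i q) + 1). lra.
  - assert (Hm : exists B, forall M, In M l -> M <= B).
    { clear. induction l as [|e l [m Hm]].
      - exists 0. intros M [].
      - exists (Rmax e m). intros M [<-|H]; [apply Rmax_l|].
        eapply Rle_trans; [|apply Rmax_r]. auto. }
    destruct Hm as [B HB]. exists B. intros q Hq. destruct (Hl q Hq) as [M [HM Hqm]].
    specialize (HB M HM). lra.
Qed.

(** Heine-Borel: each point has a ball that lies in one member of the cover or misses [A], and
    finitely many of these balls cover the box of half-width [M]. The existence of that finite list
    comes under a double negation. *)
Lemma compact_set_closed_bounded (A : R * (R * R) -> Prop) (M : R) :
  (forall q, ~ A q -> locally q (fun q' => ~ A q')) ->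
  (forall q, A q -> Rabs (fst q) <= M /\ Rabs (fst (snd q)) <= M /\ Rabs (snd (snd q)) <= M) ->
  compact_set A.
Proof.
  intros Hcl Hbd I V HV Hcov.
  assert (Hd : forall q, exists d : posreal, (exists i, forall q', ball q d q' -> V i q') \/
    (forall q', ball q d q' -> ~ A q')).
  { intros q. destruct (classic (A q)) as [Hq|Hq].
    - destruct (Hcov q Hq) as [i Hi]. destruct (HV i q Hi) as [d Hd]. exists d. left. now exists i.
    - destruct (Hcl q Hq) as [d Hd]. exists d. now right. }
  set (dl := fun q => proj1_sig (constructive_indefinite_description _ (Hd q))).
  assert (Hdl : forall q, (exists i, forall q', ball q (dl q) q' -> V i q') \/
    (forall q', ball q (dl q) q' -> ~ A q')).
  { intros q. unfold dl. now destruct constructive_indefinite_description. }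
  set (pt := fun t : Tn 3 R => (fst t, (fst (snd t), fst (snd (snd t))))).
  set (box := fun c : R => (c, (c, (c, tt))) : Tn 3 R).
  assert (HL := compactness_list 3 (box (- M)) (box M) (fun t => dl (pt t))).
  apply NNPP in HL. destruct HL as [l Hl].
  assert (Hfin : exists li : list I, forall t, In t l -> forall q', ball (pt t) (dl (pt t)) q' -> A q' ->
    exists i, In i li /\ V i q').
  { clear Hl. induction l as [|t l [li Hli]].
    - exists nil. intros t [].
    - destruct (Hdl (pt t)) as [[i Hi]|Hn].
      + exists (i :: li). intros t' [<-|Ht'] q' Hq' HA.
        * exists i. split; [now left|auto].
        * destruct (Hli t' Ht' q' Hq' HA) as [j [Hj1 Hj2]]. exists j. split; [now right|assumption].
      + exists li. intros t' [<-|Ht'] q' Hq' HA; [now destruct (Hn q' Hq')|]. now apply (Hli t' Ht' q'). }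
  destruct Hfin as [li Hli]. exists li. intros [a [b c]] Hq.
  destruct (Hl (a, (b, (c, tt)))) as [t [Ht [Hb Hc]]].
  - destruct (Hbd _ Hq) as (H1&H2&H3). simpl in *.
    apply Rabs_le_between in H1, H2, H3. repeat split; lra.
  - apply (Hli t Ht); [|assumption]. destruct t as [t1 [t2 [t3 []]]].
    simpl in Hc. destruct Hc as (H1&H2&H3&_). unfold pt in *; simpl in *.
    split; [exact H1|split; [exact H2|exact H3]].
Qed.

Lemma annulus_map_continuous (x z : R -> R) (q : R * (R * R)) :
  (forall s, continuous x s) -> (forall s, continuous z s) -> continuous (annulus_map x z) q.
Proof.
  intros Hx Hz.
  apply (continuous_ext (fun q : R * (R * R) => ((x (fst q) * fst (snd q), x (fst q) * snd (snd q)), z (fst q)))).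
  { now intros [s [c d]]. }
  assert (Hf : forall f : R -> R, (forall s, continuous f s) -> continuous (fun q : R * (R * R) => f (fst q)) q).
  { intros f Hf. apply (continuous_comp fst f); [apply continuous_fst|apply Hf]. }
  assert (Hs : continuous (fun q : R * (R * R) => snd q) q) by apply continuous_snd.
  apply continuous_pair; [apply continuous_pair|now apply Hf].
  - apply (continuous_mult (fun q : R * (R * R) => x (fst q))); [now apply Hf|].
    apply (continuous_comp snd fst); [exact Hs|apply continuous_fst].
  - apply (continuous_mult (fun q : R * (R * R) => x (fst q))); [now apply Hf|].
    apply (continuous_comp snd snd); [exact Hs|apply continuous_snd].
Qed.

Lemma annulus_closed (q : R * (R * R)) : ~ annulus q -> locally q (fun q' => ~ annulus q').
Proof.
  intros Hq.
  assert (Hc : continuous (fun q : R * (R * R) => Rabs (fst (snd q) ^ 2 + snd (snd q) ^ 2 - 1)) q).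
  { assert (H1 : continuous (fun q : R * (R * R) => fst (snd q)) q).
    { apply (continuous_comp snd fst); [apply continuous_snd|apply continuous_fst]. }
    assert (H2 : continuous (fun q : R * (R * R) => snd (snd q)) q).
    { apply (continuous_comp snd snd); [apply continuous_snd|apply continuous_snd]. }
    apply (continuous_comp (fun q : R * (R * R) => fst (snd q) ^ 2 + snd (snd q) ^ 2 - 1) Rabs); [|apply continuous_Rabs].
    apply (continuous_minus (fun q : R * (R * R) => fst (snd q) ^ 2 + snd (snd q) ^ 2)); [|apply continuous_const].
    simpl. apply (continuous_plus (fun q : R * (R * R) => fst (snd q) * (fst (snd q) * 1))).
    - apply (continuous_mult (fun q : R * (R * R) => fst (snd q))); [exact H1|].
      apply (continuous_mult (fun q : R * (R * R) => fst (snd q))); [exact H1|apply continuous_const].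
    - apply (continuous_mult (fun q : R * (R * R) => snd (snd q))); [exact H2|].
      apply (continuous_mult (fun q : R * (R * R) => snd (snd q))); [exact H2|apply continuous_const]. }
  generalize (locally_gt _ 0 q Hc ltac:(apply Rabs_pos_lt; unfold annulus in Hq; lra)).
  apply filter_imp. intros v Hv Ha. unfold annulus in Ha.
  rewrite Ha, Rminus_diag, Rabs_R0 in Hv. lra.
Qed.

(** Compactness bounds the height, the height bounds [s], and the circle factor is bounded
    anyway. *)
Lemma proper_annulus (x z : R -> R) :
  (forall s, continuous x s) -> (forall s, continuous z s) ->
  (forall B, exists M, forall s, Rabs (z s) <= B -> Rabs s <= M) ->
  forall K : R3 -> Prop, compact_set K ->
    compact_set (fun q => annulus q /\ K (annulus_map x z q)).
Proof.
  intros Hx Hz Hpr K HK.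
  destruct (compact_set_bounded K ix_z HK) as [B HB]. destruct (Hpr B) as [M HM].
  apply (compact_set_closed_bounded _ (Rmax 1 M)).
  - intros q Hq. apply not_and_or in Hq. destruct Hq as [Hq|Hq].
    + generalize (annulus_closed q Hq). apply filter_imp. tauto.
    + assert (H := annulus_map_continuous x z q Hx Hz _ (compact_set_closed K _ HK Hq)).
      unfold filtermap in H. revert H. apply filter_imp. tauto.
  - intros [s [c d]] [Ha HKq]. unfold annulus in Ha; simpl in *.
    assert (H1 := Rmax_l 1 M). assert (H2 := Rmax_r 1 M).
    assert (Hzs := HM s (HB _ HKq)).
    destruct (unit_sqr_le c d) as (_&_&Hc&Hd); [lra|].
    repeat split; [lra|apply Rabs_le; lra|apply Rabs_le; lra].
Qed.

(** The height recovers [s], and division by [x s] then recovers the point of the circle. This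
    continuous left inverse [Phi] yields injectivity and the homeomorphism at once. *)
Lemma embedded_of_left_inverse (x z g : R -> R) (D : R -> Prop) :
  (forall s, continuous x s) -> (forall s, x s <> 0) ->
  (forall y, continuous g y) -> (forall s, D s -> g (z s) = s) -> embedded_on x z D.
Proof.
  intros Hx Hx0 Hg HgD.
  set (Phi := fun p : R3 => (g (snd p), (fst (fst p) * / x (g (snd p)), snd (fst p) * / x (g (snd p))))).
  assert (HPhi : forall q, D (fst q) -> Phi (annulus_map x z q) = q).
  { intros [s [c d]] Hs. unfold Phi; simpl in *. rewrite HgD by assumption.
    apply f_equal, f_equal2; field; auto. }
  split.
  - intros p (q1&q2&_&_&H1&H2&Hne&E1&E2). apply Hne.
    rewrite <- (HPhi q1), <- (HPhi q2) by assumption. now rewrite E1, E2.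
  - intros q V _ Hq HV. exists (fun p => V (Phi p)). split.
    + assert (Hc : continuous Phi (annulus_map x z q)).
      { set (p := annulus_map x z q). assert (Hs := coord_continuous ix_z p). simpl in Hs.
        assert (Hgs : continuous (fun p : R3 => g (snd p)) p) by (apply (continuous_comp snd g); auto).
        assert (Hix : continuous (fun p : R3 => / x (g (snd p))) p).
        { apply (continuous_comp (fun p : R3 => x (g (snd p))) Rinv).
          - apply (continuous_comp (fun p : R3 => g (snd p)) x); auto.
          - apply continuous_Rinv, Hx0. }
        apply continuous_pair; [exact Hgs|]. apply continuous_pair.
        - apply (continuous_mult (fun p : R3 => fst (fst p))); [apply (coord_continuous ix_x p)|exact Hix].
        - apply (continuous_mult (fun p : R3 => snd (fst p))); [apply (coord_continuous ix_y p)|exact Hix]. }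
      apply Hc. rewrite HPhi; assumption.
    + intros q' _ Hq' HW. now rewrite HPhi in HW.
Qed.

Lemma C1_affine (a b : R) : Defs.C1 (fun v => a + b * v).
Proof.
  assert (H : forall v, is_derive (fun v => a + b * v) v b) by (intros v; auto_derive; [trivial|ring]).
  intros u. split; [now exists b|].
  apply (continuous_ext (fun _ => b)); [|apply continuous_const].
  intros v. symmetry. apply is_derive_unique, H.
Qed.

Lemma dist_to_le (tau : R) (p : R3) (S : R3 -> Prop) (c : R -> R3) (l : R) :
  C1_curve c -> c 0 = p -> S (c 1) -> curve_length tau c 0 1 = l -> Rbar_le (dist_to tau p S) l.
Proof.
  intros H1 H2 H3 H4. unfold dist_to.
  apply (proj1 (Glb_Rbar_correct (fun l => exists c : R -> R3,
    C1_curve c /\ c 0 = p /\ S (c 1) /\ l = curve_length tau c 0 1))).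
  exists c. auto.
Qed.

Lemma dist_to_ge (tau : R) (p : R3) (S : R3 -> Prop) (b : R) :
  (forall c, C1_curve c -> c 0 = p -> S (c 1) -> b <= curve_length tau c 0 1) ->
  Rbar_le b (dist_to tau p S).
Proof.
  intros H. unfold dist_to.
  apply (proj2 (Glb_Rbar_correct (fun l => exists c : R -> R3,
    C1_curve c /\ c 0 = p /\ S (c 1) /\ l = curve_length tau c 0 1))).
  intros l (c&H1&H2&H3&->). now apply H.
Qed.

(* The radial segment is horizontal, hence as long as in Euclidean space. *)
Lemma radial_distance (tau a b t h : R) (S : R3 -> Prop) :
  S (b * cos t, b * sin t, h) -> Rbar_le (dist_to tau (a * cos t, a * sin t, h) S) (Rabs (b - a)).
Proof.
  intros HS.
  set (c := fun v : R => ((a * cos t + (b - a) * cos t * v, a * sin t + (b - a) * sin t * v), h + 0 * v) : R3).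
  apply (dist_to_le tau _ S c).
  - intros [| |]; unfold c; simpl; apply C1_affine.
  - unfold c. apply f_equal2; [apply f_equal2|]; ring.
  - unfold c. replace (_, _, _) with (b * cos t, b * sin t, h); [assumption|].
    apply f_equal2; [apply f_equal2|]; ring.
  - unfold curve_length. rewrite (RInt_ext _ (fun _ => Rabs (b - a))).
    + rewrite RInt_const. unfold scal; simpl. unfold mult; simpl. ring.
    + intros u _. assert (Hv : velocity c u = ((b - a) * cos t, (b - a) * sin t, 0)).
      { unfold velocity, c; simpl. apply f_equal2; [apply f_equal2|];
          apply is_derive_unique; auto_derive; auto; ring. }
      rewrite Hv. unfold c, metric.
      transitivity (sqrt ((b - a)²)); [f_equal|apply sqrt_Rsqr_abs].
      assert (H := sin2_cos2 t). unfold Rsqr in *.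
      transitivity ((b - a) * (b - a) * (sin t * sin t + cos t * cos t)); [ring|rewrite H; ring].
Qed.

Lemma metric_speed_continuous (tau : R) (c : R -> R3) (u : R) :
  C1_curve c -> continuous (fun u => sqrt (metric tau (c u) (velocity c u) (velocity c u))) u.
Proof.
  intros Hc.
  assert (Hd : forall i, continuous (Derive (fun u => coord i (c u))) u) by (intros i; apply Hc).
  assert (H0 : forall i, continuous (fun u => coord i (c u)) u).
  { intros i. apply (@ex_derive_continuous R_AbsRing R_NormedModule). apply Hc. }
  assert (Hx := H0 ix_x). assert (Hy := H0 ix_y). assert (Hdx := Hd ix_x).
  assert (Hdy := Hd ix_y). assert (Hdz := Hd ix_z). clear H0 Hd.
  set (dx := Derive (fun u => coord ix_x (c u))) in *.
  set (dy := Derive (fun u => coord ix_y (c u))) in *.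
  set (dz := Derive (fun u => coord ix_z (c u))) in *.
  set (X := fun u => coord ix_x (c u)) in *. set (Y := fun u => coord ix_y (c u)) in *.
  apply (continuous_ext (fun u => sqrt (dx u * dx u + dy u * dy u
    + (dz u + tau * (Y u * dx u - X u * dy u)) * (dz u + tau * (Y u * dx u - X u * dy u))))).
  { intros v. unfold metric, velocity, X, Y. destruct (c v) as [[a b] h]. reflexivity. }
  repeat first [assumption | continuity_step].
Qed.

(** The metric dominates [dx^2 + dy^2], so length bounds the variation of the linear coordinate in
    the fixed direction [(cos t, sin t)]; this coordinate is [a] at the start and [0] on the
    axis. *)
Lemma axis_distance (tau a t h : R) :
  Rbar_le (Rabs a) (dist_to tau (a * cos t, a * sin t, h) rotation_axis).
Proof.
  apply dist_to_ge. intros c Hc Hc0 [Hx1 Hy1].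
  set (g := fun u => sqrt (metric tau (c u) (velocity c u) (velocity c u))).
  assert (Hg : forall u, continuous g u) by (intros; now apply metric_speed_continuous).
  set (f := fun u => coord ix_x (c u) * cos t + coord ix_y (c u) * sin t).
  set (df := fun u => Derive (fun u => coord ix_x (c u)) u * cos t + Derive (fun u => coord ix_y (c u)) u * sin t).
  assert (Hf : forall u, is_derive f u (df u)).
  { intros u. unfold f, df.
    assert (D1 := Derive_correct _ _ (proj1 (Hc ix_x u))). assert (D2 := Derive_correct _ _ (proj1 (Hc ix_y u))).
    apply (is_derive_plus (fun u => coord ix_x (c u) * cos t)).
    - apply (is_derive_ext (fun u => cos t * coord ix_x (c u))); [intros; apply Rmult_comm|].
      rewrite Rmult_comm. now apply (is_derive_scal (fun u => coord ix_x (c u))).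
    - apply (is_derive_ext (fun u => sin t * coord ix_y (c u))); [intros; apply Rmult_comm|].
      rewrite Rmult_comm. now apply (is_derive_scal (fun u => coord ix_y (c u))). }
  assert (Hfg : forall u, Rabs (df u) <= g u).
  { intros u. unfold g. rewrite <- sqrt_Rsqr_abs. apply sqrt_le_1_alt.
    unfold df, metric, velocity, Rsqr. destruct (c u) as [[X Y] Z].
    set (dx := Derive _ u). set (dy := Derive (fun v => coord ix_y (c v)) u). set (dz := Derive (fun v => coord ix_z (c v)) u).
    assert (H := sin2_cos2 t). unfold Rsqr in H.
    assert (H1 : 0 <= (dx * sin t - dy * cos t) ^ 2) by apply pow2_ge_0.
    assert (H2 : 0 <= (dz + tau * (Y * dx - X * dy)) ^ 2) by apply pow2_ge_0.
    assert (H3 : (dx * cos t + dy * sin t) * (dx * cos t + dy * sin t) + (dx * sin t - dy * cos t) ^ 2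
      = (dx * dx + dy * dy) * (sin t * sin t + cos t * cos t)) by ring.
    rewrite H in H3. lra. }
  set (G := (fun u => RInt g 0 u) : R -> R).
  assert (HG : forall u, is_derive G u (g u)) by (intros u; exact (integral_derive g u Hg)).
  change (Rabs a <= G 1).
  assert (G0 : G 0 = 0) by (unfold G; rewrite RInt_point; reflexivity).
  assert (F0 : f 0 = a).
  { unfold f. rewrite Hc0. simpl. assert (H := sin2_cos2 t). unfold Rsqr in H.
    transitivity (a * (sin t * sin t + cos t * cos t)); [ring|rewrite H; ring]. }
  assert (F1 : f 1 = 0) by (unfold f; rewrite Hx1, Hy1; ring).
  assert (H1 : 0 * (1 - 0) <= (G 1 - f 1) - (G 0 - f 0)).
  { eapply (increment_ge (fun u => G u - f u)); [lra| |].
    - intros u _. apply (is_derive_minus G f); auto.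
    - intros u _. unfold minus, plus, opp; simpl. specialize (Hfg u). apply Rabs_le_between in Hfg. lra. }
  assert (H2 : 0 * (1 - 0) <= (G 1 + f 1) - (G 0 + f 0)).
  { eapply (increment_ge (fun u => G u + f u)); [lra| |].
    - intros u _. apply (is_derive_plus G f); auto.
    - intros u _. unfold plus; simpl. specialize (Hfg u). apply Rabs_le_between in Hfg. lra. }
  apply Rabs_le. lra.
Qed.

(** * Rotational translators *)

Lemma sign_constant (f : R -> R) :
  (forall s, continuous f s) -> (forall s, f s ^ 2 = 1) -> forall s, f s = f 0.
Proof.
  intros Hc Hf s. assert (Hs := Hf s). assert (H0 := Hf 0).
  destruct (Req_dec (f s) (f 0)) as [H|H]; [assumption|exfalso].
  destruct (IVT_gen f s 0 0) as [t [_ Ht]].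
  - intros t. apply continuity_pt_filterlim, Hc.
  - assert (f s = - f 0) by nra. unfold Rmin, Rmax. repeat destruct Rle_dec; lra.
  - specialize (Hf t). rewrite Ht in Hf. lra.
Qed.

(** Invariance under the rotation by [- t] and a vertical translation; it brings the normal at angle
    [t] back to the half-plane [y = 0]. *)
Lemma metric_rotate (tau a h t n1 n2 n3 v1 v2 v3 : R) :
  metric tau (a * cos t, a * sin t, h) (n1, n2, n3)
    (v1 * cos t - v2 * sin t, v1 * sin t + v2 * cos t, v3) =
  metric tau (a, 0, 0) (n1 * cos t + n2 * sin t, n2 * cos t - n1 * sin t, n3) (v1, v2, v3).
Proof.
  unfold metric. assert (H := sin2_cos2 t). unfold Rsqr in H.
  transitivity ((n1 * cos t + n2 * sin t) * v1 + (n2 * cos t - n1 * sin t) * v2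
    + (n3 - tau * a * (n2 * cos t - n1 * sin t)) * (v3 - tau * a * v2 * (sin t * sin t + cos t * cos t))).
  - ring.
  - rewrite H. ring.
Qed.

Lemma smooth_derive (f : R -> R) : smooth f ->
  (forall s, is_derive f s (Derive f s)) /\ (forall s, is_derive (Derive f) s (Derive (Derive f) s)).
Proof.
  intros H. split; intros s; apply Derive_correct; [exact (H 1%nat s)|exact (H 2%nat s)].
Qed.

Lemma RInt_antiderivative_le (g h K : R -> R) (u : R) :
  0 <= u -> (forall v, continuous g v) -> (forall v, is_derive K v (h v)) ->
  (forall v, g v <= h v) -> RInt g 0 u <= K u - K 0.
Proof.
  intros Hu Hg HK Hle. set (G := (fun u => RInt g 0 u) : R -> R).
  assert (HG : forall u, is_derive G u (g u)) by (intros v; exact (integral_derive g v Hg)).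
  assert (G0 : G 0 = 0) by (unfold G; rewrite RInt_point; reflexivity).
  assert (H : 0 * (u - 0) <= (K u - G u) - (K 0 - G 0)).
  { eapply (increment_ge (fun u => K u - G u)); [assumption| |].
    - intros v _. apply (is_derive_minus K G); auto.
    - intros v _. unfold minus, plus, opp; simpl. specialize (Hle v). lra. }
  change (G u <= K u - K 0). lra.
Qed.

Section Translator.
Variables (tau lam : R) (x z : R -> R) (N : R -> R -> R3).
Hypothesis (hx : smooth x) (hz : smooth z).
Hypothesis himm : immersion (rot_surface x z).
Hypothesis hcomplete : complete_surface tau x z.
Hypothesis hN : unit_normal tau (rot_surface x z) N.
Hypothesis htrans : translator tau lam (rot_surface x z) N.
Hypothesis haxis : forall s t : R, ~ rotation_axis (rot_surface x z s t).

Let x1 := Derive x.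
Let z1 := Derive z.
Let x2 := Derive x1.
Let z2 := Derive z1.
Let dx : forall s, is_derive x s (x1 s) := proj1 (smooth_derive x hx).
Let dz : forall s, is_derive z s (z1 s) := proj1 (smooth_derive z hz).
Let dx1 : forall s, is_derive x1 s (x2 s) := proj2 (smooth_derive x hx).
Let dz1 : forall s, is_derive z1 s (z2 s) := proj2 (smooth_derive z hz).
Let speed (s : R) : R := sqrt (speed_sqr tau (x s) (x1 s) (z1 s)).

Lemma radius_nonzero s : x s <> 0.
Proof. intros H. apply (haxis s 0). unfold rotation_axis, rot_surface; simpl. rewrite H. split; ring. Qed.

Lemma speed_sqr_pos s : 0 < speed_sqr tau (x s) (x1 s) (z1 s).
Proof.
  unfold speed_sqr. assert (H := warp_arg_pos tau (x s)).
  assert (H1 : 0 <= x1 s ^ 2) by apply pow2_ge_0. assert (H2 : 0 <= z1 s ^ 2) by apply pow2_ge_0.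
  destruct (Rle_lt_or_eq_dec 0 ((1 + tau ^ 2 * x s ^ 2) * x1 s ^ 2 + z1 s ^ 2)) as [Hl|He]; [nra|assumption|].
  exfalso. destruct (himm s 0 1 0) as [H3 _]; [|lra].
  assert (Hz0 : z1 s = 0) by nra. assert (Hx0 : x1 s = 0) by nra.
  rewrite (partial_s_eq x z x1 z1 dx dz), Hz0, Hx0. intros [| |]; simpl; ring.
Qed.

Lemma speed_pos s : 0 < speed s.
Proof. apply sqrt_lt_R0, speed_sqr_pos. Qed.

Lemma speed_sqr_eq s : speed s ^ 2 = speed_sqr tau (x s) (x1 s) (z1 s).
Proof. apply pow2_sqrt. left. apply speed_sqr_pos. Qed.

Lemma speed_derive s : is_derive speed s
  (((1 + tau ^ 2 * x s ^ 2) * (x1 s * x2 s) + tau ^ 2 * x s * x1 s ^ 3 + z1 s * z2 s) / speed s).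
Proof.
  assert (H := speed_pos s). assert (H' := speed_sqr_pos s). unfold speed, speed_sqr in *.
  derive_hyps.
  - exact H'.
  - match goal with |- context [sqrt ?e] => match goal with |- _ = _ / sqrt ?f => replace e with f by ring end end.
    field. lra.
Qed.

(** The sign [sg] of [unit_normal_eq], for [N s t] rotated back by the angle [t]. *)
Definition normal_sign (s t : R) : R :=
  let '(n1, n2, n3) := N s t in
  let a := n1 * cos t + n2 * sin t in
  let b := n2 * cos t - n1 * sin t in
  (- a * z1 s + (1 + tau ^ 2 * x s ^ 2) * (n3 - tau * x s * b) * x1 s) / speed s.

Lemma normal_eq s t :
  normal_sign s t ^ 2 = 1 /\
  metric tau (rot_surface x z s t) (N s t) (cos t, sin t, 0) = - (normal_sign s t / speed s) * z1 s /\
  metric tau (rot_surface x z s t) (N s t) d_z = normal_sign s t * x1 s / speed s /\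
  (t = 0 -> N s t = (- (normal_sign s t / speed s) * z1 s, normal_sign s t / speed s * (tau * x s * x1 s),
     normal_sign s t / speed s * ((1 + tau ^ 2 * x s ^ 2) * x1 s))).
Proof.
  destruct (proj1 hN s t) as (H1&H2&H3). unfold normal_sign, rot_surface.
  rewrite (partial_s_eq x z x1 z1 dx dz) in H2. rewrite (partial_t_eq x z) in H3. unfold rot_surface in *.
  destruct (N s t) as [[n1 n2] n3].
  set (a := n1 * cos t + n2 * sin t) in *. set (b := n2 * cos t - n1 * sin t) in *.
  assert (Hsc := sin2_cos2 t). unfold Rsqr in Hsc.
  assert (M : forall v1 v2 v3, metric tau (x s * cos t, x s * sin t, z s) (n1, n2, n3)
    (v1 * cos t - v2 * sin t, v1 * sin t + v2 * cos t, v3) = metric tau (x s, 0, 0) (a, b, n3) (v1, v2, v3))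
    by (intros; apply metric_rotate).
  assert (R1 : metric tau (x s, 0, 0) (a, b, n3) (a, b, n3) = 1).
  { rewrite <- M. etransitivity; [|exact H1]. f_equal.
    unfold a, b. apply f_equal2; [apply f_equal2|reflexivity].
    - transitivity (n1 * (sin t * sin t + cos t * cos t)); [ring|rewrite Hsc; ring].
    - transitivity (n2 * (sin t * sin t + cos t * cos t)); [ring|rewrite Hsc; ring]. }
  assert (R2 : metric tau (x s, 0, 0) (a, b, n3) (x1 s, 0, z1 s) = 0).
  { rewrite <- M. etransitivity; [|exact H2]. f_equal.
    apply f_equal2; [apply f_equal2|reflexivity]; ring. }
  assert (R3 : metric tau (x s, 0, 0) (a, b, n3) (0, x s, 0) = 0).
  { rewrite <- M. etransitivity; [|exact H3]. f_equal.
    apply f_equal2; [apply f_equal2|reflexivity]; ring. }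
  destruct (unit_normal_eq tau (x s) (x1 s) (z1 s) a b n3 (radius_nonzero s) (speed_sqr_pos s) R1 R2 R3)
    as (S1&S2&S3&S4&S5).
  fold (speed s) in *. split; [exact S1|]. split; [|split].
  - rewrite <- S2. transitivity (metric tau (x s, 0, 0) (a, b, n3) (1, 0, 0)).
    + rewrite <- M. f_equal.
      apply f_equal2; [apply f_equal2|reflexivity]; ring.
    + unfold metric. ring.
  - rewrite <- S5. transitivity (metric tau (x s, 0, 0) (a, b, n3) (0, 0, 1)).
    + rewrite <- M. f_equal.
      unfold d_z, basis. apply f_equal2; [apply f_equal2|reflexivity]; ring.
    + unfold metric. ring.
  - intros Ht0. rewrite <- S2, <- S3, <- S4. unfold a, b. rewrite Ht0, cos_0, sin_0.
    apply f_equal2; [apply f_equal2|reflexivity]; ring.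
Qed.

Lemma normal_sign_constant s : normal_sign s 0 = normal_sign 0 0.
Proof.
  apply (sign_constant (fun s => normal_sign s 0)); [|intros u; apply normal_eq].
  intros u.
  assert (HN : continuous (fun s => N s 0) u).
  { apply (continuous_comp (fun s : R => (s, 0)) (fun q => N (fst q) (snd q))); [|apply hN].
    apply continuous_pair; [apply continuous_id|apply continuous_const]. }
  assert (Hn : forall i, continuous (fun s => coord i (N s 0)) u).
  { intros i. apply (continuous_comp (fun s => N s 0) (coord i)); [exact HN|apply coord_continuous]. }
  assert (H1 := Hn ix_x). assert (H2 := Hn ix_y). assert (H3 := Hn ix_z).
  set (n1 := fun s => coord ix_x (N s 0)) in *. set (n2 := fun s => coord ix_y (N s 0)) in *.
  set (n3 := fun s => coord ix_z (N s 0)) in *.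
  assert (Hx := continuous_of_derive _ _ dx u). assert (Hx1 := continuous_of_derive _ _ dx1 u).
  assert (Hz1 := continuous_of_derive _ _ dz1 u).
  assert (HW : continuous (fun s => / speed s) u).
  { apply (continuous_comp speed Rinv); [apply (continuous_of_derive _ _ speed_derive)|].
    apply continuous_Rinv. apply Rgt_not_eq, speed_pos. }
  apply (continuous_ext (fun s => (- (n1 s * cos 0 + n2 s * sin 0) * z1 s
    + (1 + tau * tau * (x s * x s)) * (n3 s - tau * x s * (n2 s * cos 0 - n1 s * sin 0)) * x1 s) * / speed s)).
  { intros v. unfold normal_sign, n1, n2, n3. destruct (N v 0) as [[a b] c]; simpl. unfold Rdiv. ring. }
  repeat first [assumption | continuity_step].
Qed.

Lemma radius_sign : exists de, de ^ 2 = 1 /\ forall s, 0 < de * x s.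
Proof.
  assert (Hc := continuous_of_derive _ _ dx).
  assert (H : forall s, 0 < x 0 * x s).
  { intros s. apply Rnot_le_lt. intros Hs.
    destruct (IVT_gen x 0 s 0) as [t [_ Ht]]; [intros u; apply continuity_pt_filterlim, Hc| |now apply (radius_nonzero t)].
    unfold Rmin, Rmax. repeat destruct Rle_dec; split; nra. }
  assert (H0 := radius_nonzero 0).
  destruct (Rlt_le_dec 0 (x 0)) as [H1|H1].
  - exists 1. split; [ring|]. intros s. specialize (H s). nra.
  - exists (-1). split; [ring|]. intros s. specialize (H s). nra.
Qed.

(** Completeness is applied to the meridian [theta = 0]. Its length integrates
    [sqrt (x1 ^ 2 + z1 ^ 2)], which [speed] dominates thanks to the factor [1 + tau ^ 2 * x ^ 2]. *)
Lemma arc_length_diverges (eta : R) (L : R -> R) : eta ^ 2 = 1 ->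
  (forall s, is_derive L s (speed s)) -> is_lim (fun u => eta * L (eta * u)) p_infty p_infty.
Proof.
  intros Heta HL.
  assert (Hlin : forall v, is_derive (fun v => eta * v) v eta) by (intros; auto_derive; [trivial|ring]).
  assert (Hsig : Defs.C1 (fun v => eta * v)).
  { intros v. split; [now exists eta|].
    apply (continuous_ext (fun _ => eta)); [|apply continuous_const].
    intros w. symmetry. apply is_derive_unique, Hlin. }
  assert (Hth : Defs.C1 (fun _ => 0)).
  { intros v. split; [exists 0; apply (@is_derive_const R_AbsRing R_NormedModule)|].
    apply (continuous_ext (fun _ => 0)); [|apply continuous_const].
    intros w. symmetry. apply Derive_const. }
  assert (Habs : is_lim (fun u => Rabs (eta * u)) p_infty p_infty).
  { apply is_lim_spec. intros M. exists (Rabs M). intros u Hu.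
    rewrite Rabs_mult. rewrite (abs_of_sqr_1 eta Heta).
    assert (H1 := Rle_abs M). assert (H2 := Rle_abs u). lra. }
  assert (Lim := hcomplete _ _ Hsig Hth Habs).
  apply (is_lim_le_p_loc (fun u => curve_length tau (fun v => rot_surface x z (eta * v) 0) 0 u + eta * L (eta * 0))).
  2:{ apply (is_lim_plus _ _ _ p_infty (eta * L (eta * 0)) p_infty Lim); [apply is_lim_const|reflexivity]. }
  exists 0. intros u Hu. unfold curve_length.
  set (g := fun v => sqrt (x1 (eta * v) * x1 (eta * v) + z1 (eta * v) * z1 (eta * v))).
  assert (Hg : forall v, continuous g v).
  { intros v. assert (Hc : forall f : R -> R, (forall s : R, continuous f s) -> continuous (fun v : R => f (eta * v)) v).
    { intros f Hf. apply (continuous_comp (fun v => eta * v) f); [|apply Hf].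
      apply (continuous_of_derive _ _ Hlin). }
    assert (H1 := Hc _ (continuous_of_derive _ _ dx1)). assert (H2 := Hc _ (continuous_of_derive _ _ dz1)).
    unfold g. set (X := fun v => x1 (eta * v)) in *. set (Z := fun v => z1 (eta * v)) in *.
    change (continuous (fun v => sqrt (X v * X v + Z v * Z v)) v).
    repeat first [assumption | continuity_step]. }
  rewrite (RInt_ext _ g).
  - assert (H := RInt_antiderivative_le g (fun v => speed (eta * v)) (fun v => eta * L (eta * v)) u).
    cbv beta in H. cut (RInt g 0 u <= eta * L (eta * u) - eta * L (eta * 0)); [intros; lra|]. apply H.
    + lra.
    + exact Hg.
    + intros v. evar_last; [apply (is_derive_scal (fun v => L (eta * v))), derive_scaled, HL|].
      transitivity (eta ^ 2 * speed (eta * v)); [simpl; ring|rewrite Heta; ring].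
    + intros v. unfold g, speed. apply sqrt_le_1_alt. unfold speed_sqr.
      assert (H1 : 0 <= x1 (eta * v) ^ 2) by apply pow2_ge_0.
      assert (H2 : 0 <= (tau * x (eta * v)) ^ 2) by apply pow2_ge_0.
      assert (H3 : 0 <= (tau * x (eta * v)) ^ 2 * x1 (eta * v) ^ 2) by now apply Rmult_le_pos. nra.
  - intros v _. unfold g, rot_surface.
    assert (Hv : velocity (fun v => (x (eta * v) * cos 0, x (eta * v) * sin 0, z (eta * v))) v
      = (eta * x1 (eta * v), 0, eta * z1 (eta * v))).
    { unfold velocity; simpl. rewrite cos_0, sin_0.
      assert (Dx := derive_scaled x eta v _ (dx (eta * v))). assert (Dz := derive_scaled z eta v _ (dz (eta * v))).
      apply f_equal2; [apply f_equal2|].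
      - rewrite (Derive_ext _ (fun v => x (eta * v))) by (intros; ring). now apply is_derive_unique.
      - rewrite (Derive_ext _ (fun v => 0)) by (intros; ring). apply Derive_const.
      - now apply is_derive_unique. }
    rewrite Hv. unfold metric. rewrite cos_0, sin_0. f_equal.
    transitivity (eta ^ 2 * (x1 (eta * v) * x1 (eta * v) + z1 (eta * v) * z1 (eta * v))); [ring|rewrite Heta; ring].
Qed.

(** Passes from the surface to the planar system. The last two clauses are what is later needed of
    the normal: [|q|] measures how close the tangent plane is to that of a cylinder, and [p = 0]
    makes [<N, d_z>] vanish. *)
Lemma translator_flow : lam <> 0 ->
  exists (de mu : R) (rho p q L : R -> R),
    de ^ 2 = 1 /\ mu <> 0 /\ Rabs mu = Rabs lam /\
    flow tau mu rho (fun s => de * x s) z p q /\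
    (forall s, 0 < rho s) /\ (forall s, continuous rho s) /\
    (forall s, is_derive L s (rho s * warp tau (de * x s))) /\
    is_lim L p_infty p_infty /\ is_lim L m_infty m_infty /\
    (forall s t, Rabs (metric tau (rot_surface x z s t) (N s t) (cos t, sin t, 0)) = Rabs (q s)) /\
    (forall s t, p s = 0 -> metric tau (rot_surface x z s t) (N s t) d_z = 0).
Proof.
  intros Hlam. destruct radius_sign as [de [Hde Hpos]]. set (sg := normal_sign 0 0).
  assert (Hsg : sg ^ 2 = 1) by apply normal_eq.
  assert (Hwd : forall s, warp tau (de * x s) = warp tau (x s)).
  { intros s. now apply warp_sign. }
  assert (HL : forall s, is_derive ((fun s => RInt speed 0 s) : R -> R) s (speed s)).
  { intros s. apply integral_derive. apply (continuous_of_derive _ _ speed_derive). }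
  exists de, (de * sg * lam), (fun s => speed s / warp tau (x s)),
    (fun s => de * x1 s * warp tau (x s) / speed s), (fun s => z1 s / speed s), (fun s => RInt speed 0 s).
  assert (Hmu : Rabs (de * sg * lam) = Rabs lam).
  { rewrite !Rabs_mult, (abs_of_sqr_1 de), (abs_of_sqr_1 sg) by assumption. ring. }
  split; [assumption|]. split.
  { intros H. apply Hlam. rewrite H, Rabs_R0 in Hmu. symmetry in Hmu. now apply Rabs_eq_0. }
  split; [assumption|]. split; [|split; [|split; [|split; [|split; [|split; [|split]]]]]].
  - apply (profile_flow tau lam sg de x z x1 z1 x2 z2 speed); auto using speed_pos, speed_sqr_eq, speed_derive.
    intros s. destruct (normal_eq s 0) as (_&_&H3&H4). specialize (H4 eq_refl).
    rewrite normal_sign_constant in H3, H4. fold sg in H3, H4.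
    assert (HW := speed_pos s). assert (HW2 := speed_sqr_pos s). assert (Hx0 := radius_nonzero s).
    assert (HH := mean_curvature_eq x z x1 z1 x2 z2 dx dz dx1 dz1 tau N (sg / speed s) s Hx0
      ltac:(lra) H4).
    rewrite (htrans s 0), H3 in HH. set (V := speed_sqr tau (x s) (x1 s) (z1 s)) in *.
    set (Qs := z1 s * V + _ - _) in *.
    (* Multiplying the translator equation by [sg], with [sg ^ 2 = 1], moves the orientation onto
       [lam]. *)
    assert (Hsl : sg * (sg * x1 s / speed s + lam) = (x1 s + sg * lam * speed s) / speed s).
    { transitivity (sg ^ 2 * x1 s / speed s + sg * lam); [field; lra|]. rewrite Hsg. field. lra. }
    rewrite HH in Hsl.
    assert (Hsl' : Qs / (2 * x s * V) = x1 s + sg * lam * speed s).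
    { apply (Rmult_eq_reg_r (/ speed s)); [|apply Rinv_neq_0_compat; lra].
      fold (Rdiv (x1 s + sg * lam * speed s) (speed s)). rewrite <- Hsl.
      transitivity (sg ^ 2 * (Qs / (2 * x s * V)) / speed s); [rewrite Hsg|]; field; lra. }
    rewrite <- Hsl'. field. lra.
  - intros s. apply Rdiv_lt_0_compat; [apply speed_pos|apply warp_pos].
  - intros s. unfold Rdiv. apply (continuous_mult speed).
    + apply (continuous_of_derive _ _ speed_derive).
    + apply (continuous_comp (fun s => warp tau (x s)) Rinv).
      * apply (continuous_comp x (warp tau)); [apply (continuous_of_derive _ _ dx)|].
        apply (continuous_of_derive _ _ (warp_derive tau)).
      * apply continuous_Rinv. apply Rgt_not_eq, warp_pos.
  - intros s. rewrite Hwd. evar_last; [apply HL|]. field. apply Rgt_not_eq, warp_pos.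
  - apply (is_lim_ext (fun u => 1 * RInt speed 0 (1 * u))); [intros; now rewrite !Rmult_1_l|].
    apply (arc_length_diverges 1 (fun s => RInt speed 0 s)); [ring|exact HL].
  - assert (H := arc_length_diverges (-1) (fun s => RInt speed 0 s) ltac:(ring) HL).
    apply (is_lim_reverse _ m_infty) in H.
    apply (is_lim_opp _ m_infty) in H. apply is_lim_ext with (2 := H). intros s.
    replace (-1 * - s) with s by ring. ring.
  - intros s t. destruct (normal_eq s t) as (H1&H2&_). rewrite H2.
    replace (- (normal_sign s t / speed s) * z1 s) with (normal_sign s t * - (z1 s / speed s))
      by (field; apply Rgt_not_eq, speed_pos).
    rewrite Rabs_mult, Rabs_Ropp, (abs_of_sqr_1 _ H1). ring.
  - intros s t Hp. destruct (normal_eq s t) as (_&_&H3&_). rewrite H3.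
    assert (Hx1 : x1 s = 0).
    { assert (HW := speed_pos s). assert (Hw := warp_pos tau (x s)).
      assert (E : x1 s = de * (de * x1 s * warp tau (x s) / speed s) * (speed s / warp tau (x s))).
      { transitivity (de ^ 2 * x1 s); [rewrite Hde; ring|]. field. lra. }
      rewrite E, Hp. ring. }
    rewrite Hx1. field. apply Rgt_not_eq, speed_pos.
Qed.
End Translator.

Lemma end_limit (f : R -> R) (e l : Rbar) (P : R -> Prop) :
  e = p_infty \/ e = m_infty -> is_lim f e l -> Rbar_locally l P -> Rbar_locally e (fun s => P (f s)).
Proof. intros [-> | ->] Hl HP; exact (Hl P HP). Qed.

Lemma end_meets (e : Rbar) (D : R -> Prop) :
  e = p_infty \/ e = m_infty -> Rbar_locally e D -> exists s, D s.
Proof.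
  intros [-> | ->] [M HM]; [exists (M + 1)|exists (M - 1)]; apply HM; lra.
Qed.

Lemma list_lower_bound (l : list R3) : exists m, forall p, In p l -> m <= coord ix_z p.
Proof.
  induction l as [|a l [m Hm]].
  - exists 0. intros p [].
  - exists (Rmin (coord ix_z a) m). intros p [<-|Hp]; [apply Rmin_l|].
    eapply Rle_trans; [apply Rmin_r|auto].
Qed.

Theorem theorem1p4 (tau lam : R) (x z : R -> R) (N : R -> R -> R3)
  (htau : tau <> 0) (hlam : lam <> 0)
  (hx : smooth x) (hz : smooth z)
  (himm : immersion (rot_surface x z))
  (hcomplete : complete_surface tau x z)
  (hN : unit_normal tau (rot_surface x z) N)
  (htrans : translator tau lam (rot_surface x z) N)
  (haxis : forall s t : R, ~ rotation_axis (rot_surface x z s t)) :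
  is_cylinder tau lam (rot_surface x z) N \/
  (properly_immersed_annulus x z /\
   infinitely_many_self_intersections x z (fun _ => True) /\
   exists e1 e2 : Rbar, opposite_ends e1 e2 /\
     (is_lim z e1 p_infty /\
      embedded_end x z e1 /\
      converges_to_cylinder tau lam x z N e1) /\
     (is_lim z e2 m_infty /\
      (forall D : R -> Prop, Rbar_locally e2 D ->
         infinitely_many_self_intersections x z D) /\
      unbounded_distance_to_axis tau x z e2)).
Proof.
  destruct (translator_flow tau lam x z N hx hz himm hcomplete hN htrans haxis hlam)
    as (de&mu&rho&p&q&L&Hde&Hmu&Habs&F&Hrho&Hcrho&HL&L1&L2&Hrad&Hvert).
  assert (Hpos := flow_pos _ _ _ _ _ _ _ F). cbv beta in Hpos.
  assert (Cx := continuous_of_derive _ _ (proj1 (smooth_derive x hx))).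
  assert (Cz := continuous_of_derive _ _ (proj1 (smooth_derive z hz))).
  assert (Hx0 : forall s, x s <> 0) by (intros s H; specialize (Hpos s); rewrite H in Hpos; lra).
  assert (Hal : 0 < Rabs lam) by now apply Rabs_pos_lt.
  assert (Hx_de : forall s, x s = de * (de * x s)).
  { intros s. transitivity (de ^ 2 * x s); [rewrite Hde|]; ring. }
  assert (Hradius : forall R0, R0 ^ 2 = 1 -> (R0 * / (2 * Rabs lam)) ^ 2 = (/ (2 * lam)) ^ 2).
  { intros R0 HR0. rewrite Rpow_mult_distr, HR0, Rmult_1_l, !pow_inv. f_equal.
    rewrite !Rpow_mult_distr, pow2_abs. reflexivity. }
  destruct (flow_ends tau mu rho _ z p q L htau Hmu F Hrho Hcrho HL L1 L2)
    as [(c&Hc&Hcyl)|(e1&e2&Hends&H1&H2&H3&(D&g&HD&Hg&HgD)&H4&H5&H6)]; rewrite Habs in *.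
  - left. split.
    + intros P. split.
      * intros HP.
        assert (Hr := Hradius de Hde).
        assert (Hxs : forall s, x s = de * / (2 * Rabs lam)).
        { intros s. rewrite Hx_de. now rewrite (proj1 (Hcyl s)). }
        set (r := de * / (2 * Rabs lam)) in *. assert (Hr0 : r <> 0) by (rewrite <- (Hxs 0); apply Hx0).
        destruct P as [[a b] h]. unfold cylinder in HP; simpl coord in HP.
        destruct (unit_angle (a / r) (b / r)) as [t [Hct Hst]].
        { transitivity ((a ^ 2 + b ^ 2) / r ^ 2); [field; auto|]. rewrite HP, <- Hr. field. auto. }
        (* With [q = c] the height and [c * L] have the same derivative. Since [L] takes every real
           value, so does the height, and the whole cylinder is covered. *)
        assert (HzL : forall s, z s - c * L s = z 0 - c * L 0).
        { assert (Hd : forall s, is_derive (fun s => z s - c * L s) s 0).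
          { intros s. evar_last.
            - apply (is_derive_minus z (fun s => c * L s)); [apply (flow_z _ _ _ _ _ _ _ F)|].
              apply (is_derive_scal L), HL.
            - destruct (Hcyl s) as (_&Hq&_). rewrite Hq. unfold minus, plus, opp; simpl. ring. }
          exact (constant_of_derive _ Hd). }
        destruct (IVT_Rbar_incr L m_infty p_infty m_infty p_infty (c * (h - z 0) + L 0)) as [s [_ [_ Hs]]];
          auto; [intros; apply continuity_pt_filterlim; eapply continuous_of_derive, HL|exact I|split; exact I|].
        exists s, t. unfold rot_surface. rewrite Hxs, Hct, Hst.
        apply f_equal2; [apply f_equal2; field; auto|].
        specialize (HzL s). rewrite Hs in HzL.
        transitivity (z 0 + c ^ 2 * (h - z 0)); [|rewrite Hc; ring]. lra.
      * intros (s&t&<-). unfold cylinder, rot_surface; simpl coord.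
        rewrite Hx_de, (proj1 (Hcyl s)). rewrite <- (Hradius de Hde).
        assert (Hsc := sin2_cos2 t). unfold Rsqr in Hsc.
        transitivity ((de * / (2 * Rabs lam)) ^ 2 * (sin t * sin t + cos t * cos t)); [ring|].
        rewrite Hsc. ring.
    + intros s t. rewrite htrans, (Hvert s t); [ring|]. apply Hcyl.
  - right.
    assert (E1 : e1 = p_infty \/ e1 = m_infty) by (destruct Hends as [[]|[]]; auto).
    assert (E2 : e2 = p_infty \/ e2 = m_infty) by (destruct Hends as [[]|[]]; auto).
    assert (Hself : forall D : R -> Prop, Rbar_locally e2 D -> infinitely_many_self_intersections x z D).
    (* The height tends to [-oo] along this end, so a crossing below all the points of [l] is a new
       one. *)
    { intros D' HD' l. destruct (list_lower_bound l) as [m Hm].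
      destruct (H6 (fun s => D' s /\ z s < m)) as (s&t&Hst&[Hs1 Hs2]&[Ht1 Ht2]&Hxx&Hzz).
      - apply filter_and; [assumption|]. apply (end_limit z e2 m_infty (fun y => y < m) E2 H5).
        now exists m.
      (* The point [(de, 0)] of the circle puts the intersection in the half-plane [x > 0], on
         whichever side of the axis the profile lies. *)
      - exists (de * x s, 0, z s). simpl coord. repeat split; [apply Hpos| |].
        + assert (Hann : forall u, annulus (u, (de, 0))).
          { intros u. unfold annulus; simpl fst; simpl snd. rewrite Hde. ring. }
          exists (s, (de, 0)), (t, (de, 0)).
          do 4 (split; [solve [apply Hann | assumption]|]). split; [|split].
          * intros He. now injection He.
          * simpl. apply f_equal2; [apply f_equal2|reflexivity]; ring.
          * simpl. rewrite Hxx, Hzz. apply f_equal2; [apply f_equal2|reflexivity]; ring.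
        + intros Hin. specialize (Hm _ Hin). simpl in Hm. lra. }
    assert (Hproper : forall B, exists M, forall s, Rabs (z s) <= B -> Rabs s <= M).
    { intros B. assert (A1 := end_limit z e1 p_infty (fun y => B < y) E1 H3 ltac:(now exists B)).
      assert (A2 := end_limit z e2 m_infty (fun y => y < - B) E2 H5 ltac:(now exists (- B))).
      assert (A3 : Rbar_locally p_infty (fun s => B < Rabs (z s)) /\ Rbar_locally m_infty (fun s => B < Rabs (z s))).
      { assert (I1 : forall y, B < y -> B < Rabs y) by (intros y Hy; assert (G := Rle_abs y); lra).
        assert (I2 : forall y, y < - B -> B < Rabs y) by (intros y Hy; assert (G := Rabs_maj2 y); lra).
        destruct Hends as [[-> ->]|[-> ->]]; split;
          first [revert A1; apply filter_imp; intros; now apply I1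
                |revert A2; apply filter_imp; intros; now apply I2]. }
      destruct A3 as [[M1 HM1] [M2 HM2]]. exists (Rabs M1 + Rabs M2). intros s Hs.
      assert (G1 := Rle_abs M1). assert (G2 := Rabs_maj2 M2). assert (G3 := Rabs_pos M1). assert (G4 := Rabs_pos M2).
      apply Rabs_le. split; apply Rnot_lt_le; intros Hlt.
      - specialize (HM2 s ltac:(lra)). lra.
      - specialize (HM1 s ltac:(lra)). lra. }
    split; [split; [exact himm|now apply proper_annulus]|].
    split; [apply (Hself (fun _ => True)); apply filter_true|].
    exists e1, e2. split; [exact Hends|]. split; split; [exact H3| |exact H5|].
    + split.
      * exists D. split; [assumption|]. now apply (embedded_of_left_inverse x z g D).
      * intros eps Heps.
        assert (B1 := end_limit _ e1 _ (fun y => Rabs (y - / (2 * Rabs lam)) < eps) E1 H1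
          ltac:(exists (mkposreal eps Heps); intros y Hy; exact Hy)).
        assert (B2 := end_limit _ e1 _ (fun y => Rabs (y - 1) < eps) E1 H2
          ltac:(exists (mkposreal eps Heps); intros y Hy; exact Hy)).
        generalize (filter_and _ _ B1 B2). apply filter_imp. intros s [Hs1 Hs2] t. split; [|now rewrite Hrad].
        eapply Rbar_le_lt_trans.
        (* The limit of [x s] is [de / (2 * Rabs lam)], with the sign of the profile, so the radial
           segment to the cylinder does not go through the axis. *)
        -- apply (radial_distance tau (x s) (de * / (2 * Rabs lam)) t (z s)).
           unfold cylinder; simpl coord. rewrite <- (Hradius de Hde).
           assert (Hsc := sin2_cos2 t). unfold Rsqr in Hsc.
           transitivity ((de * / (2 * Rabs lam)) ^ 2 * (sin t * sin t + cos t * cos t)); [ring|].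
           rewrite Hsc. ring.
        -- simpl. assert (Hd1 := abs_of_sqr_1 de Hde).
           rewrite Hx_de. replace (de * / (2 * Rabs lam) - de * (de * x s))
             with (- (de * (de * x s - / (2 * Rabs lam)))) by ring.
           rewrite Rabs_Ropp, Rabs_mult, Hd1, Rmult_1_l. exact Hs1.
    + split; [exact Hself|]. intros B D' HD'.
      assert (B1 := end_limit _ e2 _ (fun y => B < y) E2 H4 ltac:(now exists B)).
      destruct (end_meets e2 _ E2 (filter_and _ _ HD' B1)) as [s [Hs1 Hs2]].
      exists s, 0. split; [assumption|].
      eapply Rbar_lt_le_trans; [|apply (axis_distance tau (x s) 0 (z s))].
      simpl. eapply Rlt_le_trans; [exact Hs2|].
      assert (Hd1 := abs_of_sqr_1 de Hde).
      rewrite <- (Rmult_1_l (Rabs (x s))), <- Hd1, <- Rabs_mult. apply Rle_abs.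
Qed.
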